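(* Let $A_i\subset\mathbb{R}^d$ ($i=1,2,\ldots,N$) be measurable sets satisfying $|A_i\cap A_j|=0$ when $i\ne j$. Let $a_i,c_i>0$ be constants and let $u_i(x,t)$ be the solution to $$\partial_t u_i=a_i\Delta u_i\ \text{ in }\ \mathbb{R}^d\times(0,T),\qquad u_i(\cdot,0)=u_{0,i}:=c_i\chi_{A_i}\ \text{ on }\ \mathbb{R}^d,$$ for $i=1,2,\ldots,N$. Put $k_{i,j}=\sqrt{a_j/a_i}$. (i) Let $\hat{x}\in\mathbb{R}^d\setminus\big(\bigcup_{i=1}^N\overline{A_i}\big)$. Assume that for $i=1,\ldots,N$: (A1) $r\mapsto\bar{u}_{0,i}(r;\hat{x})$ is piecewise continuous (with possibly countably many discontinuities having at most finitely many accumulation points); (A2) $\bar{u}_{0,i}(r;\hat{x})$ is either left or right continuous at its discontinuities; and that the number of changes of sign $Z[\bar{w}_{0,i,j}]$ for $$\bar{w}_{0,i,j}(r;\hat{x}):=\bar{u}_{0,i}(r;\hat{x})-\bar{u}_{0,j}(k_{i,j}r;\hat{x})$$ is locally finite whenever $i\ne j$. Then $S_D[u_{0,i}-u_{0,j}](\hat{x})$ is well-defined whenever $i\ne j$. Moreover, the relation $u_{0,i}\succsim u_{0,j}$, defined by $S_D[u_{0,i}-u_{0,j}](\hat{x})\ge 0$, is a preorder on $\{u_{0,1},\ldots,u_{0,N}\}$ at $\hat{x}$. (ii) Under the hypothesis of (i), the classification sets defined by $$S_i=\{x\in\mathbb{R}^d\mid S_D[u_{0,i}-u_{0,j}](x)=1\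 \text{ for } j\ne i\}$$ satisfy $$\mathrm{int}\,S_i\supset\Big\{x\in\mathbb{R}^d\ \Big|\ d_e(x,A_i)<\tfrac{1}{k_{i,j}}\,d_e(x,A_j)\ \text{ for } j\ne i\Big\}.$$
   Context: $|E|$ denotes the Lebesgue measure of $E\subset\mathbb{R}^d$, $\chi_A$ is the characteristic function of $A$, $B_r(x)=\{y\in\mathbb{R}^d\mid |y-x|<r\}$, and $\mathrm{int}$ denotes the topological interior. Essential distance: $d_e(x,A)=\sup\{r\ge 0\mid |B_r(x)\cap A|=0\}$. Solutions of the heat equations are the unique bounded solutions (given by convolution of the initial datum with the heat kernel). Sign function: $\mathrm{sgn}(s)=-1$ if $s<0$, $0$ if $s=0$, $1$ if $s>0$. Diffusive sign: $S_D[u_{0,i}-u_{0,j}](x)=\lim_{t\downarrow 0}\mathrm{sgn}(u_i(x,t)-u_j(x,t))$; it is well-defined at $x$ if this limit exists. Radial average: for a measurable function $w\colon\mathbb{R}^d\to\mathbb{R}$ and $\hat{x}\in\mathbb{R}^d$, for $r\in\mathbb{R}$, $$\bar{w}(r;\hat{x})=\frac{w(\hat{x}+r)+w(\hat{x}-r)}{2}\ \text{ if } d=1,\qquad \bar{w}(r;\hat{x})=\frac{1}{\mathcal{H}^{d-1}(\{|\omega|=1\})}\int_{|\omega|=1} w(\hat{x}+|r|\omega)\,d\mathcal{H}^{d-1}(\omega)\ \text{ if } d\ge 2.$$ Sign changing number: for $f\colon\mathbb{R}\to\mathbb{R}$ and an interval $I\subset\mathbb{R}$, $Z_I[f]$ is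 the supremum of all $m\ge 0$ such that there exist $\xi_0<\xi_1<\cdots<\xi_m$ in $I$ with $f(\xi_{l-1})f(\xi_l)<0$ for $l=1,\ldots,m$; and $Z[f]=Z_{\mathbb{R}}[f]$. One says that $Z[f]$ is locally finite if $Z_I[f]$ is finite for all bounded open intervals $I$. *)

(* Defs.v *)
From HB Require Import structures.
From mathcomp Require Import all_boot all_order all_algebra.
From mathcomp Require Import all_classical all_reals all_analysis.

Set Implicit Arguments.
Unset Strict Implicit.
Unset Printing Implicit Defensive.

Import Order.TTheory GRing.Theory Num.Theory.
Import numFieldNormedType.Exports.

Local Open Scope classical_set_scope.
Local Open Scope ring_scope.

(* The space R^d is 'rV[R]_d.  Its topology in the library is the product one,
   i.e. the Euclidean one, but its library norm is the sup norm; hence the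
   separate Euclidean norm. *)
Section euclidean.
Context {R : realType} {d : nat}.
Implicit Types x y : 'rV[R]_d.

Definition enorm x : R := Num.sqrt (\sum_(i < d) x 0 i ^+ 2).

Definition eball x (r : R) : set 'rV[R]_d := [set y | enorm (y - x) < r].

Definition esphere : set 'rV[R]_d := [set w | enorm w = 1].

Definition ediam (U : set 'rV[R]_d) : \bar R :=
  ereal_sup [set (enorm (p.1 - p.2))%:E | p in U `*` U].

End euclidean.

(* A copy of T in which every subset belongs to the semiring of sets, so that
   the library's outer measure construction mu_ext g, the infimum of
   \sum_k g (U_k) over countable covers (U_k), ranges over arbitrary covers.
   A cover element is excluded by giving it the value +oo. *)
Definition all_subsets (T : Type) : Type := T.

Section all_subsets.
Variable T : pointedType.

HB.instance Definition _ := Pointed.on (all_subsets T).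
HB.instance Definition _ := @isMeasurable.Build default_measure_display
  (all_subsets T) [set: set T] I (fun _ _ => I) (fun _ _ => I).

End all_subsets.

Section lebesgue_measure.
Context (R : realType) (d : nat).
Local Open Scope ereal_scope.

Definition box (a b : 'rV[R]_d) : set 'rV[R]_d :=
  [set x | forall i, (a ord0 i < x ord0 i <= b ord0 i)%R].

(* The volume of a box, and +oo on a nonempty set that is not a box. *)
Definition box_volume (U : set (all_subsets 'rV[R]_d)) : \bar R :=
  if U == set0 then 0 else
  ereal_inf [set (\prod_(i < d) (p.2 ord0 i - p.1 ord0 i))%:E | p in
    [set p : 'rV[R]_d * 'rV[R]_d |
      (forall i, (p.1 ord0 i <= p.2 ord0 i)%R) /\ U = box p.1 p.2]].

Definition lebesgue (E : set 'rV[R]_d) : \bar R := mu_ext box_volume E.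

Lemma box_volume0 : box_volume set0 = 0.
Proof. by rewrite /box_volume eqxx. Qed.

Lemma box_volume_ge0 U : 0 <= box_volume U.
Proof.
rewrite /box_volume; case: ifP => // _.
apply: le_ereal_inf_tmp => _ [[a b] /= [ab _] <-].
by rewrite lee_fin; apply: prodr_ge0 => i _; rewrite subr_ge0.
Qed.

HB.instance Definition _ := isOuterMeasure.Build R 'rV[R]_d lebesgue
  (mu_ext0 box_volume0 box_volume_ge0) (mu_ext_ge0 box_volume_ge0)
  (le_mu_ext box_volume) (mu_ext_sigma_subadditive box_volume_ge0).

(* Lebesgue measure on the (complete) sigma-algebra of Lebesgue measurable sets,
   which are the Caratheodory measurable ones. *)
Definition lebesgue_meas : {measure set (caratheodory_type lebesgue) -> \bar R} :=
  (lebesgue : {outer_measure set 'rV[R]_d -> \bar R}).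

End lebesgue_measure.

Section hausdorff_measure.
Context (R : realType) (d s : nat).
Local Open Scope ereal_scope.

Definition diam_gauge (e : R) (U : set (all_subsets 'rV[R]_d)) : \bar R :=
  if U == set0 then 0 else if ediam U <= e%:E then ediam U ^+ s else +oo.

(* The s-dimensional Hausdorff outer measure, without the customary constant
   factor that makes it agree with Lebesgue measure when s = d: it is used only
   through averages, in which any constant factor cancels. *)
Definition hausdorff (E : set 'rV[R]_d) : \bar R :=
  ereal_sup [set mu_ext (diam_gauge e) E | e in [set e : R | (0 < e)%R]].

Lemma diam_gauge0 e : diam_gauge e set0 = 0.
Proof. by rewrite /diam_gauge eqxx. Qed.

Lemma diam_gauge_ge0 e U : 0 <= diam_gauge e U.
Proof.
rewrite /diam_gauge; case: eqP => // /eqP/set0P[x Ux].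
case: ifP => // _; apply: expe_ge0.
apply: (@le_trans _ _ (enorm (x - x))%:E).
  by rewrite lee_fin sqrtr_ge0.
by apply: ereal_sup_ubound; exists (x, x).
Qed.

Let hausdorff_ge e E : (0 < e)%R -> mu_ext (diam_gauge e) E <= hausdorff E.
Proof. by move=> e0; apply: ereal_sup_ubound; exists e. Qed.

Lemma hausdorff_outer0 : hausdorff set0 = 0.
Proof.
apply/eqP; rewrite eq_le; apply/andP; split.
  apply: ge_ereal_sup => _ [e _ <-].
  by rewrite (mu_ext0 (diam_gauge0 e) (diam_gauge_ge0 e)).
by rewrite (le_trans (mu_ext_ge0 (diam_gauge_ge0 1%R) _) (hausdorff_ge _ ltr01)).
Qed.

Lemma hausdorff_outer_ge0 E : 0 <= hausdorff E.
Proof.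
by rewrite (le_trans (mu_ext_ge0 (diam_gauge_ge0 1%R) _) (hausdorff_ge _ ltr01)).
Qed.

Lemma le_hausdorff_outer : {homo hausdorff : A B / A `<=` B >-> A <= B}.
Proof.
move=> A B AB; apply: ge_ereal_sup => _ [e e0 <-].
exact: le_trans (le_mu_ext (diam_gauge e) AB) (hausdorff_ge _ e0).
Qed.

Lemma hausdorff_outer_sigma_subadditive : sigma_subadditive hausdorff.
Proof.
move=> F; apply: ge_ereal_sup => _ [e e0 <-].
apply: le_trans (mu_ext_sigma_subadditive (diam_gauge_ge0 e) F) _.
apply: lee_nneseries => [i _ _|i _]; last exact: hausdorff_ge.
exact: (mu_ext_ge0 (diam_gauge_ge0 e)).
Qed.

HB.instance Definition _ := isOuterMeasure.Build R 'rV[R]_d hausdorff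
  hausdorff_outer0 hausdorff_outer_ge0 le_hausdorff_outer
  hausdorff_outer_sigma_subadditive.

Definition hausdorff_meas : {measure set (caratheodory_type hausdorff) -> \bar R} :=
  (hausdorff : {outer_measure set 'rV[R]_d -> \bar R}).

End hausdorff_measure.

Section geometry.
Context {R : realType} {d : nat}.

Definition ess_dist (x : 'rV[R]_d) (A : set 'rV[R]_d) : \bar R :=
  ereal_sup [set r%:E | r in
    [set r : R | 0 <= r /\ lebesgue (eball x r `&` A) = 0%E]].

Definition radial_average (w : 'rV[R]_d -> R) (x : 'rV[R]_d) (r : R) : R :=
  if d == 1%N then (w (x + const_mx r) + w (x - const_mx r)) / 2
  else (fine (@hausdorff R d d.-1 esphere))^-1 *
    \int[hausdorff_meas R d d.-1]_(om in esphere)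
      w (x + `|r| *: om).

End geometry.

Section heat.
Context {R : realType} {d : nat}.

Definition heat_kernel (a : R) (x : 'rV[R]_d) (t : R) : R :=
  (Num.sqrt (4 * pi * a * t)) ^- d * expR (- (enorm x ^+ 2 / (4 * a * t))).

Definition heat_convolution (a : R) (u0 : 'rV[R]_d -> R) (x : 'rV[R]_d) (t : R) : R :=
  \int[lebesgue_meas R d]_y
    (heat_kernel a (x - y) t * u0 y).

Definition basis_vec (i : 'I_d) : 'rV[R]_d := delta_mx 0 i.

Definition laplacian (f : 'rV[R]_d -> R) (x : 'rV[R]_d) : R :=
  \sum_(i < d) 'D_(basis_vec i) ('D_(basis_vec i) f) x.

(* The last clause selects the bounded solution with initial datum u0, which for
   a discontinuous u0 is not determined by the pointwise condition at t = 0. *)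
Record bounded_heat_solution (T : \bar R) (a : R) (u0 : 'rV[R]_d -> R)
    (u : 'rV[R]_d -> R -> R) : Prop := {
  heat_bounded : exists M : R, forall (x : 'rV[R]_d) (t : R),
    0 <= t -> (t%:E < T)%E -> `|u x t| <= M ;
  heat_time_derivable : forall (x : 'rV[R]_d) (t : R), 0 < t -> (t%:E < T)%E ->
    derivable (u x) t 1 ;
  heat_space_derivable : forall (x : 'rV[R]_d) (t : R) (i : 'I_d), 0 < t -> (t%:E < T)%E ->
    derivable (u ^~ t) x (basis_vec i) /\
    derivable ('D_(basis_vec i) (u ^~ t)) x (basis_vec i) ;
  heat_equation : forall (x : 'rV[R]_d) (t : R), 0 < t -> (t%:E < T)%E ->
    'D_1 (u x) t = a * laplacian (u ^~ t) x ;
  heat_initial : forall x, u x 0 = u0 x ;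
  heat_representation : forall (x : 'rV[R]_d) (t : R), 0 < t -> (t%:E < T)%E ->
    u x t = heat_convolution a u0 x t }.

Definition diffusive_sign_defined (u v : 'rV[R]_d -> R -> R) (x : 'rV[R]_d) : Prop :=
  cvg (Num.sg (u x t - v x t) @[t --> 0^'+]).

Definition diffusive_sign (u v : 'rV[R]_d -> R -> R) (x : 'rV[R]_d) : R :=
  lim (Num.sg (u x t - v x t) @[t --> 0^'+]).

End heat.

Section real_functions.
Context {R : realType}.
Implicit Types f : R -> R.

Definition discontinuities f : set R := [set r | ~ {for r, continuous f}].

(* No one-sided limits are required at the discontinuities. *)
Definition piecewise_continuous f : Prop :=
  countable (discontinuities f) /\
  finite_set (limit_point (discontinuities f)).

Definition one_sided_continuous_at_discontinuities f : Prop :=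
  forall r, discontinuities f r ->
    f x @[x --> r^'-] --> f r \/ f x @[x --> r^'+] --> f r.

Definition has_sign_changes (I : set R) f (m : nat) : Prop :=
  exists xi : nat -> R,
    [/\ forall l, (l <= m)%N -> I (xi l),
        forall l, (l < m)%N -> xi l < xi l.+1 &
        forall l, (l < m)%N -> f (xi l) * f (xi l.+1) < 0].

Definition sign_changing_number (I : set R) f : \bar R :=
  ereal_sup [set (m%:R)%:E | m in has_sign_changes I f].

Definition locally_finite_sign_changes f : Prop :=
  forall a b : R, a < b -> (sign_changing_number `]a, b[%classic f < +oo)%E.

End real_functions.

Section classification.
Context {R : realType} {d N : nat}.

Definition scaled_indicator (c : R) (A : set 'rV[R]_d) : 'rV[R]_d -> R :=
  fun x => c * \1_A x.

Definition diffusivity_ratio (a : 'I_N -> R) (i j : 'I_N) : R :=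
  Num.sqrt (a j / a i).

Definition average_difference (a : 'I_N -> R) (u0 : 'I_N -> 'rV[R]_d -> R)
    (x : 'rV[R]_d) (i j : 'I_N) (r : R) : R :=
  radial_average (u0 i) x r -
  radial_average (u0 j) x (diffusivity_ratio a i j * r).

(* The relation between the i-th and the j-th initial datum, as a relation on the
   indices: the coefficients a i needed to evaluate it go with the index. *)
Definition diffusive_rel (u : 'I_N -> 'rV[R]_d -> R -> R) (x : 'rV[R]_d) : rel 'I_N :=
  fun i j => 0 <= diffusive_sign (u i) (u j) x.

Definition classification_set (u : 'I_N -> 'rV[R]_d -> R -> R) (i : 'I_N) :
    set 'rV[R]_d :=
  [set x | forall j, j != i ->
    diffusive_sign_defined (u i) (u j) x /\ diffusive_sign (u i) (u j) x = 1].

End classification.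

(* Main.v *)
Require Import Defs.
From HB Require Import structures.
From mathcomp Require Import all_boot all_order all_algebra.
From mathcomp Require Import all_classical all_reals all_analysis.
From mathcomp Require Import measurable_realfun ring lra zify.
Set Implicit Arguments.
Unset Strict Implicit.
Unset Printing Implicit Defensive.
Import Order.TTheory GRing.Theory Num.Theory.
Import numFieldNormedType.Exports.
Local Open Scope classical_set_scope.
Local Open Scope ring_scope.

(** Why the theorem holds.

    In polar coordinates about [x], with the radius of the second datum scaled by
    [k = sqrt (a' / a)], the Gaussians of the two heat kernels and their
    normalizations become the same.  Hence [u x t - u' x t] is a positive factor
    times [\int_r expR (- (tau * r ^+ 2)) * w r], where [tau = (4 * a * t)^-1],
    [w] is the difference of the radial averages and [r] is distributed like the
    distance to [x] under the volume ([radial_representation]).  As [t] decreases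
    to [0], [tau] tends to infinity and the integral only sees the smallest radii
    at which [w] does not vanish.  Precisely, unless [w] is zero almost
    everywhere, let [r0] be the largest radius below which it vanishes almost
    everywhere.  Having finitely many sign changes on bounded intervals, [w] keeps
    one weak sign on some interval to the right of [r0] ([one_sided_sign]), and
    the part of the integral on that interval dominates the rest by Laplace's
    method ([laplace_domination]).  So the sign of [u x t - u' x t] is constant
    for small [t] ([eventual_sign], [radial_eventual_sign]).  The diffusive signs
    are therefore the actual signs at every small time, and the relation is a
    preorder because the order of the reals is.

    For the second part, Laplace's method is applied to the heat integrals
    themselves.  If [A] has mass within distance [rho] of [x] and [A'] has none
    within distance [rho'], then, up to constants and a common factor, [u x t] is at least
    [expR (- (rho ^+ 2 / (4 * a * t)))] and [u' x t] at most
    [expR (- (rho' ^+ 2 / (4 * a' * t)))]; the former wins when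
    [k * rho < rho'] ([closer_eventual_sign]).  The strict inequality between the
    essential distances provides such radii, and they persist, slightly changed,
    at all nearby points ([closer_than_near]); this gives the interior.

    Most of the work is the passage to polar coordinates for the outer measures
    that define volume and spherical averages.  It avoids densities and the area
    formula: two measures under which all balls of the same radius centered on a
    common carrier have the same positive finite mass are equal
    ([uniform_measures_eq]).  On the whole space this shows that reflections
    preserve the volume; on the sphere it shows that there is only one
    probability under which all caps of the same radius have the same mass
    ([spherical_eq]).  The normalized Hausdorff
    measure is one, and so is the distribution of the direction of a point under
    the volume, restricted to any range of its norm; hence direction and norm are
    independent ([leb_sector]) and integrals split ([polar_integral]).  The
    normalization needs the Hausdorff measure of the sphere to be positive, by
    filling the ball with cones over a cover ([hausdorff_sphere_gt0]), and finite,
    by packing the sphere with disjoint balls ([hausdorff_sphere_fin]). *)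

(** * The Euclidean norm and reflections *)

Section euclidean_geometry.
Context {R : realType} {d : nat}.
Implicit Types (x y z v : 'rV[R]_d) (r s : R).

Definition dot x y : R := \sum_(i < d) x 0 i * y 0 i.

Lemma dotC x y : dot x y = dot y x.
Proof. by apply: eq_bigr => i _; rewrite mulrC. Qed.

Lemma dotDl x y z : dot (x + y) z = dot x z + dot y z.
Proof. by rewrite -big_split; apply: eq_bigr => i _; rewrite mxE mulrDl. Qed.

Lemma dotZl r x y : dot (r *: x) y = r * dot x y.
Proof. by rewrite mulr_sumr; apply: eq_bigr => i _; rewrite mxE mulrA. Qed.

Lemma dotDr x y z : dot z (x + y) = dot z x + dot z y.
Proof. by rewrite !(dotC z) dotDl. Qed.

Lemma dotZr r x y : dot x (r *: y) = r * dot x y.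
Proof. by rewrite !(dotC x) dotZl. Qed.

Lemma dotNl x y : dot (- x) y = - dot x y.
Proof. by rewrite -scaleN1r dotZl mulN1r. Qed.

Lemma dotNr x y : dot y (- x) = - dot y x.
Proof. by rewrite !(dotC y) dotNl. Qed.

Lemma dot_ge0 x : 0 <= dot x x.
Proof. by apply: sumr_ge0 => i _; rewrite -expr2 sqr_ge0. Qed.

Lemma enormE x : enorm x = Num.sqrt (dot x x).
Proof. by congr Num.sqrt; apply: eq_bigr => i _; rewrite expr2. Qed.

Lemma sqr_enorm x : enorm x ^+ 2 = dot x x.
Proof. by rewrite enormE sqr_sqrtr ?dot_ge0. Qed.

Lemma enorm_ge0 x : 0 <= enorm x.
Proof. exact: sqrtr_ge0. Qed.

Lemma dot_le_enorm x y : dot x y <= enorm x * enorm y.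
Proof.
have [/eqP|x0] := eqVneq (enorm x * enorm y) 0; last first.
  have p0 : 0 < enorm x * enorm y by rewrite lt_neqAle eq_sym x0 mulr_ge0 ?enorm_ge0.
  have := dot_ge0 (enorm y *: x - enorm x *: y).
  rewrite !(dotDl, dotDr, dotNl, dotNr, dotZl, dotZr) -!sqr_enorm (dotC y x).
  move=> h.
  have {h} : 0 <= (enorm x * enorm y) * (enorm x * enorm y - dot x y) by lra.
  by rewrite pmulr_rge0 // subr_ge0.
rewrite mulf_eq0; wlog x0 : x y / enorm x == 0.
  move=> h /orP[x0|y0]; first by apply: h => //; rewrite x0.
  by rewrite dotC mulrC; apply: h => //; rewrite y0.
move=> _; have := sqr_enorm x; rewrite (eqP x0) expr2 mul0r => /esym/eqP.
rewrite psumr_eq0 => [/allP h|i _]; last by rewrite -expr2 sqr_ge0.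
rewrite mul0r /dot big1 // => i _; have := h i (mem_index_enum _).
by rewrite implyTb mulf_eq0 orbb => /eqP->; rewrite mul0r.
Qed.

Lemma ler_enormD x y : enorm (x + y) <= enorm x + enorm y.
Proof.
rewrite -(@ler_pXn2r _ 2) ?nnegrE ?addr_ge0 ?enorm_ge0 //.
rewrite sqrrD !sqr_enorm dotDl !dotDr (dotC y x).
have := dot_le_enorm x y; lra.
Qed.

Lemma enormZ r x : enorm (r *: x) = `|r| * enorm x.
Proof.
by rewrite !enormE dotZl dotZr mulrA -expr2 sqrtrM ?sqr_ge0 // sqrtr_sqr.
Qed.

Lemma enormN x : enorm (- x) = enorm x.
Proof. by rewrite -scaleN1r enormZ normrN1 mul1r. Qed.

Lemma enormB x y : enorm (x - y) = enorm (y - x).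
Proof. by rewrite -enormN opprB. Qed.

Lemma enorm0 : enorm (0 : 'rV[R]_d) = 0.
Proof. by rewrite -(scale0r 0) enormZ normr0 mul0r. Qed.

Lemma ler_enorm_coord x i : `|x 0 i| <= enorm x.
Proof.
rewrite -(@ler_pXn2r _ 2) ?nnegrE ?enorm_ge0 // -normrX ger0_norm ?sqr_ge0 //.
rewrite sqr_enorm /dot (bigD1 i) //= -expr2 lerDl.
by apply: sumr_ge0 => j _; rewrite -expr2 sqr_ge0.
Qed.

Lemma enorm_eq0 x : enorm x = 0 -> x = 0.
Proof.
move=> x0; apply/rowP => i; rewrite mxE; apply/normr0_eq0/eqP.
by rewrite -normr_le0 normr_id -x0 ler_enorm_coord.
Qed.

Lemma enorm_triangle x y z : enorm (x - z) <= enorm (x - y) + enorm (y - z).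
Proof. by apply: le_trans (ler_enormD _ _); rewrite addrA subrK. Qed.

Lemma enorm_sub_le x y : enorm x - enorm y <= enorm (x - y).
Proof. by rewrite lerBlDr; apply: le_trans (ler_enormD _ _); rewrite subrK. Qed.

Lemma enorm_le_sup x r : 0 <= r -> (forall i, `|x 0 i| <= r) ->
  enorm x <= Num.sqrt d%:R * r.
Proof.
move=> r0 xr; rewrite -(@ler_pXn2r _ 2) ?nnegrE ?mulr_ge0 ?enorm_ge0 ?sqrtr_ge0 //.
rewrite sqr_enorm exprMn sqr_sqrtr ?ler0n // mulr_natl.
rewrite -[X in _ <= _ *+ X]card_ord -sumr_const; apply: ler_sum => i _.
by rewrite -expr2 -real_normK ?num_real // lerXn2r ?nnegrE.
Qed.

Lemma enormB_continuous x : continuous (fun y => enorm (y - x)).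
Proof.
move=> y; apply: (@continuous_comp _ _ _
  (fun z : 'rV[R]_d => \sum_(i < d) (z - x) 0 i ^+ 2) Num.sqrt); last first.
  exact: sqrt_continuous.
apply: (@cvg_big _ _ _ _ _ _ _ (nbhs y)) => [p|i _].
  exact: (@add_continuous R).
apply: (@continuous_comp _ _ _ (fun z : 'rV[R]_d => (z - x) 0 i)
  (fun t : R => t ^+ 2)); last exact: exprn_continuous.
rewrite (_ : (fun z : 'rV[R]_d => _) = (fun z => z 0 i - x 0 i)); last first.
  by apply/funext => z; rewrite !mxE.
apply: (@continuousB R R^o); first exact: coord_continuous.
exact: cst_continuous.
Qed.

Lemma enorm_continuous : continuous (@enorm R d).
Proof.
rewrite (_ : @enorm R d = fun y => enorm (y - 0)); first exact: enormB_continuous.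
by apply/funext => y; rewrite subr0.
Qed.

Lemma open_eball x r : open (eball x r).
Proof.
rewrite [eball x r](_ : _ =
  (fun y => enorm (y - x)) @^-1` [set t | t < r]) //.
apply: open_comp; last first.
  by rewrite (_ : [set t | t < r] = `]-oo, r[%classic) ?set_itvE //; exact: lray_open.
by move=> y _; exact: enormB_continuous.
Qed.

Lemma nbhs_eball x (U : set 'rV[R]_d) : nbhs x U ->
  exists2 r, 0 < r & eball x r `<=` U.
Proof.
move=> /nbhs_ballP[r /= r0 xrU]; exists r => // y yr; apply: xrU; split=> // i j.
rewrite ord1 /ball /=; apply: le_lt_trans yr.
by have := ler_enorm_coord (y - x) j; rewrite !mxE distrC.
Qed.

(** The hyperplane reflection that exchanges two vectors of the same norm; it is
    the identity when they are equal, because then the division is by zero. *)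
Definition reflection x y z : 'rV[R]_d :=
  z - (2 * dot z (x - y) / dot (x - y) (x - y)) *: (x - y).

Lemma reflectionB x y z z' :
  reflection x y z - reflection x y z' = reflection x y (z - z').
Proof.
rewrite /reflection; move: (x - y) => v; rewrite dotDl dotNl mulrBr mulrBl scalerBl.
by rewrite !opprD !opprK addrACA.
Qed.

Lemma reflectionZ x y r z : reflection x y (r *: z) = r *: reflection x y z.
Proof. rewrite /reflection; move: (x - y) => v; rewrite dotZl scalerBr scalerA.
by congr (_ - _ *: _); ring. Qed.

Lemma enorm_reflection x y z : enorm (reflection x y z) = enorm z.
Proof.
rewrite !enormE; congr Num.sqrt; rewrite /reflection.
move: (x - y) => v; have [v0|v0] := eqVneq (dot v v) 0.
  by rewrite v0 invr0 mulr0 scale0r subr0.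
rewrite !(dotDl, dotDr, dotNl, dotNr, dotZl, dotZr) (dotC v z).
by field.
Qed.

Lemma reflectionK x y : involutive (reflection x y).
Proof.
move=> z; rewrite /reflection; move: (x - y) => v.
have [v0|v0] := eqVneq (dot v v) 0.
  by rewrite v0 invr0 !mulr0 !scale0r !subr0.
rewrite !(dotDl, dotDr, dotNl, dotNr, dotZl, dotZr).
rewrite -addrA -opprD -scalerDl.
rewrite [X in X *: v](_ : _ = 0) ?scale0r ?subr0 //; by field.
Qed.

Lemma reflection_swap x y : enorm x = enorm y -> reflection x y x = y.
Proof.
rewrite !enormE => /(congr1 (fun t : R => t ^+ 2)).
rewrite !sqr_sqrtr ?dot_ge0 // => xy; rewrite /reflection.
set v := x - y.
have v2 : dot v v = 2 * dot x v.
  by rewrite /v !(dotDl, dotDr, dotNl, dotNr) (dotC y x) -xy; ring.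
have [v0|v0] := eqVneq (dot v v) 0.
  rewrite v0 invr0 mulr0 scale0r subr0.
  have : enorm v = 0 by rewrite enormE v0 sqrtr0.
  by move=> /enorm_eq0/eqP; rewrite subr_eq0 => /eqP.
by rewrite -v2 divff // scale1r /v opprB addrC subrK.
Qed.

End euclidean_geometry.

(** * Borel sets of the Euclidean space *)

Section borel_space.
Context {R : realType} {d : nat}.

Definition borel : Type := g_sigma_algebraType (@open 'rV[R]_d).
HB.instance Definition _ := Measurable.on borel.

Lemma open_borel (U : set 'rV[R]_d) : open U -> measurable (U : set borel).
Proof. exact: sub_sigma_algebra. Qed.

Lemma continuous_borel (f : 'rV[R]_d -> R) : continuous f ->
  measurable_fun [set: borel] (f : borel -> R).
Proof.
move=> cf; apply: (measurability _ (RGenOInfty.measurableE R)).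
move=> _ [_ [a ->] <-]; rewrite setTI; apply: open_borel.
by apply: open_comp => [x _|]; [exact: cf|exact: rray_open].
Qed.

Lemma coord_borel i : measurable_fun [set: borel] (fun x : borel => x 0 i).
Proof. by apply: continuous_borel => x; exact: coord_continuous. Qed.

Lemma enorm_borel : measurable_fun [set: borel] (@enorm R d : borel -> R).
Proof. exact: continuous_borel enorm_continuous. Qed.

(** Open sets are countable unions of rational cubes, so that measurability of a
    vector-valued map can be checked coordinatewise. *)
Lemma measurable_borel dd (T : measurableType dd) (f : T -> 'rV[R]_d) :
  (forall i, measurable_fun [set: T] (fun t => f t 0 i)) ->
  measurable_fun [set: T] (f : T -> borel).
Proof.
move=> mf; apply: (@measurability _ _ T borel setT f (@open 'rV[R]_d)) => //.
move=> _ [U oU <-].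
rewrite setTI.
pose cube (p : 'rV[rat]_d * nat) : set 'rV[R]_d :=
  [set x | forall i, `|x 0 i - ratr (p.1 0 i)| < p.2.+1%:R^-1].
have -> : f @^-1` U =
    \bigcup_p (if `[<cube p `<=` U>] then f @^-1` cube p else set0).
  apply/seteqP; split=> [t Uft|t [p _]]; last first.
    by case: asboolP => // pU; exact: pU.
  have /nbhs_ballP[e /= e0 feU] : nbhs (f t) U by exact: open_nbhs_nbhs.
  have [n ne] : exists n, n.+1%:R^-1 < e / 2 :> R.
    have [n ne] := @ltr_add_invr R 0 (e / 2) (divr_gt0 e0 (ltr0Sn _ 1)).
    by exists n; rewrite -[X in X < _]add0r.
  have rn i : {q : rat | `|f t 0 i - ratr q| < n.+1%:R^-1}.
    have /rat_in_itvoo/cid[q] : f t 0 i - n.+1%:R^-1 < f t 0 i :> R.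
      by rewrite ltrBlDr ltrDl invr_gt0.
    rewrite in_itv /= => /andP[q1 q2]; exists q.
    by rewrite ger0_norm ?subr_ge0 ?ltW // ltrBlDl -ltrBlDr.
  pose q := \row_i sval (rn i).
  have qt : cube (q, n) (f t) by move=> i; rewrite mxE; exact: (svalP (rn i)).
  exists (q, n) => //; case: asboolP => // -[] y qy; apply: feU.
  split=> // i j; rewrite ord1 /ball /=.
  have := qy j; have := qt j; rewrite /= => h1 h2.
  rewrite -(subrK (ratr (q 0 j)) (f t 0 j)) -addrA.
  apply: le_lt_trans (ler_normD _ _) _.
  rewrite (distrC (ratr _) (y 0 j)) (splitr e).
  by apply: ltrD; [exact: lt_trans h1 ne|exact: lt_trans h2 ne].
apply: countable_bigcupT_measurable => // p; case: ifP => // _.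
rewrite (_ : f @^-1` cube p =
    \bigcap_(i in [set: 'I_d]) (fun t => `|f t 0 i - ratr (p.1 0 i)|) @^-1`
      [set s | s < p.2.+1%:R^-1]); last first.
  by apply/seteqP; split=> [t h i _|t h i]; [exact: h|exact: (h i I)].
apply: fin_bigcap_measurable => // i _.
have mfi : measurable_fun [set: T] (fun t => `|f t 0 i - ratr (p.1 0 i)|).
  by apply: measurableT_comp => //; exact: measurable_funB.
rewrite -[X in measurable X]setTI; apply: mfi => //.
rewrite (_ : [set s | _] = `]-oo, p.2.+1%:R^-1[%classic); last by rewrite set_itvE.
exact: measurable_itv.
Qed.

End borel_space.
Arguments borel : clear implicits.

(** * Borel sets are Lebesgue measurable *)

Section outer_measure_transport.
Local Open Scope ereal_scope.
Context {R : realType} {T : pointedType}.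
Implicit Types (g : set (all_subsets T) -> \bar R) (E : set T).

(** The preimages of a cover of [E] cover the preimage of [E]. *)
Lemma mu_ext_preimage g g' (f : T -> T) (k : R) E : (0 < k)%R ->
  (forall U, 0 <= g U) -> (forall U, 0 <= g' U) ->
  (forall U : set T, g' (f @^-1` U) <= k%:E * g U) ->
  mu_ext g' (f @^-1` E) <= k%:E * mu_ext g E.
Proof.
move=> k0 g0 g'0 gg'; rewrite muleC -lee_pdivrMr //.
apply: le_ereal_inf_tmp => _ [F [_ EF] <-].
rewrite lee_pdivrMr // muleC -nneseriesZl //.
apply: (@le_trans _ _ (\sum_(i <oo) g' (f @^-1` F i))); last first.
  exact: lee_nneseries.
apply: ereal_inf_lbound; exists (fun i => f @^-1` F i) => //; split=> // x Ex.
by have [i _ Fi] := EF _ Ex; exists i.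
Qed.

(** Splitting every member of a cover of [X] along [A] and [B] gives covers of
    the two parts, so an additivity of the gauge passes to the outer measure. *)
Lemma mu_ext_split g E A B : (forall U, 0 <= g U) ->
  (forall U, g (U `&` A) + g (U `&` B) <= g U) ->
  mu_ext g (E `&` A) + mu_ext g (E `&` B) <= mu_ext g E.
Proof.
move=> g0 gAB; apply: le_ereal_inf_tmp => _ [F [_ EF] <-].
have le X : mu_ext g (E `&` X) <= \sum_(i <oo) g (F i `&` X).
  apply: ereal_inf_lbound; exists (fun i => F i `&` X) => //; split=> // x [Ex Xx].
  by have [i _ Fi] := EF _ Ex; exists i.
apply: le_trans (leeD (le A) (le B)) _.
by rewrite -nneseriesD //; apply: lee_nneseries => // i _ _; exact: adde_ge0.
Qed.

End outer_measure_transport.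

Section lebesgue_basics.
Context {R : realType} {d : nat}.
Local Notation E := 'rV[R]_d.
Local Notation lambda := (@lebesgue R d).
Implicit Types (x y v : E).

Lemma box_volume_box_le (a b : E) : (forall i, a 0 i <= b 0 i) ->
  (box_volume (box a b) <= (\prod_(i < d) (b 0 i - a 0 i))%:E)%E.
Proof.
move=> ab; rewrite /box_volume; case: ifP => _.
  by rewrite lee_fin; apply: prodr_ge0 => i _; rewrite subr_ge0.
by apply: ereal_inf_lbound; exists (a, b).
Qed.

Lemma box_volume_lb (r : \bar R) (U : set (all_subsets E)) : U !=set0 ->
  (forall a b : E, (forall i, a 0 i <= b 0 i) -> U = box a b ->
    (r <= (\prod_(i < d) (b 0 i - a 0 i))%:E)%E) -> (r <= box_volume U)%E.
Proof.
move=> /set0P/negbTE U0 rU; rewrite /box_volume U0.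
by apply: le_ereal_inf_tmp => _ [[a b] /= [ab UE] <-]; exact: rU.
Qed.

Lemma lebesgue_box_le (a b : E) : (forall i, a 0 i <= b 0 i) ->
  (lambda (box a b) <= (\prod_(i < d) (b 0 i - a 0 i))%:E)%E.
Proof.
move=> ab; apply: le_trans (box_volume_box_le ab).
apply: ereal_inf_lbound; exists (fun k => if k == 0%N then box a b else set0).
  by split=> // x abx; exists 0%N.
rewrite nneseries_recl //; last by move=> k _; exact: box_volume_ge0.
by rewrite eseries0 ?adde0 // => -[|k] // _ _; exact: box_volume0.
Qed.

Definition affine (s : R) v x := v + s *: x.

Lemma box_volume_affine_le s v (U : set E) : 0 < s ->
  (box_volume (affine s v @^-1` U) <= (s ^- d)%:E * box_volume U)%E.
Proof.
move=> s0; have [->|/set0P U0] := eqVneq U set0.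
  by rewrite preimage_set0 box_volume0 mule0.
rewrite muleC -lee_pdivrMr ?invr_gt0 ?exprn_gt0 //.
apply: box_volume_lb => // a b ab ->.
rewrite lee_pdivrMr ?invr_gt0 ?exprn_gt0 //.
have -> : affine s v @^-1` box a b = box (s^-1 *: (a - v)) (s^-1 *: (b - v)).
  apply/seteqP; split=> x h i; have := h i; rewrite !mxE.
    by rewrite ltr_pdivrMl // ler_pdivlMl // ltrBlDl lerBrDl.
  by rewrite ltr_pdivrMl // ler_pdivlMl // ltrBlDl lerBrDl.
apply: le_trans (box_volume_box_le _) _.
  by move=> i; rewrite !mxE ler_pM2l ?invr_gt0 // lerB.
rewrite -EFinM lee_fin -exprVn -[X in _ ^+ X]card_ord -prodr_const -big_split /=.
rewrite le_eqVlt; apply/orP; left; apply/eqP; apply: eq_bigr => i _.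
by rewrite !mxE; ring.
Qed.

Lemma lebesgue_affine s v (A : set E) : 0 < s ->
  lambda (affine s v @^-1` A) = ((s ^- d)%:E * lambda A)%E.
Proof.
have le s' v' B : 0 < s' ->
    (lambda (affine s' v' @^-1` B) <= (s' ^- d)%:E * lambda B)%E.
  move=> s0; apply: mu_ext_preimage; rewrite ?invr_gt0 ?exprn_gt0 //.
  - exact: box_volume_ge0.
  - exact: box_volume_ge0.
  - by move=> U; exact: box_volume_affine_le.
move=> s0; apply/eqP; rewrite eq_le le //=.
rewrite muleC -lee_pdivlMr ?invr_gt0 ?exprn_gt0 // invrK muleC.
have := le s^-1 (- (s^-1 *: v)) (affine s v @^-1` A).
rewrite invr_gt0 exprVn invrK => /(_ s0); apply: le_trans.
apply: le_outer_measure => x Ax /=; rewrite /affine scalerDr scalerN !scalerA.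
by rewrite divff ?gt_eqF // !scale1r addrA subrr add0r.
Qed.

(** A coordinate hyperplane cuts a box into two boxes whose volumes add up; the
    truncations of the [i]-th side keep the endpoints ordered when the hyperplane
    misses the box. *)
Lemma caratheodory_halfspace i (c : R) :
  measurable ([set x : E | x 0 i <= c] : set (caratheodory_type lambda)).
Proof.
set C := [set _ | _].
apply: le_caratheodory_measurable => X.
apply: mu_ext_split => [U|U]; first exact: box_volume_ge0.
have [->|/set0P U0] := eqVneq U set0.
  by rewrite !set0I !box_volume0 adde0.
apply: box_volume_lb => // a b ab ->.
pose up (w : E) t : E := \row_j (if j == i then t else w 0 j).
have -> : box a b `&` C = box a (up b (Num.max (a 0 i) (Num.min (b 0 i) c))).
  apply/seteqP; split=> x.
    move=> [h /= Cx] j; rewrite mxE; case: eqP => [->|_]; last exact: h.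
    by have /andP[-> h2] := h i; rewrite le_max le_min h2 Cx orbT.
  move=> h; have := h i; rewrite mxE eqxx le_max le_min => /andP[h1].
  rewrite leNgt h1 /= => /andP[h2 h3]; split=> // j.
  have := h j; rewrite mxE; case: eqP => // -> _; exact/andP.
have -> : box a b `&` ~` C = box (up a (Num.min (b 0 i) (Num.max (a 0 i) c))) b.
  apply/seteqP; split=> x.
    move=> [h /= /negP]; rewrite -ltNge => Cx j; rewrite mxE.
    case: eqP => [->|_]; last exact: h.
    by have /andP[h1 ->] := h i; rewrite gt_min gt_max h1 Cx orbT.
  move=> h; have := h i; rewrite mxE eqxx gt_min gt_max => /andP[h1 h2].
  move: h1; rewrite ltNge h2 /= => /andP[h1 h3]; split.
    move=> j; have := h j; rewrite mxE; case: eqP => // -> _; exact/andP.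
  by move=> /=; apply/negP; rewrite -ltNge.
apply: le_trans (leeD (box_volume_box_le _) (box_volume_box_le _)) _.
- by move=> j; rewrite mxE; case: eqP => [->|//]; rewrite le_max lexx.
- by move=> j; rewrite mxE; case: eqP => [->|//]; rewrite ge_min lexx.
rewrite -EFinD lee_fin (bigD1 i) //= [X in _ + X](bigD1 i) //= [leRHS](bigD1 i) //=.
rewrite !mxE eqxx.
rewrite [X in _ * X + _](eq_bigr (fun j => b 0 j - a 0 j)); last first.
  by move=> j /negbTE ji; rewrite mxE ji.
rewrite [X in _ + _ * X](eq_bigr (fun j => b 0 j - a 0 j)); last first.
  by move=> j /negbTE ji; rewrite mxE ji.
rewrite -mulrDl ler_wpM2r //.
  by apply: prodr_ge0 => j _; rewrite subr_ge0.
have := ab i; rewrite /Num.max /Num.min.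
by do ![case: ltP => ?]; lra.
Qed.

Lemma lebesgue_coord_measurable i :
  measurable_fun [set: caratheodory_type lambda] (fun x : E => x 0 i).
Proof.
apply: (measurability _ (RGenOInfty.measurableE R)).
move=> _ [_ [c ->] <-]; rewrite setTI.
rewrite (_ : _ @^-1` _ = ~` [set x : E | x 0 i <= c]); last first.
  apply/seteqP; split=> x /=; rewrite in_itv /= andbT; first by rewrite ltNge => /negP.
  by move=> /negP; rewrite -ltNge.
apply: measurableC; exact: caratheodory_halfspace.
Qed.

Lemma lebesgue_id_borel :
  measurable_fun [set: caratheodory_type lambda] (id : E -> borel R d).
Proof. by apply: measurable_borel => i; exact: lebesgue_coord_measurable. Qed.

Lemma borel_caratheodory (A : set (borel R d)) : measurable A ->
  measurable (A : set (caratheodory_type lambda)).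
Proof. by move=> mA; rewrite -[A]setTI; exact: lebesgue_id_borel. Qed.

End lebesgue_basics.

(** * The volume of the unit box is positive *)

Section lebesgue_positive.
Context {R : realType}.

(** Integrating the covering inequality in one coordinate after the other; each
    integration turns one indicator into the length of the interval. *)
Lemma interval_cover_weight n (c : nat -> R) (a b : nat -> nat -> R) :
  (forall k, 0 <= c k) -> (forall k i, a k i <= b k i) ->
  (forall x : nat -> R, (forall i, 0 < x i <= 1) ->
    (1 <= \sum_(k <oo)
      (c k * \prod_(i < n) \1_(`]a k i, b k i]%classic) (x i))%:E)%E) ->
  (1 <= \sum_(k <oo) (c k * \prod_(i < n) (b k i - a k i))%:E)%E.
Proof.
elim: n c => [|n IH] c c0 ab cov.
  (* without factors left, the hypothesis is the conclusion *)
  have := cov (fun=> 1); under eq_eseriesr do rewrite big_ord0.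
  under [in X in _ -> X]eq_eseriesr do rewrite big_ord0.
  by move=> h; apply: h => i; rewrite ltr01 lexx.
under eq_eseriesr do rewrite big_ord_recr /= mulrCA mulrC -mulrA [X in c _ * X]mulrC.
under eq_eseriesr => k _ do rewrite [X in (_ * X)%:E]mulrC mulrA.
apply: IH => [k|//|x x01]; first by rewrite mulr_ge0 ?subr_ge0.
pose p k : R := c k * \prod_(i < n) \1_(`]a k i, b k i]%classic) (x i).
have p0 k : 0 <= p k by rewrite mulr_ge0 // prodr_ge0.
have {}cov t : 0 < t <= 1 ->
    (1 <= \sum_(k <oo) (p k * \1_(`]a k n, b k n]%classic) t)%:E)%E.
  move=> t01; have := cov (fun i => if i == n then t else x i).
  rewrite (@eq_eseriesr _ _ (fun k => (p k * \1_(`]a k n, b k n]%classic) t)%:E)).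
    by move=> h; apply: h => i; case: eqP.
  move=> k _; rewrite big_ord_recr /= eqxx mulrA; congr (_ * _ * _)%:E.
  by apply: eq_bigr => i _; rewrite ltn_eqF.
have m01 : lebesgue_measure (`]0, 1]%classic : set R) = 1%E.
  by rewrite lebesgue_measure_itv /= lte_fin ltr01 oppr0 adde0.
have -> : (1 = \int[@lebesgue_measure R]_(t in `]0%R, 1%R]) (cst 1) t)%E.
  by rewrite integral_cst //= mul1e m01.
apply: (@le_trans _ _ (\int[@lebesgue_measure R]_(t in `]0%R, 1%R])
    \sum_(k <oo) (p k * \1_(`]a k n, b k n]%classic) t)%:E)%E).
  apply: ge0_le_integral => //=.
  apply: ge0_emeasurable_sum => [k t _ _|k _]; first by rewrite lee_fin mulr_ge0.
    by apply/measurable_EFinP; apply: measurable_funM.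
rewrite integral_nneseries //=; last 2 first.
- by move=> k; apply/measurable_EFinP; apply: measurable_funM.
- by move=> k t _; rewrite lee_fin mulr_ge0.
apply: lee_nneseries => [k _ _|k _].
  by apply: integral_ge0 => t _; rewrite lee_fin mulr_ge0.
under eq_integral do rewrite EFinM.
rewrite ge0_integralZl //=; last 2 first.
- by apply/measurable_EFinP.
- by rewrite lee_fin.
rewrite integral_indic //= mulrAC -/(p k) [leRHS]EFinM.
apply: lee_wpmul2l; first by rewrite lee_fin.
apply: (@le_trans _ _ (lebesgue_measure (`]a k n, b k n]%classic : set R))).
  apply: le_measure; rewrite ?inE; [exact: measurableI|by []|].
  by move=> t [].
rewrite lebesgue_measure_itv /= lte_fin; case: ifP => _; first by rewrite -EFinB.
by rewrite lee_fin subr_ge0.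
Qed.

Variable d : nat.
Local Notation E := 'rV[R]_d.
Local Notation lambda := (@lebesgue R d).

(** A nonempty box determines its sides, so that [box_volume] is the product of
    the sides of any description of the box. *)
Lemma box_side (a b a' b' : E) x : box a b x -> box a b = box a' b' ->
  forall i, b 0 i - a 0 i = b' 0 i - a' 0 i.
Proof.
move=> abx abE i.
pose u t : E := \row_j (if j == i then t else x 0 j).
have uP t (e f : E) : box e f x -> box e f (u t) <-> (e 0 i < t <= f 0 i).
  move=> efx; split=> [/(_ i)|h j]; first by rewrite mxE eqxx.
  by rewrite mxE; case: eqP => [->|_]; [exact: h|exact: efx].
have abx' : box a' b' x by rewrite -abE.
have itvP t : (a 0 i < t <= b 0 i) <-> (a' 0 i < t <= b' 0 i).
  by split=> [/(uP t a b abx)|/(uP t a' b' abx')]; [rewrite abE|rewrite -abE] => /uP; exact.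
have /andP[ax xb] := abx i; have /andP[a'x xb'] := abx' i.
have /andP[_ bb'] : a' 0 i < b 0 i <= b' 0 i by apply/itvP; lra.
have /andP[_ b'b] : a 0 i < b' 0 i <= b 0 i by apply/itvP; lra.
have aa' : ~ a 0 i < a' 0 i.
  move=> h; have /itvP : a 0 i < a' 0 i <= b 0 i by lra.
  by rewrite ltxx.
have a'a : ~ a' 0 i < a 0 i.
  move=> h; have /itvP : a' 0 i < a 0 i <= b' 0 i by lra.
  by rewrite ltxx.
by move/negP: aa'; move/negP: a'a; rewrite -!leNgt => *; lra.
Qed.

Lemma lebesgue_unit_box_ge1 : (0 < d)%N -> (1 <= lambda (box 0%R (const_mx 1%R)))%E.
Proof.
move=> d0; apply: le_ereal_inf_tmp => _ [F [_ FE] <-].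
have [[k Fk]|noty] := pselect (exists k, box_volume (F k) = +oo%E).
  rewrite (nneseries_pinfty _ _ Fk) ?leey // => n _; exact: box_volume_ge0.
have /choice[ab abP] : forall k, exists ab : E * E,
    [/\ forall i, ab.1 0 i <= ab.2 0 i, F k = box ab.1 ab.2 &
     ((\prod_(i < d) (ab.2 0 i - ab.1 0 i))%:E <= box_volume (F k))%E].
  move=> k; have [Fk0|/set0P Fk0] := eqVneq (F k) set0.
    exists (0, 0); split=> //=.
      rewrite Fk0; apply/seteqP; split=> // x /(_ (Ordinal d0)).
      by rewrite !mxE; lra.
    by rewrite Fk0 box_volume0 (bigD1 (Ordinal d0)) //= subrr mul0r.
  have [[a [b [ab Fab]]]|nab] := pselect (exists a b : E,
      (forall i, a 0 i <= b 0 i) /\ F k = box a b); last first.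
    exfalso; apply: noty; exists k; apply/eqP; rewrite -leye_eq.
    by apply: box_volume_lb => // a b ab Fab; exfalso; apply: nab; exists a, b.
  exists (a, b); split=> //=; apply: box_volume_lb => // a' b' ab' Fab'.
  have [x] := Fk0; rewrite Fab => abx.
  by rewrite lee_fin (eq_bigr _ (fun i _ => box_side abx (etrans (esym Fab) Fab') i)).
pose coord (x : E) (i : nat) : R := if insub i is Some j then x 0 j else 0.
have coordE x (i : 'I_d) : coord x i = x 0 i by rewrite /coord valK.
have /(_ d (fun=> 1)) := @interval_cover_weight _ _
  (fun k => coord (ab k).1) (fun k => coord (ab k).2).
rewrite (@eq_eseriesr _ _
    (fun k => (\prod_(i < d) ((ab k).2 0 i - (ab k).1 0 i))%:E)); last first.
  by move=> k _; rewrite mul1r; under eq_bigr do rewrite !coordE.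
move=> h; apply: le_trans (h _ _ _) _ => //.
- move=> k i; rewrite /coord; case: insubP => [j _ _|//].
  by have [] := abP k.
- move=> x x01; pose y : E := \row_i x i.
  have [|k _ Fky] := FE y; first by move=> i; rewrite !mxE.
  have [_ Fk _] := abP k; rewrite Fk in Fky.
  apply: le_trans (nneseries_lim_ge k.+1 _); last first.
    by move=> n _ _; rewrite lee_fin mul1r prodr_ge0.
  rewrite big_nat_recr //= -[leLHS]add0e; apply: leeD.
    by apply: sume_ge0 => n _; rewrite lee_fin mul1r prodr_ge0.
  rewrite lee_fin mul1r big1 // => i _; rewrite !coordE indicE mem_set //=.
  by rewrite in_itv /=; have := Fky i; rewrite mxE.
- apply: lee_nneseries => [k _ _|k _]; last by have [] := abP k.
  rewrite lee_fin; apply: prodr_ge0 => i _; rewrite subr_ge0.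
  by have [] := abP k.
Qed.

End lebesgue_positive.

(** * Volumes of balls, shells and spheres *)

Section borel_lebesgue.
Context {R : realType} {d : nat}.
Local Notation E := 'rV[R]_d.
Local Notation lambda := (@lebesgue R d).

(** The volume on the Borel sets: unlike the Caratheodory measurable sets, they
    have measurable sections and are generated by the open sets. *)
Definition leb : set (borel R d) -> \bar R := lambda.

Let leb0 : leb set0 = 0%E. Proof. exact: outer_measure0. Qed.
Let leb_ge0 A : (0 <= leb A)%E. Proof. exact: outer_measure_ge0. Qed.
Let leb_sigma_additive : semi_sigma_additive leb.
Proof.
move=> F mF tF mUF; apply: (@measure_semi_sigma_additive _ _ _ (lebesgue_meas R d)) => //.
  by move=> i; exact: borel_caratheodory.
exact: borel_caratheodory.
Qed.
HB.instance Definition _ := isMeasure.Build _ _ _ leb leb0 leb_ge0 leb_sigma_additive.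

Lemma measurable_eball (x : E) r : measurable (eball x r : set (borel R d)).
Proof. by apply: open_borel; exact: open_eball. Qed.

Lemma leb_affine s (v : E) (A : set (borel R d)) : 0 < s ->
  leb (affine s v @^-1` A) = ((s ^- d)%:E * leb A)%E.
Proof. exact: lebesgue_affine. Qed.

Definition unit_ball_volume : R := fine (leb (eball 0 1)).

Lemma leb_unit_ball : leb (eball 0 1) = unit_ball_volume%:E.
Proof.
rewrite /unit_ball_volume fineK // ge0_fin_numE ?measure_ge0 //.
apply: (@le_lt_trans _ _ (lambda (box (const_mx (-1)) (const_mx 1)))).
  apply: le_outer_measure => x; rewrite /eball /= subr0 => x1 i.
  by rewrite !mxE; have := ler_enorm_coord x i; rewrite ler_norml => /andP[]; lra.
apply: le_lt_trans (lebesgue_box_le _) (ltry _).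
by move=> i; rewrite !mxE; lra.
Qed.

Lemma leb_eball_gt0 (x : E) r : 0 < r -> leb (eball x r) = (r ^+ d * unit_ball_volume)%:E.
Proof.
move=> r0; have := leb_affine x (eball x r) r0.
rewrite [_ @^-1` _](_ : _ = eball 0 1); last first.
  rewrite /eball /affine; apply/seteqP; split=> y /=;
  by rewrite addrAC subrr add0r enormZ gtr0_norm // subr0 gtr_pMr.
rewrite leb_unit_ball => h.
rewrite EFinM h muleA -EFinM divff ?mul1e //.
by rewrite expf_neq0 // gt_eqF.
Qed.

Lemma eball_trivial (x : E) r : r <= 0 -> eball x r = set0.
Proof.
move=> r0; apply/seteqP; split=> // y; rewrite /eball /=.
by have := enorm_ge0 (y - x); lra.
Qed.

Lemma leb_eball_fin (x : E) r : (leb (eball x r) < +oo)%E.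
Proof.
have [r0|r0] := ltP 0 r; first by rewrite leb_eball_gt0 // ltry.
by rewrite eball_trivial // measure0 ltry.
Qed.

Lemma eball_cover (x : E) : \bigcup_n eball x n.+1%:R = [set: E].
Proof.
apply/seteqP; split=> // y _; exists (Num.truncn (enorm (y - x))) => //=.
by rewrite /eball /= truncnS_gt.
Qed.

Let leb_sigma_finite : sigma_finite setT leb.
Proof.
exists (fun n => eball 0 n.+1%:R); first by rewrite eball_cover.
by move=> n; split; [exact: measurable_eball|exact: leb_eball_fin].
Qed.
HB.instance Definition _ := Measure_isSigmaFinite.Build _ _ _ leb leb_sigma_finite.

Hypothesis d0 : (0 < d)%N.

Lemma unit_ball_volume_gt0 : 0 < unit_ball_volume.
Proof.
have r0 : 0 < Num.sqrt d%:R + 1 :> R by rewrite ltr_wpDl ?sqrtr_ge0.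
have : (1 <= leb (eball 0 (Num.sqrt d%:R + 1)))%E.
  apply: le_trans (lebesgue_unit_box_ge1 d0) _; apply: le_outer_measure => x x01.
  rewrite /eball /= subr0; apply: (@le_lt_trans _ _ (Num.sqrt d%:R * 1)).
    apply: enorm_le_sup => // i; have := x01 i; rewrite !mxE => /andP[h1 h2].
    by rewrite ger0_norm // ltW.
  by rewrite mulr1; lra.
rewrite leb_eball_gt0 // lee_fin => h.
have := lt_le_trans ltr01 h; rewrite pmulr_rgt0 // exprn_gt0 //.
Qed.

Lemma leb_eball (x : E) r : 0 <= r -> leb (eball x r) = (r ^+ d * unit_ball_volume)%:E.
Proof.
rewrite le_eqVlt => /predU1P[<-|]; last exact: leb_eball_gt0.
by rewrite eball_trivial // measure0 expr0n gtn_eqF // mul0r.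
Qed.

Lemma subset_eball (x : E) r s : r <= s -> eball x r `<=` eball x s.
Proof. by move=> rs y; rewrite /eball /= => /lt_le_trans; exact. Qed.

(** The difference of the [d]-th powers of the two radii is divisible by the width
    of the shell. *)
Lemma leb_shell : exists2 C : R, 0 <= C & forall h, 0 <= h <= 1 ->
  (leb (eball 0%R (1 + h)%R `\` eball 0%R (1 - h)%R) <= (C * h)%:E)%E.
Proof.
pose C : R := 2 * (d%:R * 2 ^+ d) * unit_ball_volume.
have v0 := unit_ball_volume_gt0.
exists C; first by rewrite !mulr_ge0 ?exprn_ge0 // ltW.
move=> h /andP[h0 h1]; rewrite measureD; [|exact: measurable_eball..|exact: leb_eball_fin].
rewrite setIidr; last by apply: subset_eball; lra.
rewrite /= !leb_eball; [|lra..].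
rewrite -EFinB lee_fin -mulrBl /C [leRHS]mulrAC ler_pM2r //.
rewrite subrXX (_ : 1 + h - (1 - h) = 2 * h); last by ring.
rewrite [leRHS]mulrAC ler_wpM2l ?mulr_ge0 //.
rewrite mulr_natl -[X in _ *+ X]card_ord -sumr_const; apply: ler_sum => i _.
apply: (@le_trans _ _ (2 ^+ (d.-1 - i) * 1)).
  apply: ler_pM; rewrite ?exprn_ge0 //; try lra.
    by apply: lerXn2r; rewrite ?nnegrE; lra.
  by apply: exprn_ile1; lra.
by rewrite mulr1 ler_eXn2l ?ltr1n // (leq_trans (leq_subr _ _)) // leq_pred.
Qed.

Lemma measurable_sphere r : measurable ([set x : E | enorm x = r] : set (borel R d)).
Proof.
have := @enorm_borel R d measurableT [set r] (measurable_set1 r).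
by rewrite setTI.
Qed.

Lemma le_mul_small_eq0 (x : \bar R) (C : R) : (0 <= x)%E ->
  (forall h : R, 0 < h <= 1 -> (x <= (C * h)%:E)%E) -> x = 0%E.
Proof.
move=> x0 xC; apply/eqP; rewrite eq_le x0 andbT.
apply/lee_addgt0Pr => e e0; rewrite add0e.
have C0 : 0 <= C.
  have : (0 <= (C * 1)%:E)%E by apply: le_trans x0 (xC 1 _); lra.
  by rewrite mulr1 lee_fin.
pose h := Num.min 1 (e / (C + 1)).
have h0 : 0 < h by rewrite lt_min ltr01 divr_gt0 //; lra.
apply: le_trans (xC h _) _; first by rewrite h0 ge_min lexx.
rewrite lee_fin; apply: (@le_trans _ _ ((C + 1) * (e / (C + 1)))).
  by apply: ler_pM; rewrite ?ge_min ?lexx ?orbT //; lra.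
by rewrite mulrC divfK //; apply/eqP; lra.
Qed.

(** A sphere lies in arbitrarily thin shells, the origin in arbitrarily small
    balls. *)
Lemma leb_sphere r : leb [set x | enorm x = r] = 0%E.
Proof.
have v0 := unit_ball_volume_gt0.
have [r0|r0|->] := ltgtP r 0.
- rewrite (_ : [set _ | _] = set0) ?measure0 //.
  by apply/seteqP; split=> // x /= xr; have := enorm_ge0 x; lra.
- have [C _ shellC] := leb_shell.
  have S0 : leb esphere = 0%E.
    apply: (le_mul_small_eq0 (C := C)) => [|h /andP[h0 h1]]; first exact: measure_ge0.
    apply: le_trans (shellC h _); last by lra.
    apply: le_outer_measure => x; rewrite /esphere /eball /= !subr0 => ->.
    by split=> /=; lra.
  have := leb_affine 0 [set x | enorm x = r] r0.
  rewrite [_ @^-1` _](_ : _ = esphere); last first.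
    apply/seteqP; split=> x; rewrite /esphere /affine /= add0r enormZ gtr0_norm //.
      by move=> h; apply: (@mulfI _ r); rewrite ?gt_eqF // h mulr1.
    by move=> ->; rewrite mulr1.
  rewrite S0 => /esym/eqP; rewrite mule_eq0 => /orP[|/eqP//].
  by rewrite eqe invr_eq0 expf_eq0 gt_eqF // andbF.
- apply: (le_mul_small_eq0 (C := unit_ball_volume)) => [|h /andP[h0 h1]].
    exact: measure_ge0.
  apply: (@le_trans _ _ (leb (eball 0 h))).
    by apply: le_outer_measure => x; rewrite /eball /= subr0 => ->.
  rewrite (leb_eball _ (ltW h0)) lee_fin mulrC ler_pM2l //.
  by rewrite -[leRHS]expr1; apply: ler_wiXn2l => //; exact: ltW.
Qed.

End borel_lebesgue.
Arguments leb : clear implicits.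
Arguments unit_ball_volume : clear implicits.

(** * Integrability of the Gaussian *)

Section gaussian_integrable.
Context {R : realType} {d : nat}.
Local Notation E := 'rV[R]_d.

Definition gauss (tau : R) (r : R) : R := expR (- (tau * r ^+ 2)).

Lemma gauss_ge0 tau r : 0 <= gauss tau r.
Proof. exact: expR_ge0. Qed.

Lemma measurable_gauss tau : measurable_fun [set: R] (gauss tau).
Proof.
apply: measurableT_comp => //; apply: measurableT_comp => //.
apply: measurable_funM => //; exact: measurable_funX.
Qed.

Lemma expRN_le_inv_exp n (s : R) : 0 < s -> expR (- s) <= n.+1`!%:R / s ^+ n.+1.
Proof.
move=> s0; rewrite expRN -[leRHS]invrK lef_pV2 ?posrE ?expR_gt0 ?invr_gt0 //; last first.
  by rewrite divr_gt0 ?exprn_gt0 // ltr0n fact_gt0.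
rewrite invf_div; apply: le_trans (expR_ge1Dxn n (ltW s0)).
by rewrite lerDr.
Qed.

(** The Gaussian is dominated by a multiple of [2 ^- (n * d.+1)] on the dyadic
    shell of outer radius [2 ^ n], a ball of volume proportional to [2 ^ (n * d)]. *)
Lemma gauss_integral_fin tau : 0 < tau ->
  (\int[leb R d]_y (gauss tau (enorm y))%:E < +oo)%E.
Proof.
move=> tau0; set m := d.+1.
pose K : R := 1 + m`!%:R * (4 / tau) ^+ m.
have K0 : 0 < K.
  by rewrite ltr_wpDr // mulr_ge0 // exprn_ge0 // divr_ge0 // ltW.
pose g n (y : borel R d) : R := K / (2 ^+ n) ^+ m * \1_(eball 0 (2 ^+ n)) y.
have g0 n y : 0 <= g n y.
  by rewrite mulr_ge0 // divr_ge0 ?exprn_ge0 // ltW.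
have mg n : measurable_fun [set: borel R d] (g n).
  by apply: measurable_funM => //; apply: measurable_indic; exact: measurable_eball.
have mgauss : measurable_fun [set: borel R d] (fun y => (gauss tau (enorm y))%:E).
  apply/measurable_EFinP; apply: measurableT_comp; first exact: measurable_gauss.
  exact: enorm_borel.
apply: (@le_lt_trans _ _ (\int[leb R d]_y (\sum_(n <oo) (g n y)%:E))%E).
  apply: ge0_le_integral => //.
  - by move=> y _; rewrite lee_fin gauss_ge0.
  - apply: ge0_emeasurable_sum => [k y _ _|k _]; first by rewrite lee_fin.
    exact/measurable_EFinP.
  move=> y _.
  have [n0 n0P] : exists n, enorm y < 2 ^+ n :> R.
    exists (Num.truncn (enorm y)).+1; apply: lt_trans (truncnS_gt _) _.
    by rewrite -natrX ltr_nat ltn_expl.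
  have {n0 n0P} [n yn nmin] := @ex_minnP (fun n => enorm y < 2 ^+ n) (ex_intro _ n0 n0P).
  apply: (@le_trans _ _ (g n y)%:E); last first.
    apply: le_trans (nneseries_lim_ge n.+1 _); last by move=> k _ _; rewrite lee_fin.
    by rewrite big_nat_recr //= leeDr // sume_ge0 // => k _; rewrite lee_fin.
  rewrite lee_fin /g indicE mem_set ?mulr1; last by rewrite /eball /= subr0.
  case: n yn nmin => [_ _|n _ nmin].
    rewrite expr0 expr1n divr1 (@le_trans _ _ 1) //.
      by rewrite -expR0 ler_expR oppr_le0 mulr_ge0 ?sqr_ge0 // ltW.
    by rewrite lerDl mulr_ge0 // exprn_ge0 // divr_ge0 // ltW.
  have yn : 2 ^+ n <= enorm y by rewrite leNgt; apply/negP => /nmin; rewrite ltnn.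
  have y0 : 0 < enorm y by apply: lt_le_trans yn; rewrite exprn_gt0.
  apply: le_trans (expRN_le_inv_exp d _) _; first by rewrite mulr_gt0 ?exprn_gt0.
  apply: (@le_trans _ _ (m`!%:R * (4 / tau) ^+ m / (2 ^+ n.+1) ^+ m)); last first.
    by rewrite ler_wpM2r ?invr_ge0 ?exprn_ge0 // lerDr.
  rewrite -mulrA ler_wpM2l // -expr_div_n -exprVn.
  have p0 : 0 < 4 / tau / 2 ^+ n.+1 by rewrite !divr_gt0 ?exprn_gt0.
  have q0 : 0 < tau * enorm y ^+ 2 by rewrite mulr_gt0 ?exprn_gt0.
  apply: lerXn2r; rewrite ?nnegrE ?(ltW p0) ?invr_ge0 ?(ltW q0) //.
  rewrite -[leRHS]invrK lef_pV2 ?posrE ?invr_gt0 //.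
  rewrite !invf_div mulrCA ler_pM2l // exprS.
  have h1 : 1 <= 2 ^+ n :> R by rewrite exprn_ege1 // ler1n.
  have h2 : 2 ^+ n * 1 <= enorm y * enorm y by apply: ler_pM => //; lra.
  by rewrite expr2; lra.
rewrite integral_nneseries //; last 2 first.
- by move=> k; apply/measurable_EFinP.
- by move=> k y _; rewrite lee_fin.
pose v := unit_ball_volume R d.
rewrite (@eq_eseriesr _ _ (fun n => (2 * K * v / (2 ^ (n + 1))%:R)%:E)); last first.
  move=> n _; rewrite /g; under eq_integral do rewrite EFinM.
  rewrite ge0_integralZl //; last 2 first.
  - by apply/measurable_EFinP; apply: measurable_indic; exact: measurable_eball.
  - by rewrite lee_fin divr_ge0 ?exprn_ge0 // ltW.
  rewrite integral_indic ?setIT //; last exact: measurable_eball.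
  rewrite /= leb_eball_gt0 ?exprn_gt0 // -EFinM -/v; congr _%:E.
  rewrite natrX addn1 !exprS; field.
  by rewrite !expf_neq0.
have /cvg_lim -> // := @cvg_geometric_eseries_half R (2 * K * v) 0.
exact: ltry.
Qed.

End gaussian_integrable.

(** * Borel hulls of measurable sets *)

Section borel_hull.
Context {R : realType} {d : nat}.
Local Notation E := 'rV[R]_d.
Local Notation lambda := (@lebesgue R d).

Lemma lebesgue_le_box_volume (U : set E) : (lambda U <= box_volume U)%E.
Proof.
have [->|/set0P U0] := eqVneq U set0; first by rewrite outer_measure0 box_volume0.
by apply: box_volume_lb => // a b ab ->; exact: lebesgue_box_le.
Qed.

Lemma box_measurable (a b : E) : measurable (box a b : set (borel R d)).
Proof.
rewrite (_ : box a b =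
  \bigcap_(i in [set: 'I_d]) (fun x : borel R d => x 0 i) @^-1` `]a 0 i, b 0 i]).
  apply: fin_bigcap_measurable => // i _.
  have := @coord_borel R d i measurableT `]a 0 i, b 0 i]%classic (measurable_itv _).
  by rewrite setTI.
apply/seteqP; split=> x h i; first by move=> _ /=; rewrite in_itv; exact: h.
by have := h i I; rewrite /= in_itv.
Qed.

Lemma box_volume_fin_measurable (U : set E) : (box_volume U < +oo)%E ->
  measurable (U : set (borel R d)).
Proof.
move=> Uoo; have [->//|/set0P U0] := eqVneq U set0.
have [[a [b ->]]|nab] := pselect (exists a b : E, U = box a b).
  exact: box_measurable.
exfalso; move: Uoo; rewrite ltNge => /negP; apply.
by apply: box_volume_lb => // a b _ Uab; exfalso; apply: nab; exists a, b.
Qed.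

(** [G] is an intersection of unions of boxes; a cover of finite volume consists
    of boxes and empty sets, everything else having infinite [box_volume]. *)
Lemma outer_borel_hull (X : set E) : (lambda X < +oo)%E ->
  exists G : set (borel R d), [/\ measurable G, X `<=` G & leb R d G = lambda X].
Proof.
move=> Xoo; have Xfin : lambda X \is a fin_num by rewrite ge0_fin_numE // outer_measure_ge0.
have /choice[F FP] : forall n, exists F : (set E)^nat, X `<=` \bigcup_k F k /\
    (\sum_(k <oo) box_volume (F k) <= lambda X + n.+1%:R^-1%:E)%E.
  move=> n; have n0 : 0 < n.+1%:R^-1 :> R by [].
  have [_ [F [_ XF] <-] FX] := lb_ereal_inf_adherent n0 Xfin.
  by exists F; split=> //; exact: ltW.
have mF n k : measurable (F n k : set (borel R d)).
  apply: box_volume_fin_measurable; have [_ h] := FP n.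
  apply: (@le_lt_trans _ _ (lambda X + n.+1%:R^-1%:E)%E); last first.
    by rewrite lte_add_pinfty // ltry.
  apply: le_trans h; apply: le_trans (nneseries_lim_ge k.+1 _); last first.
    by move=> ? _ _; exact: box_volume_ge0.
  rewrite big_nat_recr //= leeDr // sume_ge0 // => ? _; exact: box_volume_ge0.
pose G := \bigcap_n \bigcup_k F n k.
have XG : X `<=` G by move=> x Xx n _; exact: (FP n).1.
exists G; split=> //.
  by apply: bigcapT_measurable => n; apply: bigcupT_measurable => k; exact: mF.
apply/eqP; rewrite eq_le; apply/andP; split; last exact: le_outer_measure.
apply/lee_addgt0Pr => e e0.
have [n ne] := @ltr_add_invr R 0 e e0; rewrite add0r in ne.
apply: (@le_trans _ _ (lambda (\bigcup_k F n k))).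
  by apply: le_outer_measure => x; exact.
apply: le_trans (outer_measure_sigma_subadditive _ _) _.
apply: (@le_trans _ _ (\sum_(k <oo) box_volume (F n k))%E).
  apply: lee_nneseries => [k _ _|k _]; first exact: outer_measure_ge0.
  exact: lebesgue_le_box_volume.
by apply: le_trans (FP n).2 _; rewrite leeD2l // lee_fin ltW.
Qed.

(** The hull is assembled from the hulls of the parts of [A] in balls, whose outer
    measure is finite. *)
Lemma borel_hull (A : set E) : lambda.-cara.-measurable A ->
  exists B N : set (borel R d), [/\ measurable B, measurable N,
    A `<=` B, B `\` A `<=` N & leb R d N = 0%E].
Proof.
move=> mA; pose C n := A `&` eball 0 n.+1%:R.
have mC n : lambda.-cara.-measurable (C n).
  by apply: measurableI => //; apply: borel_caratheodory; exact: measurable_eball.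
have Coo n : (lambda (C n) < +oo)%E.
  apply: le_lt_trans (leb_eball_fin 0 n.+1%:R).
  by apply: le_outer_measure => x [].
have /choice[G GP] : forall n, exists G : set (borel R d),
    [/\ measurable G, C n `<=` G & leb R d G = lambda (C n)].
  by move=> n; exact: outer_borel_hull.
have D0 n : lambda (G n `\` C n) = 0%E.
  have [mG CG GE] := GP n.
  have mG' := borel_caratheodory mG.
  have := @measureD _ _ _ (lebesgue_meas R d) _ _ mG' (mC n).
  rewrite /= setIidr // => -> //; last by rewrite -[X in (X < _)%E]/(leb R d (G n)) GE.
  rewrite -[X in (X - _)%E]/(leb R d (G n)) GE subee //.
  by rewrite ge0_fin_numE // outer_measure_ge0.
have /choice[N NP] : forall n, exists N : set (borel R d),
    [/\ measurable N, G n `\` C n `<=` N & leb R d N = 0%E].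
  move=> n; have [] := @outer_borel_hull (G n `\` C n); first by rewrite D0 ltry.
  by move=> N; rewrite D0; exists N.
exists (\bigcup_n G n), (\bigcup_n N n); split.
- by apply: bigcupT_measurable => n; have [] := GP n.
- by apply: bigcupT_measurable => n; have [] := NP n.
- move=> x Ax; have : (\bigcup_n eball (0 : E) n.+1%:R) x by rewrite eball_cover.
  by move=> [n _ xn]; exists n => //; have [_ CG _] := GP n; exact: CG.
- move=> x [[n _ Gnx] Ax]; exists n => //; have [_ GN _] := NP n; apply: GN.
  by split=> // -[].
- apply/eqP; rewrite eq_le measure_ge0 andbT.
  apply: le_trans (outer_measure_sigma_subadditive _ _) _.
  by rewrite eseries0 // => n _ _; have [] := NP n.
Qed.

End borel_hull.

(** * Measures that are uniform on balls *)

Section image_measure.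
Context {R : realType} {dd dd' : measure_display}.
Context {X : measurableType dd} {Y : measurableType dd'}.

Lemma preimage_sigma_additive (m : {measure set X -> \bar R}) (f : X -> Y) :
  measurable_fun setT f -> semi_sigma_additive (fun A : set Y => m (f @^-1` A)).
Proof.
move=> mf; have mpre A : measurable A -> measurable (f @^-1` A).
  by move=> mA; rewrite -[X in measurable X]setTI; exact: mf.
move=> F mF tF mUF; rewrite preimage_bigcup.
apply: measure_semi_sigma_additive.
- by move=> n; exact: mpre.
- apply/trivIsetP => /= i j _ _ ij; rewrite -preimage_setI.
  by move/trivIsetP : tF => /(_ _ _ _ _ ij) ->//; rewrite preimage_set0.
- by rewrite -preimage_bigcup; exact: mpre.
Qed.

End image_measure.

Section ball_exchange.
Context {R : realType} {d : nat}.
Local Notation E := 'rV[R]_d.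
Local Notation B := (borel R d).
Local Open Scope ereal_scope.
Implicit Types (mu nu : {sigma_finite_measure set B -> \bar R}).

Lemma measurable_borelB : measurable_fun [set: B * B] (fun p => p.2 - p.1 : B)%R.
Proof.
apply: measurable_borel => i.
rewrite (_ : (fun t => _) = fun p : B * B => (p.2 0 i - p.1 0 i)%R); last first.
  by apply/funext => p; rewrite !mxE.
apply: measurable_funB.
- apply: (measurableT_comp (coord_borel i)); exact: measurable_snd.
- apply: (measurableT_comp (coord_borel i)); exact: measurable_fst.
Qed.

Lemma eball_sym (x y : E) r : eball x r y = eball y r x.
Proof. by rewrite /eball /= enormB. Qed.

(** Fubini's theorem for the set of pairs [(x, y)] with [y] in [U] and [x], [y] at
    distance less than [r]. *)
Lemma ball_exchange mu nu (U : set B) (r : R) : measurable U ->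
  \int[nu]_x mu (U `&` eball x r) = \int[mu]_(y in U) nu (eball y r) /\
  measurable_fun [set: B] (fun x => mu (U `&` eball x r)).
Proof.
move=> mU; pose W : set (B * B) := [set p | U p.2 /\ eball p.1 r p.2].
have mW : measurable W.
  rewrite (_ : W = (setT `*` U) `&` (fun p => enorm (p.2 - p.1)%R) @^-1` `]-oo, r[).
    apply: measurableI; first exact: measurableX.
    have := measurableT_comp enorm_borel measurable_borelB.
    by move=> /(_ measurableT _ (measurable_itv `]-oo, r[)); rewrite setTI.
  apply/seteqP; split=> -[x y]; rewrite /W /= /eball /= in_itv /=.
    by move=> [].
  by move=> [[]].
have xE x : xsection W x = U `&` eball x r.
  by apply/seteqP; split=> y; rewrite /xsection /= inE.
have yE y : ysection W y = if y \in U then eball y r else set0.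
  apply/seteqP; split=> x; rewrite /ysection /= inE /W /=.
    by move=> [Uy xy]; rewrite mem_set // eball_sym.
  by case: ifPn => //; rewrite inE eball_sym.
have := indic_fubini_tonelli nu mu mW.
rewrite (_ : (fun x => _) = mu \o xsection W); last first.
  exact: indic_fubini_tonelli_FE.
rewrite (_ : (fun y => _) = nu \o ysection W); last first.
  exact: indic_fubini_tonelli_GE.
move=> h; split.
  transitivity (\int[nu]_x (mu \o xsection W) x).
    by apply: eq_integral => x _; rewrite /= xE.
  rewrite h [RHS]integral_mkcond; apply: eq_integral => y _; rewrite /= yE /patch.
  by case: ifP => // _; rewrite measure0.
rewrite (_ : (fun x => _) = mu \o xsection W); last by apply/funext => x /=; rewrite xE.
exact: measurable_fun_xsection.
Qed.

(** Two measures are compared through the mass of [U] seen from the balls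
    centered at points [x] with [eball x r] inside [U], exchanging the roles of
    the centre and of the point of the ball. *)
Lemma uniform_ball_le mu nu (S : set B) (U : set B) (r : R) (h g : \bar R) :
  measurable S -> mu (~` S) = 0 -> nu (~` S) = 0 -> measurable U ->
  measurable ([set x : E | eball x r `<=` U] : set B) ->
  0 <= h -> 0 <= g ->
  (forall x, S x -> mu (eball x r) = h) -> (forall x, S x -> nu (eball x r) = g) ->
  h * nu [set x : E | eball x r `<=` U] <= g * mu U.
Proof.
move=> mS muS nuS mU; set V := [set x : E | _] => mV h0 g0 muh nug.
have [exch mexch] := ball_exchange mu nu r mU.
have nuV : nu V = nu (V `&` S).
  have : nu (V `\` S) = 0.
    apply/eqP; rewrite eq_le measure_ge0 andbT -nuS le_measure ?inE //.
    - exact: measurableD.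
    - exact: measurableC.
  by move=> VS; rewrite (measureDI nu mV mS) [X in X + _]VS add0e.
apply: (@le_trans _ _ (\int[nu]_x mu (U `&` eball x r))).
  rewrite nuV -integral_cst //; last exact: measurableI.
  apply: (@le_trans _ _ (\int[nu]_(x in V `&` S) mu (U `&` eball x r))).
    apply: ge0_le_integral => //.
    - exact: measurableI.
    - exact: measurable_funTS.
    - move=> x [Vx Sx]; rewrite setIidr //= muh //.
  apply: ge0_subset_integral => //.
  exact: measurableI.
have mnu : measurable_fun U (fun y => nu (eball y r)).
  have [_] := ball_exchange nu mu r measurableT.
  rewrite (_ : (fun x => _) = fun y => nu (eball y r)).
    exact: measurable_funTS.
  by apply/funext => x; rewrite setTI.
rewrite exch (ge0_negligible_integral (N := ~` S)) //; last exact: measurableC.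
rewrite setDE setCK (eq_integral (cst g)).
  rewrite integral_cst; last exact: measurableI.
  by apply: lee_wpmul2l => //; rewrite le_measure ?inE //; exact: measurableI.
by move=> x; rewrite inE => -[_ Sx]; rewrite /= nug.
Qed.

End ball_exchange.

Section uniform_measures.
Context {R : realType} {d : nat}.
Local Notation E := 'rV[R]_d.
Local Notation B := (borel R d).
Local Open Scope ereal_scope.
Implicit Types (mu nu : {sigma_finite_measure set B -> \bar R}).

Lemma eball_inside_closed (U : set E) r : closed [set x : E | eball x r `<=` U].
Proof.
rewrite -[X in closed X]setCK; apply: open_closedC.
rewrite (_ : ~` _ = \bigcup_(z in ~` U) eball z r).
  by apply: bigcup_open => z _; exact: open_eball.
apply/seteqP; split=> x /=.
  move=> /existsNP[z /not_implyP[xz Uz]]; exists z => //.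
  by rewrite eball_sym.
by move=> [z Uz zx] xU; apply/Uz/xU; rewrite eball_sym.
Qed.

(** The points with their ball of radius [r] inside [U] exhaust the open set [U]
    as [r] decreases, and the factors [h r] of [uniform_ball_le] cancel. *)
Lemma uniform_measures_open_le mu nu (S : set B) (h : R -> \bar R) (U : set B) :
  measurable S -> mu (~` S) = 0 -> nu (~` S) = 0 ->
  (forall r : R, (0 < r)%R -> 0 < h r < +oo) ->
  (forall x r, S x -> (0 < r)%R -> mu (eball x r) = h r /\ nu (eball x r) = h r) ->
  open (U : set E) -> nu U <= mu U.
Proof.
move=> mS muS nuS h0 munu oU.
have mU : measurable U by exact: open_borel.
pose V n : set B := [set x : E | eball x n.+1%:R^-1%R `<=` U].
have mV n : measurable (V n).
  rewrite -[V n]setCK; apply: measurableC; apply: open_borel.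
  by apply: closed_openC; exact: eball_inside_closed.
have VU : \bigcup_n V n = U.
  apply/seteqP; split=> x.
    by move=> [n _]; apply; rewrite /eball /= subrr enorm0 invr_gt0.
  move=> Ux; have [r r0 xrU] := nbhs_eball (open_nbhs_nbhs (conj oU Ux)).
  have [n] := @ltr_add_invr R 0%R r r0; rewrite add0r => nr; exists n => //.
  by apply: subset_trans xrU; apply: subset_eball; exact: ltW.
have cvgV : nu \o V @ \oo --> nu U.
  rewrite -[X in _ --> nu X]VU; apply: nondecreasing_cvg_mu => //.
    by rewrite VU.
  move=> m n mn; apply/subsetPset => x; apply: subset_trans; apply: subset_eball.
  by rewrite lef_pV2 ?posrE // ler_nat.
rewrite -(cvg_lim _ cvgV) //; apply: lime_le; first by apply/cvg_ex; exists (nu U).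
apply: nearW => n /=.
have r0 : (0 < n.+1%:R^-1 :> R)%R by [].
have /andP[hr0 hroo] := h0 _ r0.
have hfin : h n.+1%:R^-1%R \is a fin_num by rewrite ge0_fin_numE // ltW.
rewrite -(@lee_pmul2l _ (h n.+1%:R^-1%R)) //.
apply: (@uniform_ball_le _ _ mu nu S) => //; rewrite ?(ltW hr0) //.
- exact: mV.
- by move=> x Sx; have [] := munu x _ Sx r0.
- by move=> x Sx; have [] := munu x _ Sx r0.
Qed.

(** Christensen's theorem: both measures agree on the open sets, which generate
    the Borel sets. *)
Lemma uniform_measures_eq mu nu (S : set B) (h : R -> \bar R) (x0 : E) (A : set B) :
  measurable S -> S x0 -> mu (~` S) = 0 -> nu (~` S) = 0 ->
  (forall r : R, (0 < r)%R -> 0 < h r < +oo) ->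
  (forall x r, S x -> (0 < r)%R -> mu (eball x r) = h r /\ nu (eball x r) = h r) ->
  measurable A -> mu A = nu A.
Proof.
move=> mS Sx0 muS nuS h0 munu mA.
apply: (measure_unique (@open E : set (set B)) (fun n => eball x0 n.+1%:R)) => //.
- exact: openI.
- by move=> n; exact: open_eball.
- exact: eball_cover.
- move=> U oU; apply/eqP; rewrite eq_le; apply/andP; split.
    apply: (@uniform_measures_open_le nu mu S h) => // x r Sx r0.
    by have [] := munu x r Sx r0.
  exact: (@uniform_measures_open_le mu nu S h).
- move=> n; have [e _] := munu x0 n.+1%:R%R Sx0 (ltr0Sn _ _).
  have /andP[_ hoo] := h0 n.+1%:R%R (ltr0Sn _ _).
  exact: (eq_ind_r (fun z => z < +oo) hoo e).
Qed.

End uniform_measures.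

(** * Reflections preserve the volume *)

Section reflection_invariance.
Context {R : realType} {d : nat}.
Local Notation E := 'rV[R]_d.
Local Notation B := (borel R d).
Hypothesis d0 : (0 < d)%N.
Variables a b : E.

Lemma measurable_dot (v : E) : measurable_fun [set: B] (fun x : B => dot x v).
Proof.
apply: measurable_sum => i; apply: measurable_funM => //; exact: coord_borel.
Qed.

Lemma measurable_reflection : measurable_fun [set: B] (reflection a b : B -> B).
Proof.
apply: measurable_borel => i; rewrite /reflection.
rewrite (_ : (fun t => _) = (fun t : B => t 0 i -
    2 * dot t (a - b) / dot (a - b) (a - b) * (a - b) 0 i)); last first.
  by apply/funext => t; rewrite !mxE.
apply: measurable_funB; first exact: coord_borel.
do 2 (apply: measurable_funM => //).
by apply: measurable_funM => //; exact: measurable_dot.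
Qed.

Lemma reflection_eball (x : E) r :
  reflection a b @^-1` eball x r = eball (reflection a b x) r.
Proof.
apply/seteqP; split=> y; rewrite /eball /= => h.
  by rewrite -(reflectionK a b y) reflectionB enorm_reflection.
by rewrite -(reflectionK a b x) reflectionB enorm_reflection.
Qed.

Definition reflected_leb (A : set B) : \bar R := leb R d (reflection a b @^-1` A).

Let leb_refl0 : reflected_leb set0 = 0%E.
Proof. by rewrite /reflected_leb preimage_set0 measure0. Qed.
Let leb_refl_ge0 A : (0 <= reflected_leb A)%E.
Proof. exact: outer_measure_ge0. Qed.
Let leb_refl_sigma_additive : semi_sigma_additive reflected_leb.
Proof.
exact: (@preimage_sigma_additive _ _ _ B B (leb R d) _ measurable_reflection).
Qed.
HB.instance Definition _ := isMeasure.Build _ _ _ reflected_leb leb_refl0 leb_refl_ge0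
  leb_refl_sigma_additive.
Let leb_refl_sigma_finite : sigma_finite setT reflected_leb.
Proof.
exists (fun n => eball 0 n.+1%:R); first by rewrite eball_cover.
move=> n; split; first exact: measurable_eball.
by rewrite /reflected_leb reflection_eball; exact: leb_eball_fin.
Qed.
HB.instance Definition _ :=
  Measure_isSigmaFinite.Build _ _ _ reflected_leb leb_refl_sigma_finite.

(** Reflections map balls to balls of the same radius, hence preserve the volume. *)
Lemma leb_reflection (A : set B) : measurable A -> leb R d (reflection a b @^-1` A) = leb R d A.
Proof.
move=> mA; apply: (@uniform_measures_eq _ _ reflected_leb (leb R d) setT
  (fun r => (r ^+ d * unit_ball_volume R d)%:E) 0) => //.
- by rewrite setCT measure0.
- by rewrite setCT measure0.
- by move=> r r0; rewrite lte_fin mulr_gt0 ?exprn_gt0 ?unit_ball_volume_gt0 //= ltry.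
- move=> x r _ r0; split; last exact: leb_eball_gt0.
  have : leb R d (eball (reflection a b x) r) = (r ^+ d * unit_ball_volume R d)%:E.
    exact: leb_eball_gt0.
  by rewrite -reflection_eball.
Qed.

End reflection_invariance.

(** * Uniqueness of the uniform measure on the sphere *)

Section spherical_measures.
Context {R : realType} {d : nat}.
Local Notation E := 'rV[R]_d.
Local Notation B := (borel R d).
Local Open Scope ereal_scope.
Hypothesis d0 : (0 < d)%N.

Definition spherical (mu : set B -> \bar R) : Prop :=
  mu (~` esphere) = 0 /\
  forall (x y : E) r, esphere x -> esphere y -> mu (eball x r) = mu (eball y r).

Implicit Types (mu nu : {finite_measure set B -> \bar R}).

Lemma measurable_esphere : measurable (esphere : set B).
Proof. exact: measurable_sphere. Qed.

(** Averaging over all centers with respect to the volume, some ball has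
    positive mass; it meets the sphere, so a larger cap contains it. *)
Lemma spherical_cap_gt0 mu x r : spherical mu -> 0 < mu setT -> esphere x ->
  (0 < r)%R -> 0 < mu (eball x r).
Proof.
move=> [muS mur] muT Sx r0; rewrite lt_neqAle measure_ge0 andbT eq_sym.
apply/negP => /eqP mux0.
have null (y : E) : mu (eball y (r / 2)%R) = 0.
  have [[z [Sz yz]]|no] := pselect (exists z, esphere z /\ eball y (r / 2)%R z).
    apply/eqP; rewrite eq_le measure_ge0 andbT -mux0 (mur x z) //.
    rewrite le_measure ?inE; [by []|exact: measurable_eball..|].
    move=> w; move: yz; rewrite /eball /= enormB => yz yw.
    by have := enorm_triangle w y z; lra.
  apply/eqP; rewrite eq_le measure_ge0 andbT -muS.
  rewrite le_measure ?inE; [by []|exact: measurable_eball| |].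
    by apply: measurableC; exact: measurable_esphere.
  by move=> w yw Sw; apply: no; exists w.
have [exch _] := @ball_exchange _ _ mu (leb R d) setT (r / 2)%R measurableT.
move: exch; rewrite (eq_integral (cst 0)); last by move=> y _; rewrite setTI; exact: null.
rewrite integral0 (eq_integral (cst ((r / 2) ^+ d * unit_ball_volume R d)%:E)).
  rewrite integral_cst // => /esym/eqP; rewrite mule_eq0 gt_eqF ?orbF //=.
    by rewrite gt_eqF.
  by rewrite lte_fin mulr_gt0 ?exprn_gt0 ?unit_ball_volume_gt0 // divr_gt0.
by move=> y _; apply: leb_eball_gt0; exact: divr_gt0.
Qed.

(** Comparing both measures through the full space, where every ball is allowed,
    shows that they agree on the balls centered on the sphere. *)
Lemma spherical_eq mu nu (A : set B) : spherical mu -> spherical nu ->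
  mu setT = nu setT -> measurable A -> mu A = nu A.
Proof.
move=> smu snu mnT mA.
have [T0|T0] := eqVneq (mu setT) 0.
  have z (m : {finite_measure set B -> \bar R}) : m setT = 0 -> m A = 0.
    by move=> m0; apply/eqP; rewrite eq_le measure_ge0 andbT -m0 le_measure ?inE.
  by rewrite !z // -mnT.
have muT : 0 < mu setT by rewrite lt_neqAle measure_ge0 eq_sym T0.
have nuT : 0 < nu setT by rewrite -mnT.
have [muS mur] := smu; have [nuS nur] := snu.
have [x0 Sx0] : exists x : E, esphere x.
  apply: contrapT => /forallNP noS; move: muS muT.
  by rewrite (_ : ~` esphere = setT) => [->|]; [rewrite ltxx|apply/seteqP; split=> // x _; exact: noS].
have VT r : [set x : E | eball x r `<=` setT] = setT :> set B.
  by apply/seteqP; split=> // x _ y.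
have eq_caps r : (0 < r)%R -> mu (eball x0 r) = nu (eball x0 r).
  move=> r0.
  have le (m n : {finite_measure set B -> \bar R}) : m (~` esphere) = 0 -> n (~` esphere) = 0 ->
      (forall (x y : E) r, esphere x -> esphere y -> m (eball x r) = m (eball y r)) ->
      (forall (x y : E) r, esphere x -> esphere y -> n (eball x r) = n (eball y r)) ->
      m (eball x0 r) * n setT <= n (eball x0 r) * m setT.
    move=> mS nS mr nr.
    have := @uniform_ball_le _ _ m n esphere setT r (m (eball x0 r)) (n (eball x0 r)).
    rewrite VT; apply=> //; [exact: measurable_esphere|by move=> x Sx; exact: mr|].
    by move=> x Sx; exact: nr.
  apply/eqP; rewrite eq_le.
  have fin : mu setT \is a fin_num by apply: fin_num_measure.
  rewrite -(@lee_pmul2r _ (mu setT)) // {1}mnT le //=.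
  by rewrite -(@lee_pmul2r _ (mu setT)) // {2}mnT le.
apply: (@uniform_measures_eq _ _ mu nu esphere (fun r => mu (eball x0 r)) x0) => //.
- exact: measurable_esphere.
- move=> r r0; rewrite spherical_cap_gt0 //= ltey_eq fin_num_measure //.
  exact: measurable_eball.
- by move=> x r Sx r0; split; [exact: mur|rewrite eq_caps //; exact: nur].
Qed.

Lemma spherical_proportional nu (sigma : probability B R) (A : set B) :
  spherical nu -> spherical sigma -> measurable A ->
  nu A = nu setT * sigma A.
Proof.
move=> snu [sS sr] mA.
have fin : nu setT \is a fin_num by apply: fin_num_measure.
have m0 : (0 <= fine (nu setT))%R by rewrite fine_ge0.
pose m := mscale (NngNum m0) sigma.
have mE C : m C = nu setT * sigma C by rewrite /m /mscale /= fineK.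
rewrite -mE; apply: spherical_eq => //.
- split; first by apply: etrans (mE _) _; rewrite sS mule0.
  move=> x y r Sx Sy; apply: etrans (mE _) _; apply: etrans _ (esym (mE _)).
  by rewrite (sr x y).
- by apply: etrans _ (esym (mE _)); rewrite probability_setT mule1.
Qed.

End spherical_measures.

(** * Hausdorff measures: isometries and separated sets *)

Section hausdorff_basics.
Context {R : realType} {d s : nat}.
Local Notation E := 'rV[R]_d.
Local Notation H := (@hausdorff R d s).
Local Open Scope ereal_scope.
Implicit Types (A B U V X : set E).

Lemma ediam_ge0 U : U !=set0 -> 0 <= ediam U.
Proof.
move=> [x Ux]; apply: (@le_trans _ _ (enorm (x - x)%R)%:E).
  by rewrite lee_fin enorm_ge0.
by apply: ereal_sup_ubound; exists (x, x).
Qed.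

Lemma le_ediam U V : U `<=` V -> ediam U <= ediam V.
Proof.
move=> UV; apply: ge_ereal_sup => _ [[x y] [Ux Uy] <-].
by apply: ereal_sup_ubound; exists (x, y) => //; split; exact: UV.
Qed.

Lemma lee_expe (x y : \bar R) n : 0 <= x -> x <= y -> x ^+ n <= y ^+ n.
Proof.
move=> x0 xy; elim: n => [|n IH]; first by rewrite !expe0.
by rewrite !expeS; apply: lee_pmul => //; exact: expe_ge0.
Qed.

(** Both the isometric preimages and the subsets of [U] have this property. *)
Lemma diam_gauge_le e U V : (V !=set0 -> U !=set0 /\ ediam V <= ediam U) ->
  diam_gauge s e V <= diam_gauge s e U.
Proof.
have [->|/set0P V0] := eqVneq V set0; first by rewrite diam_gauge0 diam_gauge_ge0.
move=> /(_ V0)[/set0P U0 VU]; rewrite /diam_gauge (negbTE U0).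
move/set0P : (V0) => /negbTE ->.
case: ifPn => [VE|/negP VE]; case: ifPn => [UE|UE]; rewrite ?leey //.
  by apply: lee_expe => //; exact: ediam_ge0.
by exfalso; apply: VE; exact: le_trans VU UE.
Qed.

Lemma mu_ext_diam_gauge_le e e' A : (e <= e')%R ->
  mu_ext (diam_gauge s e') A <= mu_ext (diam_gauge s e) A.
Proof.
move=> ee'; rewrite -[leRHS]mul1e -[A]preimage_id.
apply: mu_ext_preimage => // [U|U|U]; try exact: diam_gauge_ge0.
rewrite mul1e preimage_id /diam_gauge; case: ifP => // _.
case: ifPn => [UE|UE]; case: ifPn => [UE'|UE'] //; rewrite ?leey //.
by move: UE; rewrite (le_trans UE') // lee_fin.
Qed.

Lemma mu_ext_le_hausdorff e A : (0 < e)%R -> mu_ext (diam_gauge s e) A <= H A.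
Proof. by move=> e0; apply: ereal_sup_ubound; exists e. Qed.

Lemma hausdorff_preimage_le (f : E -> E) A :
  (forall x y, enorm (f x - f y)%R = enorm (x - y)%R) -> H (f @^-1` A) <= H A.
Proof.
move=> iso; apply: ge_ereal_sup => _ [e e0 <-].
apply: le_trans (mu_ext_le_hausdorff A e0).
rewrite -[leRHS]mul1e; apply: mu_ext_preimage => // [U|U|U]; try exact: diam_gauge_ge0.
rewrite mul1e; apply: diam_gauge_le => -[x Ux]; split; first by exists (f x).
apply: ge_ereal_sup => _ [[y z] [Uy Uz] <-] /=; rewrite -iso.
by apply: ereal_sup_ubound; exists (f y, f z).
Qed.

(** Preimages under isometries do not increase the measure, and an involution is
    its own inverse. *)
Lemma hausdorff_involution (f : E -> E) A :
  (forall x y, enorm (f x - f y)%R = enorm (x - y)%R) -> involutive f ->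
  H (f @^-1` A) = H A.
Proof.
move=> iso fK; apply/eqP; rewrite eq_le hausdorff_preimage_le //=.
have {1}-> : A = f @^-1` (f @^-1` A) by apply/seteqP; split=> x /=; rewrite fK.
exact: hausdorff_preimage_le.
Qed.

(** Sets at positive distance are not met by a common set of small diameter. *)
Lemma hausdorff_separated (eta : R) A B X : (0 < eta)%R ->
  (forall x y, A x -> B y -> (eta <= enorm (x - y))%R) -> A `|` B `<=` X ->
  H A + H B <= H X.
Proof.
move=> eta0 sep ABX.
have [->|Xoo] := eqVneq (H X) +oo; first exact: leey.
have le_e e e' : (0 < e)%R -> (0 < e')%R ->
    mu_ext (diam_gauge s e) A + mu_ext (diam_gauge s e') B <= H X.
  move=> e0 e'0; pose e2 := Num.min (Num.min e e') (eta / 2)%R.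
  have e20 : (0 < e2)%R by rewrite !lt_min e0 e'0 divr_gt0.
  apply: (@le_trans _ _ (mu_ext (diam_gauge s e2) A + mu_ext (diam_gauge s e2) B)).
    by apply: leeD; apply: mu_ext_diam_gauge_le; rewrite !ge_min lexx ?orbT.
  apply: (@le_trans _ _ (mu_ext (diam_gauge s e2) (A `|` B))); last first.
    apply: le_trans (mu_ext_le_hausdorff (A `|` B) e20) _; exact: le_outer_measure.
  rewrite -[X in mu_ext _ X + _](_ : (A `|` B) `&` A = A); last first.
    by rewrite setIC setIidl //; exact: subsetUl.
  rewrite -[X in _ + mu_ext _ X](_ : (A `|` B) `&` B = B); last first.
    by rewrite setIC setIidl //; exact: subsetUr.
  apply: mu_ext_split => [U|U]; first exact: diam_gauge_ge0.
  have [->|/set0P[x [Ux Ax]]] := eqVneq (U `&` A) set0.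
    rewrite diam_gauge0 add0e; apply: diam_gauge_le => -[y [Uy _]].
    by split; [exists y|apply: le_ediam => ? []].
  have [->|/set0P[y [Uy By]]] := eqVneq (U `&` B) set0.
    rewrite diam_gauge0 adde0; apply: diam_gauge_le => _.
    by split; [exists x|apply: le_ediam => ? []].
  rewrite [leRHS]/diam_gauge ifF; last by apply/negbTE/set0P; exists x.
  rewrite ifF ?leey //; apply/negP => UE.
  have : (enorm (x - y))%:E <= e2%:E.
    by apply: le_trans UE; apply: ereal_sup_ubound; exists (x, y).
  have : (e2 <= eta / 2)%R by rewrite !ge_min lexx orbT.
  by rewrite lee_fin => h1 h2; have := sep _ _ Ax By; lra.
have X0 : 0 <= H X by exact: outer_measure_ge0.
have Xfin : H X \is a fin_num by rewrite ge0_fin_numE // ltey.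
have Afin : H A \is a fin_num.
  rewrite ge0_fin_numE ?outer_measure_ge0 //; apply: le_lt_trans (le_outer_measure _ A X _) _.
    by move=> x Ax; apply: ABX; left.
  by rewrite ltey.
rewrite -leeBrDl //; apply: ge_ereal_sup => _ [e' e'0 <-].
rewrite leeBrDl // -leeBrDr; last first.
  rewrite ge0_fin_numE ?mu_ext_ge0 //; last by move=> ?; exact: diam_gauge_ge0.
  apply: (@le_lt_trans _ _ (H X)); last by rewrite ltey.
  apply: le_trans (mu_ext_le_hausdorff B e'0) _.
  by apply: le_outer_measure => x Bx; apply: ABX; right.
apply: ge_ereal_sup => _ [e e0 <-]; rewrite leeBrDr; first exact: le_e.
rewrite ge0_fin_numE ?mu_ext_ge0 //; last by move=> ?; exact: diam_gauge_ge0.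
apply: (@le_lt_trans _ _ (H X)); last by rewrite ltey.
apply: le_trans (mu_ext_le_hausdorff B e'0) _.
by apply: le_outer_measure => x Bx; apply: ABX; right.
Qed.

End hausdorff_basics.

(** * Half-spaces are Hausdorff measurable *)

Section hausdorff_caratheodory.
Context {R : realType} {d s : nat}.
Local Notation E := 'rV[R]_d.
Local Notation H := (@hausdorff R d s).
Local Open Scope ereal_scope.
Variable i : 'I_d.
Implicit Types (X : set E).

Definition slab X (lo hi : R) : set E := [set x | X x /\ (lo < x 0 i <= hi)%R].

Let thr (c : R) n : R := (c + n.+1%:R^-1)%R.

Let thr_lt c m n : (m < n)%N -> (thr c n < thr c m)%R.
Proof. by move=> mn; rewrite ltrD2l ltf_pV2 ?posrE // ltr_nat. Qed.

Let sep_coord (A B : set E) lo hi : (lo < hi)%R ->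
  (forall x, A x -> (x 0 i <= lo)%R) -> (forall x, B x -> (hi < x 0 i)%R) ->
  forall x y : E, A x -> B y -> (hi - lo <= enorm (x - y))%R.
Proof.
move=> lohi Alo Bhi x y /Alo xlo /Bhi yhi.
apply: le_trans (ler_enorm_coord _ i); rewrite !mxE distrC.
by apply: le_trans (ler_norm _); lra.
Qed.

(** Every second slab: these are at positive distance from each other. *)
Let slab_sum_le X c b m :
  \sum_(k < m.+1) H (slab X (thr c (k.*2 + b).+1) (thr c (k.*2 + b))) <=
  H [set x | X x /\ (thr c (m.*2 + b).+1 < x 0 i)%R].
Proof.
elim: m => [|m IH].
  by rewrite big_ord1; apply: le_outer_measure => x [Xx /andP[]].
rewrite big_ord_recr /=; apply: le_trans (leeD IH (lexx _)) _.
have h1 : (thr c (m.+1.*2 + b) < thr c (m.*2 + b).+1)%R.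
  by apply: thr_lt; rewrite doubleS !addSn.
have h2 : (thr c (m.+1.*2 + b).+1 < thr c (m.+1.*2 + b))%R by apply: thr_lt.
rewrite addeC.
apply: (@hausdorff_separated _ _ _ (thr c (m.*2 + b).+1 - thr c (m.+1.*2 + b))).
- by rewrite subr_gt0.
- by apply: (sep_coord h1) => [x [_ /andP[]]|x []].
- move=> x [[Xx /andP[]]|[Xx xlt]]; split=> //.
  by apply: lt_trans xlt; exact: lt_trans h1.
Qed.

(** The slabs of even index and those of odd index each have total measure at most
    that of [X]. *)
Let slab_series_fin X c : H X < +oo ->
  \sum_(k <oo) H (slab X (thr c k.+1) (thr c k)) < +oo.
Proof.
move=> Xoo; pose a k := H (slab X (thr c k.+1) (thr c k)).
have a0 k : 0 <= a k by exact: outer_measure_ge0.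
have dbl n : \sum_(k < n.*2) a k = \sum_(k < n) a k.*2 + \sum_(k < n) a k.*2.+1.
  elim: n => [|n IH]; first by rewrite !big_ord0 adde0.
  by rewrite doubleS !big_ord_recr /= IH addeACA addeA.
have half b n : \sum_(k < n) a (k.*2 + b)%N <= H X.
  case: n => [|n]; first by rewrite big_ord0 outer_measure_ge0.
  apply: le_trans (slab_sum_le X c b n) _.
  by apply: le_outer_measure => x [].
apply: (@le_lt_trans _ _ (H X + H X)); last by rewrite lte_add_pinfty.
apply: (lime_le (is_cvg_nneseries (fun k _ _ => a0 k))).
apply: nearW => n; rewrite big_mkord.
apply: (@le_trans _ _ (\sum_(k < n.*2) a k)).
  rewrite -!(big_mkord xpredT a); apply: lee_sum_nneg_natr => //.
  by rewrite -addnn leq_addr.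
rewrite dbl; apply: leeD.
- by have := half 0%N n; under eq_bigr do rewrite addn0.
- by have := half 1%N n; under eq_bigr do rewrite addn1.
Qed.

(** Only the part of [X] in thin slabs next to the boundary is not separated from
    the half-space, and its measure is the tail of a convergent series. *)
Let halfspace_split X (c : R) :
  H (X `&` [set x : E | (x 0 i <= c)%R]) + H (X `&` ~` [set x : E | (x 0 i <= c)%R]) <= H X.
Proof.
set C := [set x : E | _].
have [->|Xoo] := eqVneq (H X) +oo; first exact: leey.
have {}Xoo : H X < +oo by rewrite ltey.
pose a k := H (slab X (thr c k.+1) (thr c k)).
have a0 k : 0 <= a k by exact: outer_measure_ge0.
have tail0 := nneseries_tail_cvg (slab_series_fin c Xoo) (fun k _ => a0 k).
have bound n : H (X `&` C) + H (X `&` ~` C) <= H X + \sum_(n <= k <oo) a k.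
  have sub : X `&` ~` C `<=` [set x | X x /\ (thr c n < x 0 i)%R] `|`
      \bigcup_(k in ~` `I_n) slab X (thr c k.+1) (thr c k).
    move=> x [Xx /= /negP]; rewrite -ltNge => cx.
    have [nx|xn] := ltP (thr c n) (x 0%R i); first by left.
    right.
    have ex : exists k, (thr c k < x 0 i)%R.
      have [k ck] := @ltr_add_invr R c (x 0%R i) cx; by exists k.
    have [[|k] ck kmin] := ex_minnP ex.
      by move: xn; rewrite leNgt (le_lt_trans _ ck) // lerD2l lef_pV2 ?posrE // ler_nat.
    exists k => /=.
      move=> /=; rewrite leq_eqVlt => /predU1P[kn|/(thr_lt c)]; last by lra.
      by move: ck; rewrite kn; lra.
    split=> //; rewrite ck /= leNgt; apply/negP => /kmin; by rewrite ltnn.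
  apply: le_trans (leeD (lexx _) (le_outer_measure _ _ _ sub)) _.
  apply: le_trans (leeD (lexx _) (outer_measureU2 _ _ _)) _.
  rewrite addeA; apply: leeD; last exact: outer_measure_sigma_subadditive_tail.
  have h : (c < thr c n)%R by rewrite /thr ltrDl invr_gt0.
  apply: (@hausdorff_separated _ _ _ (thr c n - c)).
  - by rewrite subr_gt0.
  - by apply: (sep_coord h) => [x []|x []].
  - by move=> x [[]|[]].
rewrite -[leRHS]adde0.
have : (H X + \sum_(n <= k <oo) a k) @[n --> \oo] --> H X + 0.
  by apply: cvgeD => //; [rewrite fin_num_adde_defl|exact: cvg_cst].
move=> cv; rewrite -(cvg_lim _ cv) //; apply: lime_ge.
  by apply/cvg_ex; exists (H X + 0).
exact: nearW.
Qed.

Lemma hausdorff_halfspace (c : R) :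
  measurable ([set x : E | (x 0 i <= c)%R] : set (caratheodory_type H)).
Proof. by apply: le_caratheodory_measurable => X; exact: halfspace_split. Qed.

End hausdorff_caratheodory.

(** * The Hausdorff measure of the sphere is positive and finite *)

Section hausdorff_sphere.
Context {R : realType} {d : nat}.
Local Notation E := 'rV[R]_d.
Local Notation s := d.-1.
Local Notation H := (@hausdorff R d s).
Local Notation v := (unit_ball_volume R d).
Hypothesis d0 : (0 < d)%N.

Let dE : d = s.+1. Proof. by rewrite prednK. Qed.

Lemma hausdorff_id_borel :
  measurable_fun [set: caratheodory_type H] (id : E -> borel R d).
Proof.
apply: measurable_borel => i; apply: (measurability _ (RGenOInfty.measurableE R)).
move=> _ [_ [c ->] <-]; rewrite setTI.
rewrite (_ : _ @^-1` _ = ~` [set x : E | x 0 i <= c]); last first.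
  apply/seteqP; split=> x /=; rewrite in_itv /= andbT; first by rewrite ltNge => /negP.
  by move=> /negP; rewrite -ltNge.
apply: measurableC; exact: hausdorff_halfspace.
Qed.

Lemma borel_hausdorff (A : set (borel R d)) : measurable A ->
  measurable (A : set (caratheodory_type H)).
Proof. by move=> mA; rewrite -[A]setTI; exact: hausdorff_id_borel. Qed.

Lemma esphere_nonempty : exists x : E, esphere x.
Proof.
exists (delta_mx 0 (Ordinal d0)); rewrite /esphere /= enormE /dot.
rewrite (bigD1 (Ordinal d0)) //= big1 ?addr0.
  by rewrite mxE !eqxx mulr1 sqrtr1.
by move=> i /negbTE i0; rewrite mxE i0 andbF mul0r.
Qed.

Definition cone (U : set E) : set E :=
  [set x | exists r w, [/\ 0 <= r <= 1, esphere w, U w & x = r *: w]].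

(** A cone of small aperture [h] is covered by about [h^-1] balls of radius of
    order [h] placed along one of its rays. *)
Lemma leb_cone_aperture (U : set E) h : 0 < h <= 1 ->
  (forall x y, U x -> U y -> esphere x -> esphere y -> enorm (x - y) <= h) ->
  (lebesgue (cone U) <= (2 * 3 ^+ d * 2 ^+ s * v * h ^+ s)%:E)%E.
Proof.
move=> /andP[h0 h1] Uh.
have [[w0 [Sw0 Uw0]]|no] := pselect (exists w, esphere w /\ U w); last first.
  rewrite (_ : cone U = set0) ?outer_measure0.
    by rewrite lee_fin !mulr_ge0 ?exprn_ge0 ?(ltW h0) ?ltW ?unit_ball_volume_gt0.
  by apply/seteqP; split=> // x [r [w [_ Sw Uw _]]]; apply: no; exists w.
pose n := Num.truncn h^-1.
have n1 : (1 <= n)%N by rewrite truncn_gt0 invf_ge1.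
have n0 : 0 < n%:R :> R by rewrite ltr0n.
have hn : h <= n%:R^-1.
  by rewrite -[leLHS]invrK lef_pV2 ?posrE ?invr_gt0 // truncn_le // invr_ge0 ltW.
have nh : n%:R^-1 <= 2 * h.
  have : h^-1 < n.+1%:R by rewrite truncnS_gt.
  have : n.+1%:R <= 2 * n%:R :> R by rewrite -natrM ler_nat; lia.
  move=> a1 a2; have a3 : h^-1 < 2 * n%:R by exact: lt_le_trans a2 a1.
  rewrite -[leRHS]invrK lef_pV2 ?posrE ?invr_gt0 ?mulr_gt0 // invfM.
  by rewrite ler_pdivrMl // ltW.
pose F j : set E := eball ((j%:R / n%:R) *: w0) (3 / n%:R).
have coneF : cone U `<=` \big[setU/set0]_(j < n.+1) F j.
  move=> _ [r [w [/andP[r0 r1] Sw Uw ->]]].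
  pose j := Num.truncn (r * n%:R).
  have rn0 : 0 <= r * n%:R by rewrite mulr_ge0 // ltW.
  have rn1 : r * n%:R <= n%:R by rewrite ler_piMl // ltW.
  have jn : (j < n.+1)%N.
    by rewrite ltnS truncn_le_nat (le_lt_trans rn1) // ltr_nat.
  have /andP[j1 j2] := truncn_itv rn0; rewrite -/j -natr1 in j1 j2.
  rewrite -bigcup_mkord; exists j => //.
  rewrite /F /eball /= (_ : r *: w - _ =
    (r - j%:R / n%:R) *: w + (j%:R / n%:R) *: (w - w0)); last first.
    by rewrite scalerBr scalerBl addrA subrK.
  have jn0 : 0 <= j%:R / n%:R :> R by rewrite divr_ge0.
  have jn1 : j%:R / n%:R <= 1 :> R by rewrite ler_pdivrMr // mul1r; lra.
  have k1 : j%:R / n%:R <= r by rewrite ler_pdivrMr.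
  have k2 : r <= j%:R / n%:R + n%:R^-1.
    by rewrite -[X in _ + X]mul1r -mulrDl ler_pdivlMr // ltW.
  apply: le_lt_trans (ler_enormD _ _) _; rewrite !enormZ Sw mulr1.
  rewrite ger0_norm ?subr_ge0 // ger0_norm //.
  have ww : enorm (w - w0) <= n%:R^-1 by apply: le_trans hn; exact: Uh.
  have : j%:R / n%:R * enorm (w - w0) <= 1 * n%:R^-1.
    by apply: ler_pM => //; exact: enorm_ge0.
  have : 0 < n%:R^-1 :> R by rewrite invr_gt0.
  rewrite [3 / _]mulrC; lra.
apply: le_trans (le_outer_measure _ _ _ coneF) _.
apply: le_trans (outer_measure_subadditive _ _ _) _.
rewrite (eq_bigr (fun=> ((3 / n%:R) ^+ d * v)%:E)); last first.
  by move=> j _; apply: leb_eball_gt0; rewrite divr_gt0.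
rewrite sumEFin lee_fin sumr_const card_ord -[leLHS]mulr_natl.
have v0 : 0 < v by exact: unit_ball_volume_gt0.
rewrite [leRHS](_ : _ = 2 * 3 ^+ d * (2 * h) ^+ s * v); last first.
  rewrite (exprMn s 2 h); move: (2 ^+ s) (h ^+ s) (3 ^+ d) => p q r; ring.
rewrite mulrA ler_pM2r // expr_div_n [in n%:R ^+ d]dE exprS.
rewrite (_ : _ * _ = (n.+1%:R / n%:R) * 3 ^+ d * (n%:R^-1) ^+ s); last first.
  by rewrite exprVn; field; rewrite ?expf_neq0 // gt_eqF.
apply: ler_pM; rewrite ?mulr_ge0 ?exprn_ge0 ?invr_ge0 ?(ltW n0) //.
  rewrite ler_pM2r ?exprn_gt0 // ler_pdivrMr // -natrM ler_nat; lia.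
by apply: lerXn2r; rewrite ?nnegrE ?invr_ge0 ?(ltW n0) ?mulr_ge0 ?(ltW h0).
Qed.

Let C : R := 2 * 3 ^+ d * 2 ^+ s * v.

Let C0 : 0 < C. Proof. by rewrite !mulr_gt0 ?exprn_gt0 ?unit_ball_volume_gt0. Qed.

(** The diameter [0] is no admissible aperture; there the bound is obtained from
    all small apertures when [s] is positive, and is the one of aperture [1] when
    [s = 0], since [0 ^+ 0 = 1]. *)
Lemma leb_cone_le (U : set E) :
  (lebesgue (cone U) <= C%:E * diam_gauge s 1 U)%E.
Proof.
rewrite /diam_gauge; case: ifPn => [/eqP ->|/set0P U0].
  rewrite mule0 (_ : cone set0 = set0) ?outer_measure0 //.
  by apply/seteqP; split=> // x [r [w []]].
case: ifPn => [U1|_]; last by rewrite gt0_muley ?lte_fin // leey.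
have D0 := ediam_ge0 U0.
have : ediam U \is a fin_num by rewrite ge0_fin_numE // (le_lt_trans U1) // ltry.
move: U1 D0 => + + /fineK DE; rewrite -DE !lee_fin => U1 D0.
have le_h h : 0 < h <= 1 -> fine (ediam U) <= h ->
    (lebesgue (cone U) <= (C * h ^+ s)%:E)%E.
  move=> h01 Dh; apply: leb_cone_aperture => // x y Ux Uy _ _.
  apply: le_trans Dh; rewrite -lee_fin DE.
  by apply: ereal_sup_ubound; exists (x, y).
rewrite -EFin_expe -EFinM.
move: D0; rewrite le_eqVlt => /predU1P[D0|D0]; last by apply: le_h; rewrite ?D0.
rewrite -D0; have [s0|s0] := posnP s.
  by have := le_h 1; rewrite s0 !expr0 -D0; apply; lra.
rewrite (le_mul_small_eq0 (x := lebesgue (cone U)) (C := C)).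
- by rewrite lee_fin mulr_ge0 ?exprn_ge0 // ltW.
- exact: outer_measure_ge0.
move=> h /andP[h0 h1]; apply: le_trans (le_h h _ _) _; [by rewrite h0|by rewrite -D0 ltW|].
rewrite lee_fin ler_pM2l // -[leRHS]expr1.
by apply: ler_wiXn2l => //; exact: ltW.
Qed.

(** The cones over the members of a cover of the sphere fill the unit ball. *)
Lemma hausdorff_sphere_gt0 : (0 < H esphere)%E.
Proof.
apply: (@lt_le_trans _ _ (C^-1 * v)%:E).
  by rewrite lte_fin mulr_gt0 ?invr_gt0 // unit_ball_volume_gt0.
apply: le_trans (mu_ext_le_hausdorff esphere ltr01).
apply: le_ereal_inf_tmp => _ [F [_ SF] <-].
rewrite EFinM lee_pdivrMl // -nneseriesZl; last by move=> i _; exact: diam_gauge_ge0.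
rewrite -leb_unit_ball.
apply: (@le_trans _ _ (lebesgue (\bigcup_k cone (F k)))).
  apply: le_outer_measure => y; rewrite /eball /= subr0 => y1.
  have [y0|y0] := eqVneq y 0.
    have [w Sw] := esphere_nonempty; have [k _ Fw] := SF _ Sw.
    by exists k => //; exists 0, w; rewrite y0 scale0r; split=> //; lra.
  have ny : 0 < enorm y.
    rewrite lt_neqAle enorm_ge0 andbT eq_sym; apply: contra_neq y0.
    exact: enorm_eq0.
  have Sy : esphere ((enorm y)^-1 *: y).
    by rewrite /esphere /= enormZ ger0_norm ?invr_ge0 ?ltW // mulVf // gt_eqF.
  have [k _ Fw] := SF _ Sy; exists k => //; exists (enorm y), ((enorm y)^-1 *: y).
  by split; rewrite ?(ltW ny) ?(ltW y1) // scalerA divff ?scale1r // gt_eqF.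
apply: le_trans (outer_measure_sigma_subadditive _ _) _.
apply: lee_nneseries => [k _ _|k _]; first exact: outer_measure_ge0.
exact: leb_cone_le.
Qed.

Definition packed (h : R) (p : nat -> E) (m : nat) : Prop :=
  (forall k, (k < m)%N -> esphere (p k)) /\
  (forall j k, (j < k < m)%N -> h <= enorm (p j - p k)).

(** The balls of radius [h / 2] around the points are disjoint and lie in a shell
    of width of order [h]. *)
Lemma packed_bound : exists2 K : R, 0 <= K & forall h p m, 0 < h <= 1 ->
  packed h p m -> m%:R * h ^+ s <= K.
Proof.
have [Cs Cs0 shellC] := leb_shell (R := R) d0.
have v0 : 0 < v by exact: unit_ball_volume_gt0.
exists (Cs * 2 ^+ d / v); first by rewrite divr_ge0 ?mulr_ge0 ?exprn_ge0 // ltW.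
move=> h p m /andP[h0 h1] [pS ph].
pose F k : set (borel R d) := if (k < m)%N then eball (p k) (h / 2) else set0.
have mF k : measurable (F k) by rewrite /F; case: ifP => // _; exact: measurable_eball.
have tF : trivIset setT F.
  apply/trivIsetP => /= i j _ _; wlog ij : i j / (i < j)%N.
    by move=> hw; rewrite neq_ltn => /orP[ij|ji]; [|rewrite setIC]; apply: hw; rewrite ?ltn_eqF.
  move=> _; apply/seteqP; split=> // y; rewrite /F.
  case: ifP => [im|_ []//]; case: ifP => [jm|_ []//]; rewrite /eball /= => -[yi yj].
  have := ph i j; rewrite ij jm => /(_ isT); rewrite enormB in yi.
  by have := enorm_triangle (p i) y (p j); lra.
have vol : leb R d (\big[setU/set0]_(k < m) F k) = (m%:R * ((h / 2) ^+ d * v))%:E.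
  rewrite measure_bigsetU //= (eq_bigr (fun=> ((h / 2) ^+ d * v)%:E)).
    by rewrite sumEFin sumr_const card_ord [in RHS]mulr_natl.
  by move=> k _; rewrite /F ltn_ord leb_eball_gt0 // divr_gt0.
have shell : (leb R d (\big[setU/set0]_(k < m) F k) <= (Cs * h)%:E)%E.
  apply: le_trans (shellC h _); last by lra.
  apply: le_outer_measure; rewrite -bigcup_mkord => y [k /= km]; rewrite /F km.
  rewrite /eball /= !subr0 => yk; have Sk := pS k km; rewrite /esphere /= in Sk.
  have := enorm_sub_le y (p k); have := enorm_sub_le (p k) y.
  by rewrite (enormB (p k)); split=> /=; lra.
move: shell; rewrite vol lee_fin mulrA expr_div_n => shell.
rewrite ler_pdivlMr // -(ler_pM2r h0).
rewrite (_ : Cs * 2 ^+ d * h = Cs * h * 2 ^+ d); last by rewrite mulrAC.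
rewrite -ler_pdivrMr ?exprn_gt0 //; apply: le_trans shell.
by rewrite [in leRHS](_ : h ^+ d = h * h ^+ s); [lra|rewrite [in LHS]dE exprS].
Qed.

(** Otherwise packings could be enlarged forever, against [packed_bound]. *)
Lemma maximal_packing h : 0 < h <= 1 -> exists p m, packed h p m /\
  forall x, esphere x -> exists2 k, (k < m)%N & enorm (x - p k) < h.
Proof.
move=> h01; have [h0 _] := andP h01; apply: contrapT => /forallNP nomax.
have [K _ bound] := packed_bound.
have any m : exists p, packed h p m.
  elim: m => [|m [p [pS ph]]]; first by exists (fun=> 0); split=> // j k; rewrite ltn0 andbF.
  have [x [Sx xp]] : exists x, esphere x /\ forall k, (k < m)%N -> h <= enorm (x - p k).
    apply: contrapT => /forallNP no; apply: (nomax p); exists m; split=> // x Sx.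
    apply: contrapT => nok; apply: (no x); split=> // k km.
    by rewrite leNgt; apply/negP => xk; apply: nok; exists k.
  exists (fun k => if k == m then x else p k); split=> [k|j k /andP[jk]].
    by rewrite ltnS leq_eqVlt; case: eqVneq => //= _; exact: pS.
  rewrite ltnS leq_eqVlt => /predU1P[kE|km].
    by rewrite kE eqxx ltn_eqF -?kE // enormB; apply: xp; rewrite -kE.
  by rewrite !ltn_eqF // ?(ltn_trans jk) //; apply: ph; rewrite jk.
pose m := (Num.truncn (K / h ^+ s)).+1.
have [p pm] := any m; have := bound h p m h01 pm.
rewrite leNgt -ltr_pdivrMr ?exprn_gt0 //; apply/negP/negPn.
exact: truncnS_gt.
Qed.

(** The balls of radius [h] around a maximal packing cover the sphere, and there
    are at most of the order of [h ^- s] of them. *)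
Lemma hausdorff_sphere_fin : (H esphere < +oo)%E.
Proof.
have [K K0 bound] := packed_bound.
apply: (@le_lt_trans _ _ (K * 2 ^+ s)%:E); last exact: ltry.
apply: ge_ereal_sup => _ [e /= e0 <-].
pose h := Num.min 1 (e / 2).
have h01 : 0 < h <= 1 by rewrite lt_min ltr01 divr_gt0 //= ge_min lexx.
have [h0 h1] := andP h01.
have he : h * 2 <= e by rewrite -ler_pdivlMr // ge_min lexx orbT.
have [p [m [pm cov]]] := maximal_packing h01.
pose F k : set E := if (k < m)%N then eball (p k) h else set0.
apply: (@le_trans _ _ (\sum_(k <oo) diam_gauge s e (F k))%E).
  apply: ereal_inf_lbound; exists F => //; split=> // x Sx.
  by have [k km xk] := cov x Sx; exists k => //; rewrite /F km.
rewrite (nneseries_split 0 m) => [|k _]; last exact: diam_gauge_ge0.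
rewrite eseries0 ?adde0; last first.
  by move=> k; rewrite add0n => mk _; rewrite /F ltnNge mk diam_gauge0.
rewrite add0n big_mkord.
apply: (@le_trans _ _ (\sum_(k < m) (((h * 2) ^+ s)%:E))%E); last first.
  rewrite sumEFin sumr_const card_ord lee_fin -[leLHS]mulr_natl exprMn mulrA.
  by rewrite ler_pM2r ?exprn_gt0 //; exact: bound pm.
apply: lee_sum => k _; rewrite /F ltn_ord.
have De : (ediam (eball (p k) h) <= (h * 2)%:E)%E.
  apply: ge_ereal_sup => _ [[x y] [xk yk] <-] /=; rewrite lee_fin.
  move: xk yk; rewrite /eball /= => xk; rewrite enormB => yk.
  have := enorm_triangle y (p k) x; rewrite (enormB (p k) x); lra.
have pk : eball (p k) h !=set0 by exists (p k); rewrite /eball /= subrr enorm0.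
rewrite /diam_gauge ifF; last exact/negbTE/set0P.
rewrite ifT; last by apply: le_trans De _; rewrite lee_fin.
rewrite EFin_expe; apply: lee_expe => //; exact: ediam_ge0.
Qed.

End hausdorff_sphere.

(** * The spherical mean *)

Section sphere_mean.
Context {R : realType} {d : nat}.
Local Notation E := 'rV[R]_d.
Local Notation B := (borel R d).
Local Notation H := (@hausdorff R d d.-1).
Hypothesis d0 : (0 < d)%N.

(** [sigma] computes spherical averages of indicators: the value of the radial
    average is insensitive to changes inside a [sigma]-null set. *)
Definition averages (sigma : set B -> \bar R) : Prop :=
  forall (A : set E) (c : R) (x : E) (r : R) (D N : set B),
    0 <= c -> measurable D -> measurable N -> sigma N = 0%E ->
    [set w | A (x + `|r| *: w)] `<=` D -> D `\` [set w | A (x + `|r| *: w)] `<=` N ->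
    radial_average (scaled_indicator c A) x r = c * fine (sigma D).

Section several_dimensions.
Hypothesis d1 : d != 1%N.

Definition hausdorff_on_sphere (A : set B) : \bar R := H (esphere `&` A).
Let hs0 : hausdorff_on_sphere set0 = 0%E. Proof. by rewrite /hausdorff_on_sphere setI0 outer_measure0. Qed.
Let hs_ge0 A : (0 <= hausdorff_on_sphere A)%E. Proof. exact: outer_measure_ge0. Qed.
Let hs_sigma_additive : semi_sigma_additive hausdorff_on_sphere.
Proof.
move=> F mF tF mUF; rewrite /hausdorff_on_sphere setI_bigcupr.
have mS : measurable (esphere : set (caratheodory_type H)).
  by apply: borel_hausdorff; exact: measurable_esphere.
apply: (@measure_semi_sigma_additive _ _ _ (hausdorff_meas R d d.-1)) => //.
- by move=> n; apply: measurableI => //; exact: borel_hausdorff.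
- exact: trivIset_setIl.
- rewrite -setI_bigcupr; apply: measurableI => //; exact: borel_hausdorff.
Qed.
HB.instance Definition _ := isMeasure.Build _ _ _ hausdorff_on_sphere hs0 hs_ge0 hs_sigma_additive.

Let c := fine (H esphere).
Let HS : H esphere = c%:E.
Proof. by rewrite /c fineK // ge0_fin_numE ?outer_measure_ge0 // hausdorff_sphere_fin. Qed.
Let c0 : 0 < c.
Proof. by have := hausdorff_sphere_gt0 (R := R) d0; rewrite HS lte_fin. Qed.
Let ci0 : 0 <= c^-1. Proof. by rewrite invr_ge0 ltW. Qed.

Definition hausdorff_mean : set B -> \bar R := mscale (NngNum ci0) hausdorff_on_sphere.
HB.instance Definition _ := Measure.on hausdorff_mean.
Let meanE A : hausdorff_mean A = ((c^-1)%:E * H (esphere `&` A))%E.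
Proof. by []. Qed.
Let meanT : hausdorff_mean setT = 1%E.
Proof. by rewrite meanE setIT HS -EFinM mulVf // gt_eqF. Qed.
HB.instance Definition _ := Measure_isProbability.Build _ _ _ hausdorff_mean meanT.

(** The reflection that exchanges [x] and [y] is an isometry of the sphere. *)
Let mean_spherical : spherical hausdorff_mean.
Proof.
split; first by rewrite meanE setICr outer_measure0 mule0.
move=> x y r Sx Sy.
suff e : H (esphere `&` eball x r) = H (esphere `&` eball y r) by rewrite !meanE e.
have swap : reflection x y x = y by apply: reflection_swap; rewrite Sx Sy.
have <- := @hausdorff_involution R d d.-1 (reflection x y) (esphere `&` eball y r).
- congr (H _); apply/seteqP; split=> z; rewrite /esphere /eball /= enorm_reflection;
    by rewrite -[X in reflection x y z - X]swap reflectionB enorm_reflection.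
- by move=> z z'; rewrite reflectionB enorm_reflection.
- exact: reflectionK.
Qed.

Let mean_averages : averages hausdorff_mean.
Proof.
move=> A k x r D N k0 mD mN N0 AD DN.
rewrite /radial_average (negbTE d1); set A' := [set w | _] in AD DN.
have mS : measurable (esphere : set (caratheodory_type H)).
  by apply: borel_hausdorff; exact: measurable_esphere.
have HN : H (esphere `&` N) = 0%E.
  move: N0; rewrite meanE => /eqP; rewrite mule_eq0 => /orP[|/eqP//].
  by rewrite eqe invr_eq0 gt_eqF.
have mDN : measurable (esphere `&` (D `\` A') : set (caratheodory_type H)).
  apply: (@measure_is_complete_caratheodory _ _ H); exists (esphere `&` N); split=> //.
    by apply: measurableI => //; exact: borel_hausdorff.
  by move=> w [Sw Dw]; split=> //; exact: DN.
have SA : esphere `&` A' = (esphere `&` D) `\` (esphere `&` (D `\` A')).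
  apply/seteqP; split=> w; first by move=> [Sw Aw]; split; [split=> //; exact: AD|move=> [_ []]].
  move=> [[Sw Dw] nw]; split=> //; apply: contrapT => nA; exact: nw.
have mSA : measurable (esphere `&` A' : set (caratheodory_type H)).
  rewrite SA; apply: measurableD => //; apply: measurableI => //.
  exact: borel_hausdorff.
have HA : H (esphere `&` A') = H (esphere `&` D).
  apply/eqP; rewrite eq_le; apply/andP; split.
    by apply: le_outer_measure => w [Sw Aw]; split=> //; exact: AD.
  rewrite -[leRHS]adde0 -HN; apply: le_trans (outer_measureU2 _ _ _).
  apply: le_outer_measure => w [Sw Dw].
  by have [Aw|nA] := pselect (A' w); [left|right; split=> //; exact: DN].
rewrite /Rintegral (eq_integral (fun w : caratheodory_type H => (k%:E * (\1_(esphere `&` A') w)%:E)%E)); last first.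
  move=> w; rewrite inE => Sw; rewrite /scaled_indicator EFinM !indicE; congr (_ * (_%:R)%:E)%E.
  by congr nat_of_bool; apply/idP/idP; rewrite !inE; [move=> Aw; split|case].
rewrite ge0_integralZl; first last.
- by rewrite lee_fin.
- by move=> w _; rewrite lee_fin.
- by apply/measurable_EFinP; apply: measurable_funTS; exact: measurable_indic.
- exact: mS.
rewrite integral_indic // -setIA setIC -setIA setIid setIC /= HA.
have HDfin : H (esphere `&` D) \is a fin_num.
  rewrite ge0_fin_numE ?outer_measure_ge0 //.
  apply: le_lt_trans (hausdorff_sphere_fin (R := R) d0).
  by apply: le_outer_measure => w [].
by rewrite meanE !fineM //= mulrCA.
Qed.

Lemma sphere_mean_several : exists sigma : probability B R,
  spherical sigma /\ averages sigma.
Proof. by exists hausdorff_mean; split; [exact: mean_spherical|exact: mean_averages]. Qed.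

End several_dimensions.

Section one_dimension.
Hypothesis d1 : d = 1%N.
Let p : E := const_mx 1.

Let esphereE (w : E) : esphere w <-> w = p \/ w = - p.
Proof.
rewrite /esphere /= enormE /dot.
have -> : \sum_(i < d) w 0 i * w 0 i = w 0 (Ordinal d0) ^+ 2.
  rewrite (bigD1 (Ordinal d0)) //= big1 ?addr0 ?expr2 // => i.
  by move=> /eqP; case; apply: val_inj => /=; have := ltn_ord i; rewrite [X in (_ < X)%N -> _]d1; case: (val i).
have wE (e : R) : w 0 (Ordinal d0) = e -> w = const_mx e.
  move=> we; apply/rowP => i; rewrite mxE -we; congr (w _ _); apply: val_inj => /=.
  by have := ltn_ord i; rewrite [X in (_ < X)%N -> _]d1; case: (val i).
rewrite sqrtr_sqr; split=> [w1|[->|->]]; last 2 first.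
- by rewrite mxE normr1.
- by rewrite !mxE normrN1.
move/eqP: w1; rewrite eqr_norml ler01 andbT => /orP[/eqP|/eqP].
- by move/wE; left.
- by move/wE => ->; right; apply/rowP => i; rewrite !mxE.
Qed.

Definition two_point_mean : set B -> \bar R :=
  mscale (2^-1)%:nng (measure_add (\d_(p : B)) (\d_((- p) : B))).
HB.instance Definition _ := Measure.on two_point_mean.
Let meanE A : two_point_mean A = ((2^-1)%:E * ((\1_A p)%:E + (\1_A (- p))%:E))%E.
Proof. by rewrite /two_point_mean /mscale; congr (_ * _)%E; exact: measure_addE. Qed.
Let meanT : two_point_mean setT = 1%E.
Proof. by rewrite meanE !indicE !mem_set //= -EFinD -EFinM; congr _%:E; field. Qed.
HB.instance Definition _ := Measure_isProbability.Build _ _ _ two_point_mean meanT.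

Let mean_spherical : spherical two_point_mean.
Proof.
have Sp : esphere p by apply/esphereE; left.
have Sn : esphere (- p) by apply/esphereE; right.
split.
  rewrite meanE !indicE !memNset /= ?adde0 ?mule0 // => h; exact: h.
have oneE r : (\1_(eball p r) (- p) = \1_(eball (- p) r) p :> R).
  rewrite !indicE; congr (_%:R); congr nat_of_bool.
  by apply/idP/idP; rewrite !inE eball_sym.
have diagE r : (\1_(eball p r) p = \1_(eball (- p) r) (- p) :> R).
  rewrite !indicE; congr (_%:R); congr nat_of_bool.
  by apply/idP/idP; rewrite !inE /eball /= !subrr.
have swap r : two_point_mean (eball p r) = two_point_mean (eball (- p) r).
  by rewrite !meanE oneE diagE addeC.
by move=> x y r /esphereE[->|->] /esphereE[->|->] //; rewrite swap.
Qed.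

Let mean_averages : averages two_point_mean.
Proof.
move=> A k x r D N k0 mD mN N0 AD DN; rewrite /radial_average ifT; last exact/eqP.
set A' := [set w | _] in AD DN.
have N01 : ~ N p /\ ~ N (- p).
  move: N0; rewrite meanE -EFinD -EFinM => -[] /eqP.
  rewrite mulf_eq0 invr_eq0 (negbTE (_ : 2 != 0 :> R)) //= !indicE.
  rewrite -natrD pnatr_eq0 addn_eq0 => /andP[].
  by rewrite !eqb0 => /negP h1 /negP h2; split=> h; [apply: h1|apply: h2]; exact: mem_set.
have AE w : ~ N w -> \1_A (x + `|r| *: w) = \1_D w :> R.
  move=> Nw; rewrite !indicE; congr (_%:R); congr nat_of_bool; apply/idP/idP; rewrite !inE.
    exact: AD.
  by move=> Dw; apply: contrapT => nA; apply: Nw; exact: DN.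
rewrite meanE -EFinD -EFinM /= -!AE; [|by case: N01..].
rewrite /scaled_indicator.
have cE e : const_mx e = e *: p by apply/rowP => i; rewrite !mxE mulr1.
have -> : \1_A (x + const_mx r) = \1_A (x + r *: p) :> R by rewrite cE.
have -> : \1_A (x - const_mx r) = \1_A (x + (- r) *: p) :> R by rewrite cE scaleNr.
rewrite !scalerN -scaleNr.
by have [r0|r0] := ger0P r; rewrite ?opprK; field.
Qed.

Lemma sphere_mean_one : exists sigma : probability B R,
  spherical sigma /\ averages sigma.
Proof. by exists two_point_mean; split; [exact: mean_spherical|exact: mean_averages]. Qed.

End one_dimension.

Lemma sphere_mean_exists : exists sigma : probability B R,
  spherical sigma /\ averages sigma.
Proof.
have [d1|d1] := eqVneq d 1%N; first exact: sphere_mean_one.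
exact: sphere_mean_several.
Qed.

End sphere_mean.

(** * Polar coordinates *)

Section polar_coordinates.
Context {R : realType} {d : nat}.
Local Notation E := 'rV[R]_d.
Local Notation B := (borel R d).
Hypothesis d0 : (0 < d)%N.

Definition direction (y : B) : B := (enorm y)^-1 *: (y : E).

Lemma measurable_direction : measurable_fun [set: B] direction.
Proof.
apply: measurable_borel => i.
(* real powers are known to be measurable, and [0 `^ (-1) = 0^-1 = 0] *)
rewrite (_ : (fun t => _) = fun y : B => (enorm y) `^ (-1) * y 0 i); last first.
  by apply/funext => y; rewrite mxE powR_inv1 // enorm_ge0.
apply: measurable_funM; last exact: coord_borel.
exact: (measurableT_comp (measurable_powR (-1)) enorm_borel).
Qed.

Lemma direction_reflection a b (y : E) :
  direction (reflection a b y) = reflection a b (direction y).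
Proof. by rewrite /direction enorm_reflection reflectionZ. Qed.

Lemma esphere_direction (y : E) : y != 0 -> esphere (direction y).
Proof.
move=> y0; rewrite /esphere /= enormZ ger0_norm ?invr_ge0 ?enorm_ge0 //.
by rewrite mulVf //; apply: contra_neq y0; exact: enorm_eq0.
Qed.

(** The distribution of [enorm] under the volume; it replaces the measure with
    density proportional to [r ^ d.-1]. *)
Definition radial_measure (T : set R) : \bar R := leb R d ((@enorm R d : B -> R) @^-1` T).

Let menorm (T : set R) : measurable T -> measurable ((@enorm R d : B -> R) @^-1` T).
Proof. by move=> mT; rewrite -[X in measurable X]setTI; exact: enorm_borel. Qed.

Let radial0 : radial_measure set0 = 0%E.
Proof. by rewrite /radial_measure preimage_set0 measure0. Qed.
Let radial_ge0 T : (0 <= radial_measure T)%E.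
Proof. exact: outer_measure_ge0. Qed.
Let radial_sigma_additive : semi_sigma_additive radial_measure.
Proof.
exact: (@preimage_sigma_additive _ _ _ B R (leb R d) _ enorm_borel).
Qed.
HB.instance Definition _ := isMeasure.Build _ _ _ radial_measure
  radial0 radial_ge0 radial_sigma_additive.

Lemma radial_measure_lt r : radial_measure `]-oo, r[ = leb R d (eball 0 r).
Proof.
congr leb; apply/seteqP; split=> y; by rewrite /eball /= subr0 in_itv.
Qed.

Let radial_sigma_finite : sigma_finite setT radial_measure.
Proof.
exists (fun n => `]-oo, n.+1%:R[%classic).
  apply/seteqP; split=> // r _; exists (Num.truncn r) => //=.
  by rewrite in_itv /= truncnS_gt.
by move=> n; split=> //; rewrite radial_measure_lt; exact: leb_eball_fin.
Qed.
HB.instance Definition _ := Measure_isSigmaFinite.Build _ _ _ radial_measure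
  radial_sigma_finite.

Lemma radial_measure_lt0 : radial_measure `]-oo, 0[ = 0%E.
Proof. by rewrite radial_measure_lt eball_trivial // measure0. Qed.

Lemma radial_measure_set1 r : radial_measure [set r] = 0%E.
Proof. by have := leb_sphere d0 r. Qed.

Section sector.
Variables (T : set R) (n : nat).
Hypotheses (mT : measurable T) (Tn : T `<=` `]-oo, n.+1%:R[).

(** The distribution of the direction of the points with norm in [T]; the bound on
    [T] makes it finite. *)
Definition sector_measure (F : set B) : \bar R :=
  leb R d ([set y : B | T (enorm y)] `&` direction @^-1` F).

Let mdir (F : set B) : measurable F -> measurable (direction @^-1` F).
Proof. by move=> mF; rewrite -[X in measurable X]setTI; exact: measurable_direction. Qed.

Let sector0 : sector_measure set0 = 0%E.
Proof. by rewrite /sector_measure preimage_set0 setI0 measure0. Qed.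
Let sector_ge0 F : (0 <= sector_measure F)%E. Proof. exact: outer_measure_ge0. Qed.
Let sector_sigma_additive : semi_sigma_additive sector_measure.
Proof.
move=> F mF tF mUF; rewrite /sector_measure preimage_bigcup setI_bigcupr.
apply: measure_semi_sigma_additive.
- by move=> k; apply: measurableI; [exact: menorm|exact: mdir].
- apply: trivIset_setIl; apply/trivIsetP => /= i j _ _ ij; rewrite -preimage_setI.
  by move/trivIsetP : tF => /(_ _ _ _ _ ij) ->//; rewrite preimage_set0.
- rewrite -setI_bigcupr -preimage_bigcup.
  by apply: measurableI; [exact: menorm|exact: mdir].
Qed.
HB.instance Definition _ := isMeasure.Build _ _ _ sector_measure
  sector0 sector_ge0 sector_sigma_additive.
Let sector_fin : fin_num_fun sector_measure.
Proof.
move=> F mF; rewrite ge0_fin_numE //; apply: le_lt_trans (leb_eball_fin 0 n.+1%:R).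
apply: le_outer_measure => y [/Tn]; by rewrite /eball /= subr0 in_itv.
Qed.
HB.instance Definition _ := Measure_isFinite.Build _ _ _ sector_measure sector_fin.

(** The reflections preserve the volume and the norm, and commute with
    [direction]; the origin, which has no direction, is a null set. *)
Let sector_spherical : spherical sector_measure.
Proof.
split.
  apply/eqP; rewrite eq_le sector_ge0 andbT -(leb_sphere (d := d) d0 0).
  apply: le_outer_measure => y [_ /=]; have [->|y0] := eqVneq y 0; first by rewrite enorm0.
  by move=> /(_ (esphere_direction y0)).
move=> x y r Sx Sy.
have mS : measurable ([set y : B | T (enorm y)] `&` direction @^-1` (eball y r)).
  by apply: measurableI; [exact: menorm|apply: mdir; exact: measurable_eball].
rewrite /sector_measure -(leb_reflection d0 x y mS); congr leb; apply/seteqP.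
have swap : reflection x y x = y by apply: reflection_swap; rewrite Sx Sy.
split=> z; rewrite /eball /= enorm_reflection direction_reflection;
  by rewrite -[X in reflection x y _ - X]swap reflectionB enorm_reflection.
Qed.

Lemma sector_bounded (sigma : probability B R) (F : set B) :
  spherical sigma -> measurable F ->
  leb R d ([set y : B | T (enorm y)] `&` direction @^-1` F) =
  (radial_measure T * sigma F)%E.
Proof.
move=> ssigma mF.
have := @spherical_proportional _ _ d0 sector_measure sigma F sector_spherical ssigma mF.
move=> e; apply: etrans e _; congr (_ * _)%E.
transitivity (leb R d ([set y : B | T (enorm y)] `&` direction @^-1` setT)) => //.
by rewrite preimage_setT setIT.
Qed.

End sector.

Variable sigma : probability B R.
Hypothesis ssigma : spherical sigma.

(** Norm and direction are independent under the volume: this is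
    [sector_bounded] for bounded [T], and [T] is exhausted by bounded sets. *)
Lemma leb_sector (T : set R) (F : set B) : measurable T -> measurable F ->
  leb R d ([set y : B | T (enorm y)] `&` direction @^-1` F) =
  (radial_measure T * sigma F)%E.
Proof.
move=> mT mF.
pose Tn n := T `&` `]-oo, n.+1%:R[.
have mTn n : measurable (Tn n) by exact: measurableI.
have UTn : \bigcup_n Tn n = T.
  rewrite -setI_bigcupr (_ : \bigcup_n _ = setT) ?setIT //.
  apply/seteqP; split=> // r _; exists (Num.truncn r) => //=.
  by rewrite in_itv /= truncnS_gt.
have ndT : nondecreasing_seq Tn.
  move=> m n mn; apply/subsetPset => r [Tr]; rewrite /= !in_itv /= => rm; split=> //=.
  by rewrite in_itv /=; apply: lt_le_trans rm _; rewrite ler_nat.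
have mdir : measurable (direction @^-1` F).
  by rewrite -[X in measurable X]setTI; exact: measurable_direction.
pose G n : set B := [set y : B | Tn n (enorm y)] `&` direction @^-1` F.
have mG n : measurable (G n) by apply: measurableI => //; exact: (menorm (mTn n)).
have UG : \bigcup_n G n = [set y : B | T (enorm y)] `&` direction @^-1` F.
  rewrite -setI_bigcupl; congr (_ `&` _); rewrite -[in RHS]UTn.
  by apply/seteqP; split=> y [n _ ?]; exists n.
have cvg1 : leb R d \o G @ \oo -->
    leb R d ([set y : B | T (enorm y)] `&` direction @^-1` F).
  rewrite -UG; apply: nondecreasing_cvg_mu => //.
    by rewrite UG; apply: measurableI => //; exact: menorm.
  by move=> m n mn; apply/subsetPset => y [Ty Fy]; split=> //; exact: (subsetPset _ _ (ndT m n mn)).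
have cvg2 : (radial_measure (Tn n) * sigma F)%E @[n --> \oo] -->
    (radial_measure T * sigma F)%E.
  have sfin : sigma F \is a fin_num by exact: fin_num_measure.
  apply: cvgeZr => //; rewrite -[in X in _ --> X]UTn.
  by apply: nondecreasing_cvg_mu => //; rewrite UTn.
rewrite -(cvg_lim _ cvg1) // -(cvg_lim _ cvg2) //; apply: congr_lim.
apply/funext => n /=; rewrite /G; apply: (sector_bounded (n := n)) => //.
by move=> r [].
Qed.

Definition polar_map (y : B) : R * B := (enorm y, direction y).

Let measurable_polar_map : measurable_fun [set: B] polar_map.
Proof. exact: measurable_fun_pair enorm_borel measurable_direction. Qed.

Definition polar_measure (W : set (R * B)) : \bar R := leb R d (polar_map @^-1` W).

Let polar0 : polar_measure set0 = 0%E.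
Proof. by rewrite /polar_measure preimage_set0 measure0. Qed.
Let polar_ge0 W : (0 <= polar_measure W)%E.
Proof. exact: outer_measure_ge0. Qed.
Let polar_sigma_additive : semi_sigma_additive polar_measure.
Proof.
exact: (@preimage_sigma_additive _ _ _ B (R * B)%type (leb R d) _ measurable_polar_map).
Qed.
HB.instance Definition _ := isMeasure.Build _ _ _ polar_measure
  polar0 polar_ge0 polar_sigma_additive.

Lemma measurable_scale : measurable_fun [set: R * B] (fun p => p.1 *: (p.2 : E) : B).
Proof.
apply: measurable_borel => i.
rewrite (_ : (fun t => _) = fun p : R * B => p.1 * p.2 0 i); last first.
  by apply/funext => p; rewrite mxE.
apply: measurable_funM; first exact: measurable_fst.
apply: (measurableT_comp (coord_borel i)); exact: measurable_snd.
Qed.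

Lemma enorm_directionK (y : E) : enorm y *: direction y = y :> E.
Proof.
have [->|y0] := eqVneq y 0; first by rewrite enorm0 scale0r.
rewrite /direction scalerA divff ?scale1r //; apply: contra_neq y0.
exact: enorm_eq0.
Qed.

Lemma polar_integral (f : B -> \bar R) : measurable_fun setT f ->
  (forall y, 0 <= f y)%E ->
  (\int[leb R d]_y f y =
   \int[radial_measure]_r \int[sigma]_w f (r *: (w : E)))%E.
Proof.
move=> mf f0; pose g (p : R * B) := f (p.1 *: (p.2 : E)).
have mg : measurable_fun setT g by exact: (measurableT_comp mf measurable_scale).
transitivity (\int[leb R d]_y (g \o polar_map) y)%E.
  by apply: eq_integral => y _; rewrite /g /= enorm_directionK.
transitivity (\int[polar_measure]_p g p)%E.
  have h := ge0_integral_pushforward measurable_polar_map (leb R d) measurableT mg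
    (fun p _ => f0 _).
  apply/esym; exact: h.
transitivity (\int[radial_measure \x sigma]_p g p)%E.
  apply: eq_measure_integral => W mW _; apply/esym.
  apply: product_measure_unique => // T F mT mF.
  exact: leb_sector.
by rewrite fubini_tonelli1 // => p; exact: f0.
Qed.

End polar_coordinates.

(** * The heat integral as a Gaussian integral of radial averages *)

Section radial_representation.
Context {R : realType} {d : nat}.
Local Notation E := 'rV[R]_d.
Local Notation B := (borel R d).
Hypothesis d0 : (0 < d)%N.

Lemma measurable_affine s (v : E) : measurable_fun [set: B] (affine s v : B -> B).
Proof.
apply: measurable_borel => i.
rewrite (_ : (fun t => _) = fun y : B => v 0 i + s * y 0 i); last first.
  by apply/funext => y; rewrite !mxE.
apply: measurable_funD => //; apply: measurable_funM => //; exact: coord_borel.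
Qed.

Section image.
Variables (s : R) (v : E).

Definition affine_image (A : set B) : \bar R := leb R d ((affine s v : B -> B) @^-1` A).
Let image0 : affine_image set0 = 0%E.
Proof. by rewrite /affine_image preimage_set0 measure0. Qed.
Let image_ge0 A : (0 <= affine_image A)%E.
Proof. exact: outer_measure_ge0. Qed.
Let image_sigma_additive : semi_sigma_additive affine_image.
Proof.
exact: (@preimage_sigma_additive _ _ _ B B (leb R d) _ (measurable_affine s v)).
Qed.
HB.instance Definition _ := isMeasure.Build _ _ _ affine_image
  image0 image_ge0 image_sigma_additive.

Lemma leb_integral_affine (f : B -> \bar R) : 0 < s ->
  measurable_fun setT f -> (forall y, 0 <= f y)%E ->
  (\int[leb R d]_y f y = (s ^+ d)%:E * \int[leb R d]_z f (affine s v z))%E.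
Proof.
move=> s0 mf f0.
have sd0 : 0 < s ^+ d by rewrite exprn_gt0.
have si0 : 0 <= s ^- d by rewrite invr_ge0 ltW.
have -> : (\int[leb R d]_z f (affine s v z) = (s ^- d)%:E * \int[leb R d]_y f y)%E.
  have h := ge0_integral_pushforward (measurable_affine s v) (leb R d) measurableT mf
    (fun p _ => f0 _).
  transitivity (\int[affine_image]_y f y)%E; first exact/esym.
  pose l : {measure set B -> \bar R} := leb R d.
  pose m2 : {measure set B -> \bar R} := @mscale _ B R (NngNum si0) l.
  pose m1 : {measure set B -> \bar R} := affine_image.
  transitivity (\int[m2]_y f y)%E.
    have e : forall A : set B, measurable A -> A `<=` setT -> m1 A = m2 A.
      by move=> A mA _; exact: leb_affine.
    exact: (eq_measure_integral m2 e).
  by apply: (ge0_integral_mscale l measurableT (NngNum si0) mf) => y _; exact: f0.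
by rewrite muleA -EFinM divff ?mul1e // gt_eqF.
Qed.

End image.

Lemma radial_integral (g : R -> \bar R) : measurable_fun setT g ->
  (forall r, 0 <= g r)%E ->
  (\int[@radial_measure R d]_r g r = \int[leb R d]_y g (enorm y))%E.
Proof.
move=> mg g0.
exact: (ge0_integral_pushforward enorm_borel (leb R d) measurableT mg (fun p _ => g0 _)).
Qed.

Lemma radial_gauss_fin tau : 0 < tau ->
  (\int[@radial_measure R d]_r (gauss tau r)%:E < +oo)%E.
Proof.
move=> tau0; rewrite radial_integral; first exact: gauss_integral_fin.
- by apply/measurable_EFinP; exact: measurable_gauss.
- by move=> r; rewrite lee_fin gauss_ge0.
Qed.

Lemma measurable_dist (x : E) :
  measurable_fun [set: B] (fun y : B => enorm (x - (y : E))).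
Proof.
rewrite (_ : (fun y => _) = fun y : B => enorm (affine (-1) x y)); last first.
  by apply/funext => y; rewrite /affine scaleN1r.
exact: (measurableT_comp enorm_borel (measurable_affine _ _)).
Qed.

Lemma measurable_heat_kernel a (x : E) t :
  measurable_fun [set: B] (fun y : B => heat_kernel a (x - y) t).
Proof.
apply: measurable_funM => //; apply: measurableT_comp => //.
apply: measurableT_comp => //; apply: measurable_funM => //.
apply: measurable_funX; exact: measurable_dist.
Qed.

Lemma heat_kernel_ge0 a (y : E) t : 0 <= heat_kernel a y t.
Proof. by rewrite mulr_ge0 ?expR_ge0 // invr_ge0 exprn_ge0 ?sqrtr_ge0. Qed.

Lemma lebesgue_integral_borel (f : B -> \bar R) : measurable_fun setT f ->
  (forall y, 0 <= f y)%E ->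
  (\int[lebesgue_meas R d]_y f y = \int[leb R d]_y f y)%E.
Proof.
move=> mf f0; apply/esym.
exact: (ge0_integral_pushforward lebesgue_id_borel (lebesgue_meas R d)
  measurableT mf (fun p _ => f0 _)).
Qed.

Lemma measurable_fun_lebesgue (f : B -> R) : measurable_fun [set: B] f ->
  measurable_fun [set: caratheodory_type (@lebesgue R d)] (f : E -> R).
Proof. by move=> mf; exact: (measurableT_comp mf lebesgue_id_borel). Qed.

(** The two integrands differ only on the null set [N]. *)
Lemma heat_integral_hull (A : set E) (B' N : set B) a c (x : E) t :
  0 <= c -> (@lebesgue R d).-cara.-measurable A -> measurable B' -> measurable N ->
  A `<=` B' -> B' `\` A `<=` N -> leb R d N = 0%E ->
  (\int[lebesgue_meas R d]_y (heat_kernel a (x - y) t * scaled_indicator c A y)%:E =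
   \int[leb R d]_y (heat_kernel a (x - y) t * (c * \1_B' y))%:E)%E.
Proof.
move=> c0 mA mB mN AB BN N0.
have mg : measurable_fun [set: B] (fun y : B => heat_kernel a (x - y) t * (c * \1_B' y)).
  apply: measurable_funM; first exact: measurable_heat_kernel.
  by apply: measurable_funM => //; exact: measurable_indic.
have g0 y : 0 <= heat_kernel a (x - y) t * (c * \1_B' y).
  by rewrite !mulr_ge0 ?heat_kernel_ge0.
rewrite -lebesgue_integral_borel; last 2 first.
- exact/measurable_EFinP.
- by move=> y; rewrite lee_fin.
apply: ge0_ae_eq_integral.
- exact: measurableT.
- apply/measurable_EFinP; apply: measurable_funM.
    by apply: measurable_fun_lebesgue; exact: measurable_heat_kernel.
  by apply: measurable_funM => //; exact: measurable_indic.
- by apply/measurable_EFinP; exact: measurable_fun_lebesgue.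
- by move=> y _; rewrite lee_fin !mulr_ge0 ?heat_kernel_ge0.
- by move=> y _; rewrite lee_fin.
exists N; split; [exact: borel_caratheodory|exact: N0|].
move=> y /= /not_implyP[_ neq]; apply: BN; split.
  apply: contrapT => nB; apply: neq; rewrite /scaled_indicator !indicE.
  by rewrite !memNset // => /AB.
move=> Ay; apply: neq; rewrite /scaled_indicator !indicE.
by rewrite !mem_set //; exact: AB.
Qed.

Section datum.
Variables (A : set E) (c : R) (x : E) (k : R).
Hypotheses (mA : (@lebesgue R d).-cara.-measurable A) (c0 : 0 <= c) (k0 : 0 < k).

(** The solution at [x] only depends on the radial averages of the datum about [x];
    the scaling [k] of the radius absorbs the diffusivity. *)
Lemma radial_representation : exists f : R -> R,
  [/\ measurable_fun setT f, forall r, 0 <= f r <= c,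
    {ae @radial_measure R d, forall r,
      f r = radial_average (scaled_indicator c A) x (k * r)} &
    forall a t, 0 < a -> 0 < t ->
      heat_convolution a (scaled_indicator c A) x t =
      Num.sqrt (4 * pi * a * t) ^- d * k ^+ d *
      \int[@radial_measure R d]_r (gauss (k ^+ 2 / (4 * a * t)) r * f r)].
Proof.
have [B' [N [mB mN AB BN N0]]] := borel_hull mA.
have [sigma [ssigma avg]] := sphere_mean_exists (R := R) d0.
pose pol (p : R * B) : B := affine k x (p.1 *: (p.2 : E)).
have mpol : measurable_fun [set: R * B] pol.
  exact: (measurableT_comp (measurable_affine k x) measurable_scale).
have mpre (C : set B) : measurable C -> measurable (pol @^-1` C).
  by move=> mC; rewrite -[X in measurable X]setTI; exact: mpol.
pose sec (C : set B) r : set B := xsection (pol @^-1` C) r.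
have secE (C : set B) r (w : B) : sec C r w <-> C (x + (k * r) *: (w : E)).
  by rewrite /sec /xsection /= inE /pol /affine /= scalerA.
have msec (C : set B) r : measurable C -> measurable (sec C r).
  by move=> mC; apply: measurable_xsection; exact: mpre.
have sfin (C : set B) r : measurable C -> sigma (sec C r) \is a fin_num.
  by move=> mC; apply: fin_num_measure; exact: msec.
have msig (C : set B) : measurable C -> measurable_fun setT (fun r => sigma (sec C r)).
  by move=> mC; exact: (measurable_fun_xsection sigma (mpre C mC)).
pose f r := c * fine (sigma (sec B' r)).
have f0c r : 0 <= f r <= c.
  rewrite mulr_ge0 ?fine_ge0 //= ler_piMr // -lee_fin fineK ?sfin //.
  by apply: probability_le1; exact: msec.
have mf : measurable_fun setT f.
  apply: measurable_funM => //; have mfine := @fine_measurable R setT measurableT.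
  exact: (measurableT_comp mfine (msig B' mB)).
have mindicB (C : set B) : measurable C -> measurable_fun [set: B] (\1_C : B -> R).
  by move=> mC; exact: measurable_indic.
(* polar coordinates for the indicator of a Borel set; used for the hull of [A]
   and, with [tau = 0], to see that [N] meets almost all spheres in a null set *)
have slice tau (C : set B) : 0 <= tau -> measurable C ->
    (\int[leb R d]_y (gauss tau (enorm y) * \1_C (affine k x y))%:E =
     \int[@radial_measure R d]_r ((gauss tau r)%:E * sigma (sec C r)))%E.
  move=> tau0 mC; pose g (y : B) := (gauss tau (enorm y) * \1_C (affine k x y : B))%:E.
  have mg : measurable_fun setT g.
    apply/measurable_EFinP; apply: measurable_funM.
      exact: (measurableT_comp (measurable_gauss tau) enorm_borel).
    exact: (measurableT_comp (mindicB C mC) (measurable_affine k x)).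
  have g0 y : (0 <= g y)%E by rewrite lee_fin mulr_ge0 ?gauss_ge0.
  rewrite -[LHS]/(\int[leb R d]_y g y)%E (polar_integral d0 ssigma mg g0).
  apply: eq_integral => r _.
  have mi : measurable_fun setT (fun w : B => (\1_(sec C r) w)%:E : \bar R).
    by apply/measurable_EFinP; apply: measurable_indic; exact: msec.
  transitivity (\int[sigma]_w ((gauss tau r)%:E * (\1_(sec C r) w)%:E))%E.
    apply: ge0_ae_eq_integral => //.
    - apply: (measurableT_comp mg) => //.
      exact: (measurableT_comp measurable_scale (measurable_pair1 r)).
    - exact: measurable_funeM.
    - by move=> w _; rewrite mule_ge0 // lee_fin gauss_ge0.
    exists (~` esphere); split.
    + by apply: measurableC; exact: measurable_esphere.
    + exact: ssigma.1.
    move=> w /= /not_implyP[_ neq] Sw; apply: neq.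
    rewrite /g EFinM /gauss enormZ Sw mulr1 real_normK ?num_real //; congr (_ * _%:E)%E.
    rewrite !indicE; congr (_%:R); congr nat_of_bool; apply/idP/idP; rewrite !inE secE;
      by rewrite /affine scalerA.
  rewrite ge0_integralZl //; last by rewrite lee_fin gauss_ge0.
  by rewrite integral_indic ?setIT //; exact: msec.
exists f; split=> //.
  have N1 : (\int[@radial_measure R d]_r `|sigma (sec N r)| = 0)%E.
    rewrite (eq_integral (fun r => (gauss 0 r)%:E * sigma (sec N r))%E); last first.
      by move=> r _; rewrite gee0_abs // /gauss mul0r oppr0 expR0 mul1e.
    rewrite -slice //.
    rewrite (eq_integral (fun y : B => (\1_N (affine k x y : B))%:E)); last first.
      by move=> y _; rewrite /gauss mul0r oppr0 expR0 mul1r.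
    have mN1 : measurable_fun [set: B] (fun y : B => (\1_N y)%:E : \bar R).
      by apply/measurable_EFinP; exact: mindicB.
    have NE : (\int[leb R d]_(y in setT) (\1_N y)%:E = 0)%E.
      by rewrite integral_indic // setIT.
    have indic0 (y : B) : (0 <= (\1_N y)%:E :> \bar R)%E by rewrite lee_fin.
    have aff := leb_integral_affine x k0 mN1 indic0.
    rewrite NE in aff; move/esym/eqP: aff; rewrite mule_eq0 => /orP[|/eqP //].
    by rewrite eqe expf_eq0 gt_eqF // andbF.
  have aeN : {ae @radial_measure R d, forall r, sigma (sec N r) = 0%E}.
    have /(ae_eq_integral_abs _ measurableT (msig N mN)) := N1.
    by apply: filterS => r /(_ I).
  have ae0 : {ae @radial_measure R d, forall r, 0 <= r}.
    exists `]-oo, 0[%classic; split=> //; first exact: radial_measure_lt0.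
    by move=> r /= /negP; rewrite -ltNge in_itv.
  apply: filterS2 aeN ae0 => r sN r0; apply/esym; apply: (avg _ _ _ _ _ (sec N r)) => //.
  - exact: msec.
  - exact: msec.
  - by move=> w /=; rewrite ger0_norm ?mulr_ge0 ?(ltW k0) // => Aw; apply/secE; exact: AB.
  - move=> w [/secE Bw]; rewrite /= ger0_norm ?mulr_ge0 ?(ltW k0) // => nA.
    by apply/secE; apply: BN.
move=> a t a0 t0; set tau := k ^+ 2 / (4 * a * t); set Z := _ ^- d.
have at0 : 0 < 4 * a * t by rewrite !mulr_gt0.
have tau0 : 0 < tau by rewrite divr_gt0 ?exprn_gt0.
have Z0 : 0 <= Z by rewrite invr_ge0 exprn_ge0 ?sqrtr_ge0.
pose I := (\int[@radial_measure R d]_r ((gauss tau r)%:E * sigma (sec B' r)))%E.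
have mgs : measurable_fun setT (fun r => (gauss tau r)%:E * sigma (sec B' r))%E.
  apply: emeasurable_funM; last exact: msig.
  by apply/measurable_EFinP; exact: measurable_gauss.
have I0 : (0 <= I)%E.
  by apply: integral_ge0 => r _; rewrite mule_ge0 // lee_fin gauss_ge0.
have Ifin : I \is a fin_num.
  rewrite ge0_fin_numE //; apply: le_lt_trans (radial_gauss_fin tau0).
  apply: ge0_le_integral => //.
  - by move=> r _; rewrite mule_ge0 // lee_fin gauss_ge0.
  - by apply/measurable_EFinP; exact: measurable_gauss.
  move=> r _; rewrite -[leRHS]mule1; apply: lee_pmul => //; first by rewrite lee_fin gauss_ge0.
  by apply: probability_le1; exact: msec.
rewrite /heat_convolution /Rintegral (heat_integral_hull _ _ _ c0 mA mB mN) //.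
have mg : measurable_fun [set: B] (fun y : B => (heat_kernel a (x - y) t * (c * \1_B' y))%:E).
  apply/measurable_EFinP; apply: measurable_funM; first exact: measurable_heat_kernel.
  by apply: measurable_funM => //; exact: measurable_indic.
rewrite (leb_integral_affine x k0 mg); last first.
  by move=> y; rewrite lee_fin !mulr_ge0 ?heat_kernel_ge0.
rewrite (eq_integral (fun z : B => ((Z * c)%:E *
    (gauss tau (enorm (z : E)) * \1_B' (affine k x z))%:E)%E)); last first.
  move=> z _; rewrite -EFinM; congr _%:E.
  rewrite /heat_kernel -/Z /affine opprD addrA subrr add0r enormN enormZ gtr0_norm //.
  rewrite (_ : expR _ = gauss tau (enorm z)); first by ring.
  by rewrite /gauss; congr (expR (- _)); rewrite /tau exprMn; ring.
rewrite ge0_integralZl //; last 3 first.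
- apply/measurable_EFinP; apply: measurable_funM.
    exact: (measurableT_comp (measurable_gauss tau) enorm_borel).
  exact: (measurableT_comp (mindicB B' mB) (measurable_affine k x)).
- by move=> y _; rewrite lee_fin mulr_ge0 ?gauss_ge0.
- by rewrite lee_fin mulr_ge0.
rewrite slice ?ltW // -/I.
rewrite [X in _ * fine X](_ : _ = (c%:E * I)%E); last first.
  rewrite -ge0_integralZl //; last by move=> r _; rewrite mule_ge0 // lee_fin gauss_ge0.
  apply: eq_integral => r _; rewrite /f -[sigma _]fineK ?sfin // -!EFinM.
  by congr _%:E; rewrite mulrCA.
by rewrite -(fineK Ifin) -!EFinM /=; ring.
Qed.

End datum.

End radial_representation.

(** * Laplace's method *)

Section laplace_domination.
Context {R : realType} {dd : measure_display} {X : measurableType dd}.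
Variable mu : {measure set X -> \bar R}.
Local Open Scope ereal_scope.

(** As [tau] grows, the integral that carries mass on [p <= alpha] decays at most
    like [expR (- (tau * alpha))], the other one at least like
    [expR (- (tau * beta))] (Laplace's method). *)
Lemma laplace_domination (p q f g : X -> R) (alpha beta tau1 : R) :
  measurable_fun setT p -> measurable_fun setT q ->
  measurable_fun setT f -> measurable_fun setT g ->
  (forall x, 0 <= f x)%R -> (forall x, 0 <= g x)%R -> (alpha < beta)%R ->
  (forall x, g x != 0%R -> beta <= q x)%R ->
  0 < \int[mu]_(x in [set x | p x <= alpha]%R) (f x)%:E ->
  \int[mu]_x (expR (- (tau1 * q x)) * g x)%:E < +oo ->
  exists tau0 : R, forall tau, (tau0 <= tau)%R ->
    \int[mu]_x (expR (- (tau * q x)) * g x)%:E <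
    \int[mu]_x (expR (- (tau * p x)) * f x)%:E.
Proof.
move=> mp mq mf mg f0 g0 ab gq; set D := [set x | _]; set M := integral _ D _ => M0 Koo.
have mD : measurable D.
  rewrite (_ : D = p @^-1` `]-oo, alpha]); last first.
    by apply/seteqP; split=> x; rewrite /D /= in_itv.
  by rewrite -[X in measurable X]setTI; exact: mp.
have mexp (r : X -> R) (h : X -> R) tau : measurable_fun setT r -> measurable_fun setT h ->
    measurable_fun setT (fun x => (expR (- (tau * r x)) * h x)%:E).
  move=> mr mh; apply/measurable_EFinP; apply: measurable_funM => //.
  apply: measurableT_comp => //; apply: measurableT_comp => //.
  exact: measurable_funM.
have [m m0 mM] : exists2 m : R, (0 < m)%R & m%:E <= M.
  have [Moo|Mfin] := eqVneq M +oo; first by exists 1%R; rewrite ?Moo ?leey.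
  have Mf : M \is a fin_num by rewrite ge0_fin_numE ?ltey // ltW.
  by exists (fine M); rewrite ?fineK // -lte_fin fineK.
set KK := integral _ _ _ in Koo.
have K0 : 0 <= KK by apply: integral_ge0 => x _; rewrite lee_fin mulr_ge0 ?expR_ge0.
have Kfin : KK \is a fin_num by rewrite ge0_fin_numE.
pose K := fine KK.
have Kge0 : (0 <= K)%R by exact: fine_ge0.
pose C := (expR (tau1 * beta) * K)%R.
(* for such [tau], [C / m] is less than [expR (tau * (beta - alpha))] *)
exists (Num.max (Num.max tau1 0) (C / m / (beta - alpha)))%R => tau.
rewrite !ge_max => /andP[/andP[t1 t0] tC].
apply: (@le_lt_trans _ _ ((expR (- ((tau - tau1) * beta)))%:E * KK)).
  rewrite -ge0_integralZl //; last 2 first.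
  - exact: mexp.
  - by move=> x _; rewrite lee_fin mulr_ge0 ?expR_ge0.
  apply: ge0_le_integral => //.
  - by move=> x _; rewrite lee_fin mulr_ge0 ?expR_ge0.
  - exact: mexp.
  - by apply: measurable_funeM; exact: mexp.
  move=> x _; rewrite -EFinM lee_fin mulrA.
  have [->|gx] := eqVneq (g x) 0%R; first by rewrite !mulr0.
  rewrite ler_wpM2r // -expRD ler_expR.
  have h : ((tau - tau1) * beta <= (tau - tau1) * q x)%R.
    by apply: ler_wpM2l; [rewrite subr_ge0|exact: gq].
  lra.
apply: (@lt_le_trans _ _ ((expR (- (tau * alpha)) * m)%:E)).
  rewrite -(fineK Kfin) -EFinM lte_fin -/K.
  have : (C / m < expR (tau * (beta - alpha)))%R.
    apply: (@le_lt_trans _ _ (tau * (beta - alpha)))%R.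
      by rewrite -ler_pdivrMr // subr_gt0.
    by apply: lt_le_trans (expR_ge1Dx _); lra.
  rewrite ltr_pdivrMr // => Cm.
  have -> : (- ((tau - tau1) * beta) = - (tau * beta) + tau1 * beta)%R by ring.
  have -> : (- (tau * alpha) = - (tau * beta) + tau * (beta - alpha))%R by ring.
  by rewrite !expRD -!mulrA ltr_pM2l ?expR_gt0.
apply: (@le_trans _ _ (\int[mu]_(x in D) ((expR (- (tau * alpha)))%:E * (f x)%:E))).
  rewrite ge0_integralZl //; last 2 first.
  - by apply/measurable_EFinP; exact: measurable_funTS.
  - by move=> x _; rewrite lee_fin.
  by rewrite EFinM; apply: lee_wpmul2l => //; rewrite lee_fin expR_ge0.
apply: (@le_trans _ _ (\int[mu]_(x in D) (expR (- (tau * p x)) * f x)%:E)).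
  apply: ge0_le_integral => //.
  - by move=> x _; rewrite mule_ge0 // lee_fin // expR_ge0.
  - by apply: measurable_funeM; apply/measurable_EFinP; exact: measurable_funTS.
  - by apply: measurable_funTS; exact: mexp.
  move=> x; rewrite /D /= => px; rewrite -EFinM lee_fin ler_wpM2r // ler_expR lerN2.
  by apply: ler_wpM2l.
apply: ge0_subset_integral => //; first exact: mexp.
by move=> x _; rewrite lee_fin mulr_ge0 ?expR_ge0.
Qed.

End laplace_domination.

(** * The sign of a Laplace integral *)

Section sign_changes.
Context {R : realType}.
Implicit Type w : R -> R.

(** If both strict signs occurred arbitrarily close to the right of [r0], points
    with alternating signs could be chosen one after the other, each closer to
    [r0], and [w] would change sign arbitrarily often before [r0 + 1]. *)
Lemma one_sided_sign w (r0 : R) : locally_finite_sign_changes w ->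
  exists2 delta : R, 0 < delta &
    (forall s, r0 < s < r0 + delta -> 0 <= w s) \/
    (forall s, r0 < s < r0 + delta -> w s <= 0).
Proof.
move=> fin; apply: contrapT => no.
have ex (delta : R) : 0 < delta -> (exists2 s, r0 < s < r0 + delta & w s < 0) /\
    (exists2 s, r0 < s < r0 + delta & 0 < w s).
  move=> delta0; split; apply: contrapT => nos; apply: no; exists delta => //.
    by left=> s sr; rewrite leNgt; apply/negP => ws; apply: nos; exists s.
  by right=> s sr; rewrite leNgt; apply/negP => ws; apply: nos; exists s.
have changes m : exists xi : nat -> R, [/\ forall l, (l <= m)%N -> r0 < xi l < r0 + 1,
    forall l, (l < m)%N -> xi l < xi l.+1,
    forall l, (l < m)%N -> w (xi l) * w (xi l.+1) < 0 & w (xi 0%N) != 0].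
  elim: m => [|m [xi [xiI xiS xiw xi0]]].
    have [[s sr ws] _] := ex 1 ltr01.
    by exists (fun=> s); split=> //; rewrite lt_eqF.
  have /andP[xi1 xi2] := xiI 0%N (leq0n m).
  have [s /andP[s1 s2] ws] : exists2 s, r0 < s < xi 0%N & w s * w (xi 0%N) < 0.
    have d0 : 0 < xi 0%N - r0 by rewrite subr_gt0.
    have [[s sr ws] [s' sr' ws']] := ex _ d0; rewrite subrKC in sr sr'.
    have [x0|x0|x0] := ltgtP (w (xi 0%N)) 0; last by rewrite x0 eqxx in xi0.
      by exists s' => //; rewrite pmulr_rlt0.
    by exists s => //; rewrite nmulr_rlt0.
  (* a point still closer to [r0], where [w] has the other sign, is put in front *)
  exists (fun l => if l is l'.+1 then xi l' else s); split.
  - by move=> [_|l lm]; [rewrite s1 (lt_trans s2)|exact: xiI].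
  - by move=> [_|l lm] //; exact: xiS.
  - by move=> [_|l lm] //; exact: xiw.
  - by apply: contraTneq ws => ->; rewrite mul0r ltxx.
have := fin r0 (r0 + 1); rewrite ltrDl ltr01 => /(_ isT).
rewrite ltNge => /negP; apply; rewrite leye_eq; apply/eqP/eq_infty => M.
apply: (@le_trans _ _ ((Num.truncn M).+1%:R)%:E).
  by rewrite lee_fin ltW // truncnS_gt.
apply: ereal_sup_ubound; exists (Num.truncn M).+1 => //.
have [xi [xiI xiS xiw _]] := changes (Num.truncn M).+1.
by exists xi; split=> // l /xiI; rewrite /= in_itv.
Qed.

End sign_changes.

Section eventual_sign.
Context {R : realType}.
Variable P : {measure set R -> \bar R}.
Hypothesis P_lt0 : P `]-oo, 0[%classic = 0%E.
Hypothesis P_atomless : forall r, P [set r] = 0%E.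
Hypothesis P_gauss : forall tau, 0 < tau -> (\int[P]_r (gauss tau r)%:E < +oo)%E.

Lemma gauss_bounded_integrable tau (f : R -> R) M : 0 < tau ->
  measurable_fun setT f -> (forall r, `|f r| <= M) ->
  P.-integrable setT (EFin \o (fun r => gauss tau r * f r)).
Proof.
move=> tau0 mf fM; apply/integrableP; split.
  by apply/measurable_EFinP; apply: measurable_funM => //; exact: measurable_gauss.
have M0 : 0 <= M by exact: le_trans (fM 0).
apply: (@le_lt_trans _ _ (\int[P]_r (M%:E * (gauss tau r)%:E))%E).
  apply: ge0_le_integral.
  - exact: measurableT.
  - by move=> r _; exact: abse_ge0.
  - apply: measurableT_comp => //; apply/measurable_EFinP.
    by apply: measurable_funM => //; exact: measurable_gauss.
  - by apply: measurable_funeM; apply/measurable_EFinP; exact: measurable_gauss.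
  move=> r _; rewrite -EFinM lee_fin normrM ger0_norm ?gauss_ge0 //.
  by rewrite mulrC ler_wpM2r ?gauss_ge0.
rewrite ge0_integralZl //; last 2 first.
- by apply/measurable_EFinP; exact: measurable_gauss.
- by move=> r _; rewrite lee_fin gauss_ge0.
by rewrite lte_mul_pinfty ?P_gauss // lee_fin.
Qed.

Definition null_below (f : R -> R) r := {ae P, forall x, x < r -> f x = 0}.

(** Where a function vanishes up to [r0] but not further, and is nonnegative just
    after [r0], the large negative exponents select its positive sign. *)
Lemma eventual_sign_pos (f : R -> R) M (r0 delta : R) :
  measurable_fun setT f -> (forall r, `|f r| <= M) -> 0 <= r0 -> 0 < delta ->
  null_below f r0 -> ~ null_below f (r0 + delta / 2) ->
  {ae P, forall x, r0 < x < r0 + delta -> 0 <= f x} ->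
  exists tau0 : R, forall tau, tau0 <= tau ->
    0 < \int[P]_r (gauss tau r * f r).
Proof.
move=> mf fM r00 d0 nz nnz pos.
pose fp r := Num.max (f r) 0; pose fn r := Num.max (- f r) 0.
have mfp : measurable_fun setT fp by apply: measurable_maxr.
have mfn : measurable_fun setT fn.
  by apply: measurable_maxr => //; exact: measurableT_comp.
have fp0 r : 0 <= fp r by rewrite le_max lexx orbT.
have fn0 r : 0 <= fn r by rewrite le_max lexx orbT.
have fE r : f r = fp r - fn r.
  by rewrite /fp /fn /Num.max; do ![case: ifPn; rewrite -?leNgt => ?]; lra.
have M0 : 0 <= M by exact: le_trans (fM 0).
have fpM r : `|fp r| <= M.
  by rewrite ger0_norm // ge_max M0 andbT; apply: le_trans (fM r); exact: ler_norm.
have fnM r : `|fn r| <= M.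
  rewrite ger0_norm // ge_max M0 andbT; apply: le_trans (fM r).
  by rewrite -normrN ler_norm.
have nn : {ae P, forall x, x < r0 + delta -> 0 <= f x}.
  have ne : {ae P, forall x, x != r0}.
    exists [set r0]; split=> //.
    by move=> x /= /negP; rewrite negbK => /eqP.
  apply: filterS3 nz ne pos => x h1 h2 h3 xd.
  have [x0|x0|xr0] := ltgtP x r0; first by rewrite (h1 x0) lexx.
    by apply: h3; rewrite x0.
  by rewrite xr0 eqxx in h2.
(* almost everywhere, the negative part of [f] only lives beyond [r0 + delta] *)
pose g r := fn r * \1_(`[r0 + delta, +oo[%classic) r.
have mg : measurable_fun setT g by apply: measurable_funM.
have g0 r : 0 <= g r by rewrite mulr_ge0.
have fn_g tau : (\int[P]_r (gauss tau r * fn r)%:E = \int[P]_r (gauss tau r * g r)%:E)%E.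
  apply: ge0_ae_eq_integral.
  - exact: measurableT.
  - apply/measurable_EFinP; apply: measurable_funM => //; exact: measurable_gauss.
  - apply/measurable_EFinP; apply: measurable_funM => //; exact: measurable_gauss.
  - by move=> r _; rewrite lee_fin mulr_ge0 ?gauss_ge0.
  - by move=> r _; rewrite lee_fin mulr_ge0 ?gauss_ge0.
  apply: filterS nn => x h _; rewrite /g indicE.
  have [xd|xd] := ltP x (r0 + delta).
    rewrite memNset ?mulr0; last by rewrite /= in_itv /= andbT leNgt xd.
    by rewrite /fn max_r ?mulr0 // oppr_le0 h.
  by rewrite mem_set ?mulr1 //= in_itv /= andbT.
set alpha := (r0 + delta / 2) ^+ 2; set beta := (r0 + delta) ^+ 2.
have ab : alpha < beta by rewrite /alpha /beta ltr_pXn2r // ?nnegrE; lra.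
have msq : measurable_fun setT (fun r : R => r ^+ 2) by exact: measurable_funX.
have [tau0 dom] : exists tau0, forall tau, tau0 <= tau ->
    (\int[P]_r (gauss tau r * g r)%:E < \int[P]_r (gauss tau r * fp r)%:E)%E.
  apply: (@laplace_domination _ _ _ P (fun r => r ^+ 2) (fun r => r ^+ 2) fp g alpha beta 1).
  - exact: msq.
  - exact: msq.
  - exact: mfp.
  - exact: mg.
  - exact: fp0.
  - exact: g0.
  - exact: ab.
  - move=> x; rewrite /g indicE; case: (boolP (x \in _)); last by rewrite mulr0 eqxx.
    rewrite inE /= in_itv /= andbT => xd _.
    by apply: lerXn2r => //; rewrite nnegrE; lra.
  - rewrite lt_neqAle integral_ge0 ?andbT; last by move=> x _; rewrite lee_fin.
    rewrite eq_sym; apply/negP => /eqP I0; apply: nnz.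
    set D := [set x | _] in I0.
    have mD : measurable D.
      rewrite (_ : D = (fun r : R => r ^+ 2) @^-1` `]-oo, alpha]); last first.
        by apply/seteqP; split=> x; rewrite /D /= in_itv.
      by rewrite -[X in measurable X]setTI; exact: msq.
    have mfpD : measurable_fun D (fun x => (fp x)%:E).
      by apply/measurable_EFinP; exact: measurable_funTS.
    have I0' : (\int[P]_(x in D) `|(fp x)%:E| = 0)%E.
      by rewrite -[RHS]I0; apply: eq_integral => x _; rewrite gee0_abs // lee_fin.
    have /(ae_eq_integral_abs _ mD mfpD) z := I0'.
    have ge0 : {ae P, forall x, 0 <= x}.
      exists `]-oo, 0[%classic; split=> //.
      by move=> x /= /negP; rewrite -ltNge in_itv.
    apply: filterS3 nn z ge0 => x h1 h2 x0 xd.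
    have : (fp x)%:E = 0%E.
      by apply: h2; rewrite /D /=; apply: lerXn2r; rewrite ?nnegrE; lra.
    rewrite /fp => -[]; have := h1 _; rewrite (_ : x < r0 + delta); last by lra.
    by move=> /(_ isT) fx0; rewrite max_l.
  - rewrite -fn_g; have /integrableP[_] := gauss_bounded_integrable ltr01 mfn fnM.
    apply: le_lt_trans; apply: ge0_le_integral.
    + exact: measurableT.
    + by move=> x _; rewrite lee_fin mulr_ge0 ?gauss_ge0.
    + apply/measurable_EFinP; apply: measurable_funM => //; exact: measurable_gauss.
    + apply: measurableT_comp => //; apply/measurable_EFinP.
      by apply: measurable_funM => //; exact: measurable_gauss.
    by move=> x _; rewrite /= lee_fin ler_norm.
exists (Num.max tau0 1) => tau; rewrite ge_max => /andP[t0 t1].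
have tau_gt0 : 0 < tau by lra.
have intp := gauss_bounded_integrable tau_gt0 mfp fpM.
have intn := gauss_bounded_integrable tau_gt0 mfn fnM.
rewrite (@eq_Rintegral _ _ _ P setT (fun r => gauss tau r * fp r - gauss tau r * fn r)); last first.
  by move=> r _; rewrite -mulrBr -fE.
rewrite RintegralB // subr_gt0 /Rintegral.
have := dom tau t0; rewrite -fn_g.
have fin1 := integrable_fin_num measurableT intp.
have fin2 := integrable_fin_num measurableT intn.
by move=> h; apply: fine_lt.
Qed.

(** Either [f] vanishes almost everywhere, or there is a largest [r0] below which it
    does, and [eventual_sign_pos] applies to [f] or to [- f] there. *)
Lemma eventual_sign (f w : R -> R) M : measurable_fun setT f ->
  (forall r, `|f r| <= M) -> {ae P, forall r, f r = w r} ->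
  locally_finite_sign_changes w ->
  exists s tau0 : R, forall tau, tau0 <= tau ->
    Num.sg (\int[P]_r (gauss tau r * f r)) = s.
Proof.
move=> mf fM fw wfin.
have null0 : null_below f 0.
  exists `]-oo, 0[%classic; split=> //.
  by move=> x /= /not_implyP[]; rewrite in_itv.
have [all_null|/existsNP[r1 nr1]] := pselect (forall r, null_below f r).
  exists 0, 0 => tau _.
  have fz : {ae P, forall x, f x = 0}.
    have : {ae P, forall x, forall n : nat, x < n%:R -> f x = 0}.
      by apply/ae_foralln => n; exact: all_null.
    apply: filterS => x /(_ (Num.truncn x).+1); apply; exact: truncnS_gt.
  rewrite /Rintegral (@ae_eq_integral _ _ _ P setT (cst 0%E)).
  - by rewrite integral0 sgr0.
  - exact: measurableT.
  - by apply/measurable_EFinP; apply: measurable_funM => //; exact: measurable_gauss.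
  - exact: measurable_cst.
  - by apply: filterS fz => x fx _; rewrite /= fx mulr0.
pose Z := [set r | null_below f r].
have down r r' : r' <= r -> null_below f r -> null_below f r'.
  by move=> rr'; apply: filterS => x h xr; apply: h; exact: lt_le_trans rr'.
have Zub : ubound Z r1.
  move=> r /= nr; rewrite leNgt; apply/negP => r1r; apply: nr1.
  exact: down (ltW r1r) nr.
have hs : has_sup Z by split; [exists 0|exists r1].
pose r0 := sup Z.
have r00 : 0 <= r0 by apply: ub_le_sup => //; exists r1.
have nr0 : null_below f r0.
  have : {ae P, forall x, forall n : nat, x < r0 - n.+1%:R^-1 -> f x = 0}.
    apply/ae_foralln => n.
    have n0 : 0 < n.+1%:R^-1 :> R by rewrite invr_gt0.
    have [r nr rn] := sup_adherent n0 hs.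
    exact: down (ltW rn) nr.
  apply: filterS => x h xr0.
  have [n] := @ltr_add_invr R x r0 xr0; rewrite -ltrBrDr; exact: h.
have nafter r : r0 < r -> ~ null_below f r.
  move=> r0r nr; suff : r <= r0 by rewrite leNgt r0r.
  by apply: ub_le_sup => //; exists r1.
have [delta d0 sgn] := one_sided_sign r0 wfin.
have nd : ~ null_below f (r0 + delta / 2).
  by apply: nafter; rewrite ltrDl divr_gt0.
case: sgn => [wpos|wneg].
  have [|tau0 tau0P] := eventual_sign_pos mf fM r00 d0 nr0 nd.
    by apply: filterS fw => x -> /wpos.
  by exists 1, tau0 => tau /tau0P h; rewrite gtr0_sg.
have mfN : measurable_fun setT (\- f) by exact: measurableT_comp.
have fMN r : `|(\- f) r| <= M by rewrite normrN.
have nz_opp r : null_below (\- f) r <-> null_below f r.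
  by split; apply: filterS => x h /h /=; [move=> /eqP; rewrite oppr_eq0 => /eqP|move=> ->; rewrite oppr0].
have [|||tau0 tau0P] := eventual_sign_pos mfN fMN r00 d0.
- exact/nz_opp.
- by move=> /nz_opp.
- by apply: filterS fw => x /= -> /wneg; rewrite oppr_ge0.
exists (-1), (Num.max tau0 1) => tau; rewrite ge_max => /andP[/tau0P h t1].
have tau_gt0 : 0 < tau by lra.
rewrite ltr0_sg // -oppr_gt0.
rewrite -mulN1r -RintegralZl //; last exact: gauss_bounded_integrable fM.
rewrite (@eq_Rintegral _ _ _ P setT (fun r => gauss tau r * (\- f) r)) //.
by move=> r _; rewrite /= mulN1r mulrN.
Qed.

End eventual_sign.

(** * Eventual signs of the difference of two solutions *)

Section diffusive_signs.
Context {R : realType} {d : nat}.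
Local Notation E := 'rV[R]_d.

Lemma diffusive_signE (u v : E -> R -> R) x s :
  (\forall t \near 0^'+, Num.sg (u x t - v x t) = s) ->
  diffusive_sign_defined u v x /\ diffusive_sign u v x = s.
Proof.
move=> uvs.
have cv : Num.sg (u x t - v x t) @[t --> 0^'+] --> s.
  by apply: cvg_near_cst.
split; first by apply/cvg_ex; exists s.
exact: cvg_lim.
Qed.

Lemma near_small_time (T : \bar R) (t0 : R) : (0 < T)%E -> 0 < t0 ->
  \forall t \near 0^'+, [/\ 0 < t, t <= t0 & (t%:E < T)%E].
Proof.
move=> T0 t00.
have [t1 t10 t1T] : exists2 t1 : R, 0 < t1 & forall t, t < t1 -> (t%:E < T)%E.
  case: T T0 => [r|_|//]; last by exists 1 => // t _; exact: ltry.
  by rewrite lte_fin => r0; exists r => // t; rewrite lte_fin.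
near=> t; split.
- by near: t; exact: nbhs_right_gt.
- by near: t; exact: nbhs_right_le.
- by apply: t1T; near: t; exact: nbhs_right_lt.
Unshelve. all: by end_near. Qed.

Lemma sqrt_heat_scale (a b t : R) : 0 < a -> 0 < b -> 0 < t ->
  Num.sqrt (4 * pi * b * t) = Num.sqrt (b / a) * Num.sqrt (4 * pi * a * t).
Proof.
move=> a0 b0 t0; rewrite -sqrtrM ?divr_ge0 ?ltW //.
by congr Num.sqrt; field; rewrite gt_eqF.
Qed.

Local Notation L := (caratheodory_type (@lebesgue R d)).

Lemma lebesgue_measurable_dist (x : E) :
  measurable_fun [set: L] (fun y : E => enorm (x - y)).
Proof. exact: (measurable_fun_lebesgue (measurable_dist x)). Qed.

Lemma measurable_scaled_indicator c (A : set L) : measurable A ->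
  measurable_fun [set: L] (scaled_indicator c A).
Proof.
move=> mA; apply: measurable_funM; last exact: measurable_indic.
exact: measurable_cst.
Qed.

Lemma scaled_indicator_bounds c (A : set E) y : 0 <= c ->
  0 <= scaled_indicator c A y <= c.
Proof.
move=> c0; rewrite /scaled_indicator indicE.
by case: (_ \in _); rewrite ?mulr1 ?mulr0 lexx c0.
Qed.

Lemma gauss_dist_fin (x : E) tau (h : E -> R) M : 0 < tau ->
  measurable_fun [set: L] h -> (forall y, 0 <= h y <= M) ->
  (\int[lebesgue_meas R d]_y (gauss tau (enorm (x - y)) * h y)%:E < +oo)%E.
Proof.
move=> tau0 mh hM.
have M0 : 0 <= M by have /andP[h0 h1] := hM x; exact: le_trans h1.
have mg : measurable_fun [set: borel R d] (fun y : borel R d => (gauss tau (enorm (x - (y : E))))%:E).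
  apply/measurable_EFinP.
  exact: (measurableT_comp (measurable_gauss tau) (measurable_dist x)).
have mgL : measurable_fun [set: L] (fun y : E => gauss tau (enorm (x - y))).
  exact: (measurableT_comp (measurable_gauss tau) (lebesgue_measurable_dist x)).
have fin : (\int[lebesgue_meas R d]_y (gauss tau (enorm (x - y)))%:E < +oo)%E.
  rewrite (lebesgue_integral_borel mg); last by move=> y; rewrite lee_fin gauss_ge0.
  rewrite (leb_integral_affine x ltr01 mg); last by move=> y; rewrite lee_fin gauss_ge0.
  rewrite expr1n mul1e (eq_integral (fun z : borel R d => (gauss tau (enorm (z : E)))%:E)).
    exact: gauss_integral_fin.
  by move=> z _; rewrite /affine scale1r opprD addrA subrr add0r enormN.
apply: (@le_lt_trans _ _ (\int[lebesgue_meas R d]_y (M%:E * (gauss tau (enorm (x - y)))%:E))%E).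
  apply: ge0_le_integral.
  - exact: measurableT.
  - by move=> y _; have /andP[h0 h1] := hM y; rewrite lee_fin mulr_ge0 ?gauss_ge0.
  - by apply/measurable_EFinP; exact: measurable_funM.
  - by apply: measurable_funeM; exact/measurable_EFinP.
  move=> y _; have /andP[h0 h1] := hM y.
  by rewrite -EFinM lee_fin mulrC ler_wpM2r ?gauss_ge0.
rewrite ge0_integralZl.
- by rewrite lte_mul_pinfty // lee_fin.
- exact: measurableT.
- exact/measurable_EFinP.
- by move=> y _; rewrite lee_fin gauss_ge0.
- by rewrite lee_fin.
Qed.

(** The heat semigroup at time [t] as a Laplace transform at [t^-1]. *)
Lemma heat_convolution_laplace (x : E) (b t M : R) (h : E -> R) : 0 < b -> 0 < t ->
  measurable_fun [set: L] h -> (forall y, 0 <= h y <= M) ->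
  heat_convolution b h x t = Num.sqrt (4 * pi * b * t) ^- d *
    fine (\int[lebesgue_meas R d]_y
      (expR (- (t^-1 * (enorm (x - y) ^+ 2 / (4 * b)))) * h y)%:E)%E.
Proof.
move=> b0 t0 mh hM; rewrite /heat_convolution /Rintegral.
set Z := Num.sqrt _ ^- d.
have Z0 : 0 <= Z by rewrite invr_ge0 exprn_ge0 ?sqrtr_ge0.
have expE (y : E) : expR (- (t^-1 * (enorm (x - y) ^+ 2 / (4 * b)))) =
    gauss (4 * b * t)^-1 (enorm (x - y)).
  by congr (expR (- _)); rewrite [in RHS]invfM; ring.
rewrite (eq_integral (fun y : L =>
    (Z%:E * (gauss (4 * b * t)^-1 (enorm (x - (y : E))) * h y)%:E)%E)); last first.
  move=> y _; rewrite -EFinM mulrA; congr (_ * _ * _)%:E.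
  by rewrite /gauss; congr (expR (- _)); rewrite mulrC.
rewrite ge0_integralZl.
- under [in RHS]eq_integral do rewrite expE.
  rewrite fineM // ge0_fin_numE.
    by apply: gauss_dist_fin mh hM; rewrite invr_gt0 !mulr_gt0.
  apply: integral_ge0 => y _; have /andP[h0 _] := hM y.
  by rewrite lee_fin mulr_ge0 ?gauss_ge0.
- exact: measurableT.
- apply/measurable_EFinP; apply: measurable_funM; last exact: mh.
  exact: (measurableT_comp (measurable_gauss _) (lebesgue_measurable_dist x)).
- by move=> y _; have /andP[h0 _] := hM y; rewrite lee_fin mulr_ge0 ?gauss_ge0.
- by rewrite lee_fin.
Qed.

Hypothesis d0 : (0 < d)%N.

Section pair.
Variables (T : \bar R) (A A' : set E) (a a' c c' : R) (u u' : E -> R -> R).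
Hypothesis T0 : (0 < T)%E.
Hypotheses (mA : (@lebesgue R d).-cara.-measurable A)
  (mA' : (@lebesgue R d).-cara.-measurable A').
Hypotheses (a0 : 0 < a) (a'0 : 0 < a') (c0 : 0 < c) (c'0 : 0 < c').
Hypotheses (hu : bounded_heat_solution T a (scaled_indicator c A) u)
  (hu' : bounded_heat_solution T a' (scaled_indicator c' A') u').
Let k := Num.sqrt (a' / a).

Let k0 : 0 < k. Proof. by rewrite sqrtr_gt0 divr_gt0. Qed.
Let k2 : k ^+ 2 = a' / a. Proof. by rewrite sqr_sqrtr // divr_ge0 // ltW. Qed.

(** Both solutions are Gaussian integrals with the same exponent and the same
    normalization, because [k ^+ 2 / a' = a^-1]. *)
Lemma radial_eventual_sign x :
  locally_finite_sign_changes (fun r => radial_average (scaled_indicator c A) x r -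
    radial_average (scaled_indicator c' A') x (k * r)) ->
  exists s, \forall t \near 0^'+, Num.sg (u x t - u' x t) = s.
Proof.
move=> wfin.
have [f [mf fc fE fheat]] := radial_representation d0 x mA (ltW c0) ltr01.
have [f' [mf' fc' fE' fheat']] := radial_representation d0 x mA' (ltW c'0) k0.
pose g r := f r - f' r.
have mg : measurable_fun setT g by exact: measurable_funB.
have fM r : `|f r| <= c by have /andP[h1 h2] := fc r; rewrite ger0_norm.
have fM' r : `|f' r| <= c' by have /andP[h1 h2] := fc' r; rewrite ger0_norm.
have gM r : `|g r| <= c + c'.
  by apply: le_trans (ler_normB _ _) _; apply: lerD.
have gw : {ae @radial_measure R d, forall r, g r =
    radial_average (scaled_indicator c A) x r -
    radial_average (scaled_indicator c' A') x (k * r)}.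
  by apply: filterS2 fE fE' => r e e'; rewrite /g e e' mul1r.
have gfin := @radial_gauss_fin R d.
have [s [tau0 sP]] := eventual_sign radial_measure_lt0
  (radial_measure_set1 d0) gfin mg gM gw wfin.
exists s; pose m := Num.max tau0 1.
have m0 : 0 < m by rewrite lt_max ltr01 orbT.
have am0 : 0 < (4 * a * m)^-1 by rewrite invr_gt0 !mulr_gt0.
apply: filterS (near_small_time T0 am0) => t [t0 tm tT].
have at0 : 0 < 4 * a * t by rewrite !mulr_gt0.
pose tau := (4 * a * t)^-1.
have tau_gt0 : 0 < tau by rewrite invr_gt0.
have tau0P : tau0 <= tau.
  apply: (@le_trans _ _ m); first by rewrite le_max lexx.
  rewrite /tau -[leLHS]invrK lef_pV2 ?posrE ?invr_gt0 //.
  rewrite -ler_pdivlMl; last by rewrite !mulr_gt0.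
  by rewrite -invfM (mulrC 4 a) -!mulrA mulrA (mulrC a) in tm *.
rewrite (heat_representation hu) // (heat_representation hu') // fheat // fheat' //.
have tau1 : 1 ^+ 2 / (4 * a * t) = tau by rewrite expr1n div1r.
have tauk : k ^+ 2 / (4 * a' * t) = tau.
  by rewrite k2 /tau; field; rewrite !gt_eqF.
rewrite tau1 tauk (sqrt_heat_scale a0 a'0 t0) -/k exprMn expr1n mulr1.
set Z := Num.sqrt _ ^+ d.
have Z0 : 0 < Z by rewrite exprn_gt0 // sqrtr_gt0 !mulr_gt0 ?pi_gt0.
have kd0 : 0 < k ^+ d by rewrite exprn_gt0.
have -> : (k ^+ d * Z)^-1 * k ^+ d = Z^-1 by field; rewrite !gt_eqF.
have intf := gauss_bounded_integrable gfin tau_gt0 mf fM.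
have intf' := gauss_bounded_integrable gfin tau_gt0 mf' fM'.
rewrite -mulrBr -RintegralB //.
rewrite (@eq_Rintegral _ _ _ (@radial_measure R d) setT (fun r => gauss tau r * g r)); last first.
  by move=> r _; rewrite /g mulrBr.
by rewrite sgrM gtr0_sg ?invr_gt0 // mul1r sP.
Qed.

(** Laplace's method with the squared distances to [x], divided by [4 * a] and
    [4 * a'], as exponents; [k * rho < rho'] compares their values at [rho] and
    [rho']. *)
Lemma closer_eventual_sign x rho rho' : lebesgue (eball x rho `&` A) != 0%E ->
  lebesgue (eball x rho' `&` A') = 0%E -> k * rho < rho' ->
  \forall t \near 0^'+, Num.sg (u x t - u' x t) = 1.
Proof.
move=> An0 A'0 krho.
have rho0 : 0 <= rho.
  rewrite leNgt; apply: contra An0 => r0; rewrite (_ : _ `&` _ = set0) ?outer_measure0 //.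
  apply/seteqP; split=> // y [+ _]; rewrite /eball /= => /lt_trans/(_ r0).
  by rewrite ltNge sqrtr_ge0.
have rho'0 : 0 < rho' by apply: le_lt_trans krho; rewrite mulr_ge0 // ltW.
have mball r : measurable (eball x r : set L).
  by apply: borel_caratheodory; exact: measurable_eball.
pose p y := enorm (x - y) ^+ 2 / (4 * a).
pose q y := enorm (x - y) ^+ 2 / (4 * a').
pose f := scaled_indicator c A.
(* [k ^- d] is the quotient of the normalizations of the two heat kernels *)
pose g := scaled_indicator (k ^- d * c') (A' `\` eball x rho').
have kd0 : 0 < k ^- d by rewrite invr_gt0 exprn_gt0.
have mf : measurable_fun [set: L] f.
  by apply: measurable_scaled_indicator.
have mg : measurable_fun [set: L] g.
  apply: measurable_scaled_indicator; exact: (measurableD mA' (mball rho')).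
have mp b : measurable_fun [set: L] (fun y => enorm (x - y) ^+ 2 / b).
  exact: (measurable_funM (measurable_funX 2 (lebesgue_measurable_dist x)) (measurable_cst b^-1)).
have fb y : 0 <= f y <= c by apply: scaled_indicator_bounds; exact: ltW.
have gb y : 0 <= g y <= k ^- d * c'.
  by apply: scaled_indicator_bounds; rewrite mulr_ge0 // ltW.
have expE b tau y : expR (- (tau * (enorm (x - y) ^+ 2 / b))) = gauss (tau / b) (enorm (x - y)).
  by rewrite /gauss mulrA mulrAC.
have [||||||tau0 dom] := @laplace_domination R _ L (lebesgue_meas R d) p q f g
  (rho ^+ 2 / (4 * a)) (rho' ^+ 2 / (4 * a')) 1 (mp _) (mp _) mf mg.
- by move=> y; have /andP[] := fb y.
- by move=> y; have /andP[] := gb y.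
- rewrite ltr_pdivrMr ?mulr_gt0 //.
  have -> : rho' ^+ 2 / (4 * a') * (4 * a) = rho' ^+ 2 / k ^+ 2.
    by rewrite k2; field; rewrite !gt_eqF.
  rewrite ltr_pdivlMr ?exprn_gt0 // -exprMn mulrC ltrXn2r //.
  by rewrite mulr_ge0 // ltW.
- move=> y; rewrite /g /scaled_indicator indicE.
  case: (boolP (_ \in _)); rewrite ?mulr0 ?eqxx // inE => -[_ nby] _.
  rewrite /q ler_pM2r ?invr_gt0 ?mulr_gt0 // lerXn2r ?nnegrE ?sqrtr_ge0 ?(ltW rho'0) //.
  by rewrite leNgt; apply/negP => h; apply: nby; rewrite /eball /= enormB.
- have mAb : measurable (eball x rho `&` A : set L) by exact: measurableI.
  apply: (@lt_le_trans _ _ (\int[lebesgue_meas R d]_(y in eball x rho `&` A) (f y)%:E)%E).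
    rewrite (eq_integral (fun=> c%:E)); last first.
      by move=> y; rewrite inE => -[_ Ay]; rewrite /f /scaled_indicator indicE mem_set // mulr1.
    rewrite integral_cst // mule_gt0 ?lte_fin // lt0e An0; exact: outer_measure_ge0.
  apply: ge0_subset_integral; first exact: mAb.
  - rewrite (_ : [set y | _] = (fun y => p y) @^-1` `]-oo, rho ^+ 2 / (4 * a)]); last first.
      by apply/seteqP; split=> y; rewrite /= in_itv.
    rewrite -[X in measurable X]setTI; exact: (mp _).
  - by apply/measurable_EFinP; exact: measurable_funTS.
  - by move=> y _; have /andP[] := fb y; rewrite lee_fin.
  move=> y [yb _]; rewrite /p /= ler_pM2r ?invr_gt0 ?mulr_gt0 //.
  by rewrite lerXn2r ?nnegrE ?sqrtr_ge0 // enormB ltW.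
- under eq_integral do rewrite expE.
  by apply: gauss_dist_fin mg gb; rewrite divr_gt0 // mulr_gt0.
pose m := Num.max tau0 1.
have m0 : 0 < m by rewrite lt_max ltr01 orbT.
have mi0 : 0 < m^-1 by rewrite invr_gt0.
apply: filterS (near_small_time T0 mi0) => t [t0 tm tT].
have tau0P : tau0 <= t^-1.
  apply: (@le_trans _ _ m); first by rewrite le_max lexx.
  by rewrite -[leLHS]invrK lef_pV2 ?posrE.
rewrite (heat_representation hu) // (heat_representation hu') //.
set Z := Num.sqrt (4 * pi * a * t) ^- d.
have Z0 : 0 < Z by rewrite invr_gt0 exprn_gt0 // sqrtr_gt0 !mulr_gt0 ?pi_gt0.
pose I := (\int[lebesgue_meas R d]_y (expR (- (t^-1 * p y)) * f y)%:E)%E.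
pose J := (\int[lebesgue_meas R d]_y (expR (- (t^-1 * q y)) * g y)%:E)%E.
have Ifin : (I < +oo)%E.
  rewrite /I; under eq_integral do rewrite expE.
  by apply: gauss_dist_fin mf fb; rewrite divr_gt0 ?invr_gt0 // mulr_gt0.
have Jfin : (J < +oo)%E.
  rewrite /J; under eq_integral do rewrite expE.
  by apply: gauss_dist_fin mg gb; rewrite divr_gt0 ?invr_gt0 // mulr_gt0.
have I0 : (0 <= I)%E.
  by apply: integral_ge0 => y _; rewrite lee_fin mulr_ge0 ?expR_ge0 //; have /andP[] := fb y.
have J0 : (0 <= J)%E.
  by apply: integral_ge0 => y _; rewrite lee_fin mulr_ge0 ?expR_ge0 //; have /andP[] := gb y.
rewrite (heat_convolution_laplace x a0 t0 mf fb) -/Z -[X in Z * fine X]/I.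
have mA'c : measurable_fun [set: L] (scaled_indicator c' A').
  exact: measurable_scaled_indicator.
have cb y : 0 <= scaled_indicator c' A' y <= c'.
  by apply: scaled_indicator_bounds; exact: ltW.
rewrite (heat_convolution_laplace x a'0 t0 mA'c cb).
rewrite (sqrt_heat_scale a0 a'0 t0) -/k exprMn (invfM (k ^+ d)) -/Z.
set K := (X in _ - _ * fine X).
have e0 y : 0 <= expR (- (t^-1 * q y)) by exact: expR_ge0.
have me : measurable_fun [set: L] (fun y => expR (- (t^-1 * q y))).
  rewrite (_ : (fun y => _) = fun y : E => gauss (t^-1 / (4 * a')) (enorm (x - y))).
    exact: (measurableT_comp (measurable_gauss _) (lebesgue_measurable_dist x)).
  by apply/funext => y; rewrite -expE.
have JE : (J = (k ^- d)%:E * K)%E.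
  rewrite /K -ge0_integralZl; first last.
  - by rewrite lee_fin ltW.
  - by move=> y _; have /andP[h0 _] := cb y; rewrite lee_fin mulr_ge0.
  - by apply/measurable_EFinP; exact: measurable_funM me mA'c.
  - exact: measurableT.
  apply: ge0_ae_eq_integral.
  - exact: measurableT.
  - by apply/measurable_EFinP; exact: measurable_funM me mg.
  - by apply: measurable_funeM; apply/measurable_EFinP; exact: measurable_funM me mA'c.
  - by move=> y _; have /andP[h0 _] := gb y; rewrite lee_fin mulr_ge0.
  - move=> y _; have /andP[h0 _] := cb y; rewrite -EFinM lee_fin.
    exact: (mulr_ge0 (ltW kd0) (mulr_ge0 (e0 y) h0)).
  exists (eball x rho' `&` A'); split.
  - exact: measurableI.
  - exact: A'0.
  move=> y /= /not_implyP[_ neq]; apply: contrapT => nyA; apply: neq.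
  have iE : \1_(A' `\` eball x rho') y = \1_A' y :> R.
    rewrite !indicE; congr (_%:R); congr nat_of_bool; apply/idP/idP; rewrite !inE.
      by case.
    by move=> Ay; split=> // yb; apply: nyA.
  by rewrite -EFinM /g /scaled_indicator iE; congr _%:E; ring.
have fin (r : \bar R) : (0 <= r)%E -> (r < +oo)%E -> r \is a fin_num.
  by move=> r0 roo; rewrite ge0_fin_numE.
have := dom _ tau0P; rewrite -/I -/J -[I]fineK ?fin // -[J]fineK ?fin // lte_fin => JI.
have Kf : k ^- d * fine K = fine J.
  rewrite JE; case: K JE => [r|jE|jE]; rewrite //=.
    by move: Jfin; rewrite jE mulry gtr0_sg // mul1e.
  by move: J0; rewrite jE mulrNy gtr0_sg // mul1e.
apply/eqP; rewrite -subr_gt0 in JI.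
rewrite (_ : _ - _ = Z * (fine I - fine J)); last by rewrite -Kf; ring.
by rewrite gtr0_sg // mulr_gt0.
Qed.

End pair.
End diffusive_signs.

(** * Comparison of essential distances *)

Section comparison.
Context {R : realType} {d : nat}.
Local Notation E := 'rV[R]_d.

Definition closer_than (k : R) (A A' : set E) (x : E) : Prop := exists rho rho',
  [/\ lebesgue (eball x rho `&` A) != 0%E, lebesgue (eball x rho' `&` A') = 0%E &
    k * rho < rho'].

Lemma closer_than_near (k : R) (A A' : set E) x : 0 < k -> closer_than k A A' x ->
  \forall y \near x, closer_than k A A' y.
Proof.
move=> k0 [rho [rho' [An0 A'0 lt]]].
(* enlarging [rho] and shrinking [rho'] by [e] uses half of the gap *)
pose e := (rho' - k * rho) / (2 * (k + 1)).
have k1 : 0 < k + 1 by rewrite addr_gt0.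
have e0 : 0 < e by rewrite divr_gt0 ?subr_gt0 // mulr_gt0.
have ke : 2 * (k + 1) * e = rho' - k * rho.
  by rewrite /e; field; rewrite gt_eqF.
have null (U V : set E) : U `<=` V -> lebesgue V = 0%E -> lebesgue U = 0%E.
  move=> UV V0; apply/eqP; rewrite eq_le outer_measure_ge0 andbT -V0.
  exact: le_outer_measure.
have near_ball : \forall y \near x, eball x e y.
  apply: open_nbhs_nbhs; split; first exact: open_eball.
  by rewrite /eball /= subrr enorm0.
apply: filterS near_ball => y; rewrite {1}/eball /= => yx; exists (rho + e), (rho' - e); split.
- apply: contra An0 => /eqP h; apply/eqP; apply: null h => z [xz Az]; split=> //.
  have := enorm_triangle z x y; rewrite /eball /= in xz *.
  by rewrite (enormB x y); lra.
- apply: null A'0 => z [yz Az]; split=> //.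
  have := enorm_triangle z y x; rewrite /eball /= in yz *; lra.
have : 0 < (k + 1) * e by rewrite mulr_gt0.
by lra.
Qed.

Lemma ess_dist_closer_than (k : R) (A A' : set E) x : 0 < k ->
  (ess_dist x A < (1 / k)%:E * ess_dist x A')%E -> closer_than k A A' x.
Proof.
move=> k0 lt.
have ess_ge0 (U : set E) : (0 <= ess_dist x U)%E.
  apply: ereal_sup_ubound; exists 0 => //; split=> //.
  rewrite (_ : _ `&` _ = set0) ?outer_measure0 //; apply/seteqP; split=> // y [].
  by rewrite /eball /= ltNge sqrtr_ge0.
have [rho rhoA krho] : exists2 rho : R, (ess_dist x A < rho%:E)%E &
    ((k * rho)%:E < ess_dist x A')%E.
  case: (ess_dist x A) (ess_ge0 A) lt => [r|_|//]; last by rewrite ltNge leey.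
  move=> _; case: (ess_dist x A') (ess_ge0 A') => [r'|_|//] _; last first.
    by exists (r + 1); [rewrite lte_fin ltrDl|exact: ltry].
  rewrite -EFinM lte_fin div1r mulrC ltr_pdivlMr // => rr'.
  exists ((r + r' / k) / 2); rewrite lte_fin.
    have : r < r' / k by rewrite ltr_pdivlMr.
    by lra.
  have -> : k * ((r + r' / k) / 2) = (r * k + r') / 2 by field; rewrite gt_eqF.
  by lra.
have [_ [rho' [rho'0 A'0] <-]] := ereal_sup_gt krho.
rewrite lte_fin => krho'; exists rho, rho'; split=> //.
have rho0 : 0 <= rho by rewrite -lee_fin (le_trans (ess_ge0 A)) // ltW.
apply: contraTN rhoA => /eqP A0; rewrite -leNgt; apply: ereal_sup_ubound.
by exists rho.
Qed.

End comparison.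

(** * Diffusive signs and classification sets *)

Theorem theorem2p3 (R : realType) (d N : nat) (hd : (0 < d)%N)
  (T : \bar R) (hT : (0 < T)%E)
  (A : 'I_N -> set 'rV[R]_d)
  (mA : forall i, (lebesgue (d:=d)).-cara.-measurable (A i))
  (hA : forall i j, i != j -> lebesgue (A i `&` A j) = 0%E)
  (a c : 'I_N -> R) (ha : forall i, 0 < a i) (hc : forall i, 0 < c i)
  (u : 'I_N -> 'rV[R]_d -> R -> R)
  (hu : forall i,
    bounded_heat_solution T (a i) (scaled_indicator (c i) (A i)) (u i))
  (xh : 'rV[R]_d)
  (hxh : ~ (\bigcup_(i in [set: 'I_N]) closure (A i)) xh)
  (A1 : forall i,
    piecewise_continuous (radial_average (scaled_indicator (c i) (A i)) xh))
  (A2 : forall i, one_sided_continuous_at_discontinuities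
    (radial_average (scaled_indicator (c i) (A i)) xh))
  (hZ : forall i j, i != j -> locally_finite_sign_changes
    (average_difference a (fun l => scaled_indicator (c l) (A l)) xh i j)) :
  [/\ forall i j, i != j -> diffusive_sign_defined (u i) (u j) xh,
      reflexive (diffusive_rel u xh) /\ transitive (diffusive_rel u xh) &
      forall i,
        [set x | forall j, j != i ->
           (ess_dist x (A i) <
              (1 / diffusivity_ratio a i j)%:E * ess_dist x (A j))%E]
        `<=` (classification_set u i)°].
Proof.
have k0 i j : 0 < diffusivity_ratio a i j by rewrite sqrtr_gt0 divr_gt0.
have sign i j : exists s, \forall t \near 0^'+, Num.sg (u i xh t - u j xh t) = s.
  have [->|ij] := eqVneq i j.
    by exists 0; apply: nearW => t; rewrite subrr sgr0.
  exact: (radial_eventual_sign hd hT (mA i) (mA j) (ha i) (ha j) (hc i) (hc j)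
    (hu i) (hu j) (hZ i j ij)).
split.
- by move=> i j _; have [s /diffusive_signE[]] := sign i j.
- have relE i j : diffusive_rel u xh i j ->
      \forall t \near 0^'+, 0 <= u i xh t - u j xh t.
    have [s uij] := sign i j; have [_ es] := diffusive_signE uij.
    rewrite /diffusive_rel es => s0; apply: filterS uij => t st.
    by rewrite -sgr_ge0 st.
  split; first move=> i.
    rewrite /diffusive_rel (_ : diffusive_sign _ _ _ = 0) //.
    by apply: (diffusive_signE _).2; apply: nearW => t; rewrite subrr sgr0.
  move=> j i l ij jl; have [s uil] := sign i l; have [_ es] := diffusive_signE uil.
  have both : \forall t \near 0^'+, Num.sg (u i xh t - u l xh t) = s /\
      0 <= u i xh t - u j xh t /\ 0 <= u j xh t - u l xh t.
    exact: filterI uil (filterI (relE _ _ ij) (relE _ _ jl)).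
  have [t [ts [ij0 jl0]]] : exists t, Num.sg (u i xh t - u l xh t) = s /\
      0 <= u i xh t - u j xh t /\ 0 <= u j xh t - u l xh t.
    exact: (@filter_ex _ _ (at_right_proper_filter (0 : R)) _ both).
  rewrite /diffusive_rel es -ts sgr_ge0.
  rewrite -[u i xh t](subrK (u j xh t)) -addrA.
  exact: addr_ge0.
(* the set [W] lies between the two sets and is open *)
move=> i; pose W := [set x | forall j, j != i ->
  closer_than (diffusivity_ratio a i j) (A i) (A j) x].
apply: (@subset_trans _ W).
  by move=> x xi j ji; apply: ess_dist_closer_than => //; exact: xi.
move=> x Wx; pose closer j y := j != i -> closer_than (diffusivity_ratio a i j) (A i) (A j) y.
have near_closer j : \forall y \near x, closer j y.
  have [->|ji] := eqVneq j i; first by apply: filterE => y; rewrite /closer eqxx.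
  by apply: filterS (closer_than_near (k0 i j) (Wx j ji)) => y ? _.
have : \forall y \near x, forall j, closer j y.
  exact: (@filter_forall _ _ closer _ (nbhs_filter x) near_closer).
apply: filterS => y Wy j ji; have [rho [rho' [An0 A'0 lt]]] := Wy j ji.
apply: diffusive_signE.
exact: (closer_eventual_sign hT (mA i) (mA j) (ha i) (ha j) (hc i) (hc j)
  (hu i) (hu j) An0 A'0 lt).
Qed.
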